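(* $\mathrm{BZFC}$ and $\mathrm{ZFC}$ are bi-interpretable, via the classes $\mathbb W$ and $\mathbb{HCL}$, both semantically and syntactically. That is: (1) $\mathrm{ZFC}$ proves $\mathbb W\models\mathrm{BZFC}$ (axiom by axiom), and $\mathrm{ZFC}$ proves that, with $\mathbb{HCL}^{\mathbb W}=\{x\in\mathbb W:\mathbb W\models x\in\mathbb{HCL}\}$, the structure $(\mathbb{HCL}^{\mathbb W},\in^+,\in^-,=^+,=^-)$ is isomorphic to $(V,\in,\notin,=,\neq)$ by a definable class isomorphism. (2) $\mathrm{BZFC}$ proves $\mathbb{HCL}\models\mathrm{ZFC}$ (axiom by axiom), and $\mathrm{BZFC}$ proves that the structure $(\mathbb W^{\mathbb{HCL}},\in^+,\in^-,=^+,=^-)$, i.e. the class $\mathbb W$ with its four relations as computed in $\mathbb{HCL}$, is isomorphic to $(V,\in,\notin,=,\neq)$ by a definable class isomorphism. (3) For every sentence $\varphi$ of the language of set theory: $\mathrm{ZFC}\vdash\varphi$ iff $\mathrm{BZFC}\vdash_{BS4}(\mathbb{HCL}\models\varphi)$; and $\mathrm{BZFC}\vdash_{BS4}\varphi$ iff $\mathrm{ZFC}\vdash(\mathbb W\models\varphi)$.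
   Context: LOGIC BS4. BS4 is a four-valued first-order logic with primitive symbols $\sim$ (native negation), $\wedge,\vee,\to,\bot,\forall,\exists,=$; $\varphi\leftrightarrow\psi$ is $(\varphi\to\psi)\wedge(\psi\to\varphi)$. Vocabularies contain only constant and relation symbols. A T/F-model $\mathcal M$ has a (nonempty) domain $M$, an element $c^{\mathcal M}\in M$ for each constant, for each $n$-ary relation symbol $R$ two sets $(R^{\mathcal M})^+,(R^{\mathcal M})^-\subseteq M^n$ (with no relation assumed between them), the relation $=^+$ which is true identity on $M$, and a symmetric binary relation $=^-$ on $M$. Truth $\models^T$ and falsity $\models^F$ are defined recursively: an atomic formula is true iff its $+$ interpretation holds and false iff its $-$ interpretation holds; $\sim\varphi$ is true iff $\varphi$ is false, and false iff $\varphi$ is true; $\varphi\wedge\psi$ is true iff both are true, false iff at least one is false; $\varphi\vee\psi$ is true iff at least one is true, false iff both are false; $\varphi\to\psi$ is true iff ($\varphi$ true implies $\psi$ true), false iff $\varphi$ is true and $\psi$ is false; $\exists x\varphi$ is true iff some instance is true, false iff all instances are false; $\forall x\varphi$ is true iff all instances are true, false iff some instance is false; $\bot$ is never true and always false. $\Sigma\vdash_{BS4}\varphi$ means: for every T/F-model $\mathcal M$, if $\mathcal M\models^T\Sigma$ then $\mathcal M\models^T\varphi$ (there is a sound and complete Hilbert calculus for this relation). ABBREVIATIONS. $\varphi\Rightarrow\psi$ is $(\varphi\to\psi)\wedge(\sim\psi\to\sim\varphi)$; $\varphi\Leftrightarrow\psi$ is $(\varphi\leftrightarrow\psi)\wedge(\sim\varphi\leftrightarrow\sim\psi)$;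 $\neg\varphi$ is $\varphi\to\bot$; $!\varphi$ is $\sim\neg\varphi$; $?\varphi$ is $\neg\sim\varphi$; $\circ\varphi$ is $!\varphi\leftrightarrow{?}\varphi$ (''$\varphi$ is classical''). $x\neq y$, $x\notin y$, $x\not\subseteq y$ are $\sim(x=y)$, $\sim(x\in y)$, $\sim(x\subseteq y)$. In ZFC, $\sim$ is read as ordinary classical negation. SETS. The language is $\{\in\}$. $x=\{y:\varphi(y)\}$ abbreviates $\forall y(y\in x\Leftrightarrow\varphi(y))$. $x\subseteq y$ is $\forall z(z\in x\Rightarrow z\in y)$. $x^!=\{y:{!}(y\in x)\}$, $x^?=\{y:{?}(y\in x)\}$. A set $x$ is classical if $\forall y(y\in x^!\leftrightarrow y\in x^?)$. $\{u_0,\dots,u_n\}=\{y:{!}(y=u_0)\vee\dots\vee{!}(y=u_n)\}$. $\langle u,v\rangle=\{\{u\},\{u,v\}\}$; the ordered pair $(a,b)$ is the set with $(a,b)^!=\{\langle x,\varnothing\rangle:x\in a^!\}\cup\{\langle y,\{\varnothing\}\rangle:y\in b^!\}$ and $(a,b)^?$ given likewise from $a^?,b^?$. $A\times B=\{(a,b):a\in A\wedge b\in B\}$; $\mathrm{dom}(R)=\{x:\exists y\,(x,y)\in R\}$. For a classical set $A$, a classical function from $A$ to $B$ is a classical set $f\subseteq A\times B$ with $\mathrm{dom}(f)=A$ and $\forall x\forall y\forall z(((x,y)\in f\wedge(x,z)\in f)\to{!}(y=z))$. AXIOMS OF PZFC (in BS4; schemas for all formulas $\varphi$, with parameters). Extensionality: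 $\forall x\forall y(x=y\Leftrightarrow\forall z(z\in x\Leftrightarrow z\in y))$. Comprehension: $\forall u\exists x\forall y(y\in x\Leftrightarrow(y\in u\wedge\varphi(y)))$. Classical Superset: $\forall x\exists C(x\subseteq C\wedge\forall y\,{\circ}(y\in C))$. Replacement: $[\forall x\forall y\,{\circ}\varphi(x,y)\wedge\forall x\exists y(\varphi(x,y)\wedge\forall z(\varphi(x,z)\to{!}(y=z)))]\to\forall x\exists y\forall z(z\in y\Leftrightarrow\exists w(w\in x\wedge\varphi(w,z)))$. Pairing: $\forall u\forall v\exists x\forall y(y\in x\Leftrightarrow({!}(y=u)\vee{!}(y=v)))$. Power Set: $\forall u\exists v\forall x(x\in v\Leftrightarrow{!}(x\subseteq u))$. Union: $\forall u\exists x\forall y(y\in x\Leftrightarrow\exists z(y\in z\wedge z\in u))$. Infinity: $\exists x(\varnothing\in x\wedge\forall y(y\in x\to y\cup\{y\}\in x))$. Foundation: $\forall x(\forall y(y\in x^!\cup x^?\to\varphi(y))\to\varphi(x))\to\forall u\,\varphi(u)$. Choice: for every classical $u$, if $\forall x(x\in u\to\exists y(y\in x))$ then there is a classical function $f$ with $\mathrm{dom}(f)=u$ and $f(x)\in x$ for all $x\in u$. ACLA: $\exists x(x^!\not\subseteq x^?)\wedge\exists x(x^?\not\subseteq x^!)$. $\mathrm{BZFC}$ is $\mathrm{PZFC}+\mathrm{ACLA}$. THE CLASS $\mathbb W$ (defined in ZFC, with an ordinary ordered pair). $W_0=\varnothing$, $W_{\alpha+1}=\mathscr P(W_\alpha)\times\mathscr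 P(W_\alpha)$, $W_\lambda=\bigcup_{\alpha<\lambda}W_\alpha$ for limit $\lambda$, $\mathbb W=\bigcup_{\alpha\in\mathrm{Ord}}W_\alpha$. On $\mathbb W$: $(a,b)\in^+(c,d)$ iff $(a,b)\in c$; $(a,b)\in^-(c,d)$ iff $(a,b)\notin d$; $(a,b)=^+(c,d)$ iff $(a,b)=(c,d)$; $(a,b)=^-(c,d)$ iff $\exists z\in a\setminus d$ or $\exists z\in c\setminus b$. For each formula $\varphi$, $\varphi^{\mathbb W,T}$ and $\varphi^{\mathbb W,F}$ are the formulas of ZFC obtained by the recursive truth and falsity clauses above applied to the class-sized T/F-model $(\mathbb W,\in^+,\in^-,=^+,=^-)$; $\mathbb W\models\varphi$ stands for $\varphi^{\mathbb W,T}$. THE CLASS $\mathbb{HCL}$ (defined in BZFC). An ordinal is a classical set $\alpha$ all of whose members are classical, such that $\beta\in\alpha\to\beta\subseteq\alpha$, and $(\beta\in\alpha\wedge\gamma\in\alpha)\to(\beta\in\gamma\vee\gamma\in\beta\vee\beta=\gamma)$. $\mathrm{HCL}_0=\varnothing$; $\mathrm{HCL}_{\alpha+1}=\{X\subseteq\mathrm{HCL}_\alpha: X\text{ is classical}\}$ (formed by selecting the classical sets from the classical set $\{X:{!}(X\subseteq\mathrm{HCL}_\alpha)\}$); $\mathrm{HCL}_\lambda=\bigcup_{\alpha<\lambda}\mathrm{HCL}_\alpha$ for limit $\lambda$; $\mathbb{HCL}=\bigcup_{\alpha\in\mathrm{Ord}}\mathrm{HCL}_\alpha$. $\mathbb{HCL}\models\varphi$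 stands for $\varphi$ with all quantifiers restricted to $\mathbb{HCL}$. CONVENTIONS. $V$ is the universe. In BZFC, a class isomorphism is a bijective operation (given by a classical formula, see the hypothesis of Replacement) $j$ with $x\in y\leftrightarrow j(x)\in^+j(y)$, $x\notin y\leftrightarrow j(x)\in^-j(y)$, $x=y\leftrightarrow j(x)=^+j(y)$, $x\neq y\leftrightarrow j(x)=^-j(y)$; similarly in ZFC. *)

(* Defs.v *)
From Stdlib Require Import List Arith.
Import ListNotations.

(** * Formulas in the language {∈}, with de Bruijn variables

    BS4 and classical first-order logic share this syntax; classically [fNeg]
    is ordinary negation. *)

Inductive form : Type :=
| fIn  : nat -> nat -> form
| fEq  : nat -> nat -> form
| fBot : form
| fNeg : form -> form
| fAnd : form -> form -> form
| fOr  : form -> form -> form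
| fImp : form -> form -> form
| fAll : form -> form
| fEx  : form -> form.

Definition up (r : nat -> nat) (i : nat) : nat :=
  match i with 0 => 0 | S j => S (r j) end.

Fixpoint ren (r : nat -> nat) (p : form) : form :=
  match p with
  | fIn i j => fIn (r i) (r j)
  | fEq i j => fEq (r i) (r j)
  | fBot => fBot
  | fNeg p => fNeg (ren r p)
  | fAnd p q => fAnd (ren r p) (ren r q)
  | fOr p q => fOr (ren r p) (ren r q)
  | fImp p q => fImp (ren r p) (ren r q)
  | fAll p => fAll (ren (up r) p)
  | fEx p => fEx (ren (up r) p)
  end.

Definition shift : form -> form := ren S.

Definition inst (k : nat) : form -> form :=
  ren (fun i => match i with 0 => k | S j => j end).

(** All free variables of [p] are [< fvb p], and [fvb p] is least such. *)
Fixpoint fvb (p : form) : nat :=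
  match p with
  | fIn i j | fEq i j => Nat.max (S i) (S j)
  | fBot => 0
  | fNeg p => fvb p
  | fAnd p q | fOr p q | fImp p q => Nat.max (fvb p) (fvb q)
  | fAll p | fEx p => Nat.pred (fvb p)
  end.

Definition sentence (p : form) : Prop := fvb p = 0.

Definition closure (p : form) : form := Nat.iter (fvb p) fAll p.

Definition theory := form -> Prop.

(** * The logic BS4 *)

Record TFmodel : Type := {
  dom :> Type;
  point : dom;
  inT : dom -> dom -> Prop;
  inF : dom -> dom -> Prop;
  neq : dom -> dom -> Prop;
  neq_sym : forall a b, neq a b -> neq b a
}.

Definition scons {D : Type} (d : D) (s : nat -> D) (i : nat) : D :=
  match i with 0 => d | S j => s j end.

Fixpoint satT (M : TFmodel) (s : nat -> M) (p : form) {struct p} : Prop :=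
  match p with
  | fIn i j => inT M (s i) (s j)
  | fEq i j => s i = s j
  | fBot => False
  | fNeg p => satF M s p
  | fAnd p q => satT M s p /\ satT M s q
  | fOr p q => satT M s p \/ satT M s q
  | fImp p q => satT M s p -> satT M s q
  | fAll p => forall d : M, satT M (scons d s) p
  | fEx p => exists d : M, satT M (scons d s) p
  end
with satF (M : TFmodel) (s : nat -> M) (p : form) {struct p} : Prop :=
  match p with
  | fIn i j => inF M (s i) (s j)
  | fEq i j => neq M (s i) (s j)
  | fBot => True
  | fNeg p => satT M s p
  | fAnd p q => satF M s p \/ satF M s q
  | fOr p q => satF M s p /\ satF M s q
  | fImp p q => satT M s p /\ satF M s q
  | fAll p => exists d : M, satF M (scons d s) p
  | fEx p => forall d : M, satF M (scons d s) p
  end.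

Definition modelsT (M : TFmodel) (p : form) : Prop :=
  forall s : nat -> M, satT M s p.

Definition BS4_proves (T : theory) (p : form) : Prop :=
  forall M : TFmodel, (forall q, T q -> modelsT M q) -> modelsT M p.

(** * Classical first-order logic with equality: natural deduction *)

Inductive nd : list form -> form -> Prop :=
| nd_ax G p : In p G -> nd G p
| nd_botE G p : nd G fBot -> nd G p
| nd_negI G p : nd (p :: G) fBot -> nd G (fNeg p)
| nd_negE G p : nd G p -> nd G (fNeg p) -> nd G fBot
| nd_raa G p : nd (fNeg p :: G) fBot -> nd G p
| nd_andI G p q : nd G p -> nd G q -> nd G (fAnd p q)
| nd_andE1 G p q : nd G (fAnd p q) -> nd G p
| nd_andE2 G p q : nd G (fAnd p q) -> nd G q
| nd_orI1 G p q : nd G p -> nd G (fOr p q)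
| nd_orI2 G p q : nd G q -> nd G (fOr p q)
| nd_orE G p q r : nd G (fOr p q) -> nd (p :: G) r -> nd (q :: G) r -> nd G r
| nd_impI G p q : nd (p :: G) q -> nd G (fImp p q)
| nd_impE G p q : nd G (fImp p q) -> nd G p -> nd G q
| nd_allI G p : nd (map shift G) p -> nd G (fAll p)
| nd_allE G p k : nd G (fAll p) -> nd G (inst k p)
| nd_exI G p k : nd G (inst k p) -> nd G (fEx p)
| nd_exE G p q : nd G (fEx p) -> nd (p :: map shift G) (shift q) -> nd G q
| nd_eqI G k : nd G (fEq k k)
| nd_eqE G p i j : nd G (fEq i j) -> nd G (inst i p) -> nd G (inst j p).

Definition CL_proves (T : theory) (p : form) : Prop :=
  exists G : list form, (forall q, In q G -> T q) /\ nd G p.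

(** * Writing formulas with named bound variables

    An [sform] gives the de Bruijn formula to put under [n] binders, for each
    [n]. Its variables are de Bruijn levels: level [l] is the variable bound
    by the [l]-th binder from outside, i.e. index [n - S l] at depth [n].
    Hence abbreviations take variables as arguments without any shifting. *)

Definition sform := nat -> form.

Definition sIn (x y : nat) : sform := fun n => fIn (n - S x) (n - S y).
Definition sEq (x y : nat) : sform := fun n => fEq (n - S x) (n - S y).
Definition sBot : sform := fun _ => fBot.
Definition sNeg (p : sform) : sform := fun n => fNeg (p n).
Definition sAnd (p q : sform) : sform := fun n => fAnd (p n) (q n).
Definition sOr (p q : sform) : sform := fun n => fOr (p n) (q n).
Definition sImp (p q : sform) : sform := fun n => fImp (p n) (q n).
Definition sAll (p : nat -> sform) : sform := fun n => fAll (p n (S n)).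
Definition sEx (p : nat -> sform) : sform := fun n => fEx (p n (S n)).

(** [p] with its variables [0, 1, ..] replaced by [args]; the remaining
    variables of [p] become parameters, free in the whole formula. *)
Definition app (p : form) (args : list nat) : sform := fun n =>
  ren (fun i => match nth_error args i with
                | Some l => n - S l
                | None => n + (i - length args)
                end) p.

(** A class or a binary relation, as a formula in the variables [0] (and [1]). *)
Definition class1 (p : nat -> sform) : form := p 0 1.
Definition class2 (p : nat -> nat -> sform) : form := p 1 0 2.

Definition axiom (p : sform) : form := closure (p 0).

Definition sIff (p q : sform) := sAnd (sImp p q) (sImp q p).
Definition sSImp (p q : sform) := sAnd (sImp p q) (sImp (sNeg q) (sNeg p)).
Definition sSIff (p q : sform) := sAnd (sIff p q) (sIff (sNeg p) (sNeg q)).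
Definition sNot (p : sform) := sImp p sBot.
Definition bang (p : sform) := sNeg (sNot p).
Definition quest (p : sform) := sNot (sNeg p).
Definition circ (p : sform) := sIff (bang p) (quest p).

Declare Scope sform_scope.
Delimit Scope sform_scope with sf.
Bind Scope sform_scope with sform.

Notation "x ∈ y" := (sIn x y) (at level 70, no associativity) : sform_scope.
Notation "x ∉ y" := (sNeg (sIn x y)) (at level 70, no associativity) : sform_scope.
Notation "x ≐ y" := (sEq x y) (at level 70, no associativity) : sform_scope.
Notation "x ≠ y" := (sNeg (sEq x y)) (at level 70, no associativity) : sform_scope.
Notation "⊥" := sBot : sform_scope.
Notation "∼ p" := (sNeg p) (at level 75, right associativity) : sform_scope.
Notation "p ∧ q" := (sAnd p q) (at level 80, right associativity) : sform_scope.
Notation "p ∨ q" := (sOr p q) (at level 85, right associativity) : sform_scope.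
Notation "p → q" := (sImp p q)
  (at level 99, q at level 200, right associativity) : sform_scope.
Notation "p ⇒ q" := (sSImp p q)
  (at level 99, q at level 200, right associativity) : sform_scope.
Notation "p ↔ q" := (sIff p q) (at level 95, no associativity) : sform_scope.
Notation "p ⇔ q" := (sSIff p q) (at level 95, no associativity) : sform_scope.
Notation "∀ x .. y , p" := (sAll (fun x => .. (sAll (fun y => p%sf)) ..))
  (at level 10, x binder, y binder, p at level 200) : sform_scope.
Notation "∃ x .. y , p" := (sEx (fun x => .. (sEx (fun y => p%sf)) ..))
  (at level 10, x binder, y binder, p at level 200) : sform_scope.

Local Open Scope sform_scope.

(** * Set-theoretic abbreviations in BS4

    [is_t x ..] says that [x] is the set denoted by the term [t(..)]. A term
    [t] is eliminated from a formula [p(t)] as [∃ x, bang (is_t x) ∧ p(x)]: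
    with [bang], this has exactly the truth and the falsity conditions of
    [p] at the value of [t]. Likewise, [{t(x) : p(x)}] is
    [{z : ∃ x, bang (is_t z x) ∧ p(x)}]. *)

Definition is_set (x : nat) (p : nat -> sform) : sform := ∀ y, y ∈ x ⇔ p y.

Definition sub (x y : nat) : sform := ∀ z, z ∈ x ⇒ z ∈ y.
Definition classical (x : nat) : sform := ∀ y, bang (y ∈ x) ↔ quest (y ∈ x).
Definition is_empty (x : nat) : sform := is_set x (fun _ => ⊥).
Definition is_sing (x u : nat) : sform := is_set x (fun y => bang (y ≐ u)).
Definition is_upair (x u v : nat) : sform :=
  is_set x (fun y => bang (y ≐ u) ∨ bang (y ≐ v)).
(** [y ∪ {y}] *)
Definition is_succ (x y : nat) : sform :=
  is_set x (fun z => z ∈ y ∨ bang (z ≐ y)).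
(** [⟨u,v⟩] *)
Definition is_kpair (x u v : nat) : sform :=
  is_set x (fun y => bang (is_sing y u) ∨ bang (is_upair y u v)).
(** [⟨x,∅⟩] and [⟨x,{∅}⟩] *)
Definition is_tag0 (z x : nat) : sform :=
  ∃ e, bang (is_empty e) ∧ is_kpair z x e.
Definition is_tag1 (z x : nat) : sform :=
  ∃ e o, bang (is_empty e) ∧ bang (is_sing o e) ∧ is_kpair z x o.
(** [(a,b)] *)
Definition is_pair (p a b : nat) : sform :=
  (∀ z, bang (z ∈ p) ⇔
     ((∃ x, bang (is_tag0 z x) ∧ bang (x ∈ a)) ∨
      (∃ y, bang (is_tag1 z y) ∧ bang (y ∈ b)))) ∧
  (∀ z, quest (z ∈ p) ⇔
     ((∃ x, bang (is_tag0 z x) ∧ quest (x ∈ a)) ∨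
      (∃ y, bang (is_tag1 z y) ∧ quest (y ∈ b)))).
(** [(x,y) ∈ r] and [z ∈ a × b] *)
Definition pair_in (x y r : nat) : sform :=
  ∃ p, bang (is_pair p x y) ∧ p ∈ r.
Definition in_prod (z a b : nat) : sform :=
  ∃ x y, bang (is_pair z x y) ∧ x ∈ a ∧ y ∈ b.
(** [f] is a classical function from [a] to [b]. *)
Definition classical_fun (f a b : nat) : sform :=
  classical a ∧ classical f ∧
  (∀ z, z ∈ f ⇒ in_prod z a b) ∧
  is_set a (fun x => ∃ y, pair_in x y f) ∧
  (∀ x y z, (pair_in x y f ∧ pair_in x z f) → bang (y ≐ z)).

(** * The theory BZFC *)

Definition ax_ext : form :=
  axiom (∀ x y, x ≐ y ⇔ (∀ z, z ∈ x ⇔ z ∈ y)).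
Definition ax_compr (p : form) : form :=
  axiom (∀ u, ∃ x, ∀ y, y ∈ x ⇔ (y ∈ u ∧ app p [y])).
Definition ax_superset : form :=
  axiom (∀ x, ∃ c, sub x c ∧ ∀ y, circ (y ∈ c)).
Definition ax_repl (p : form) : form :=
  axiom (((∀ x y, circ (app p [x; y])) ∧
          (∀ x, ∃ y, app p [x; y] ∧ ∀ z, app p [x; z] → bang (y ≐ z))) →
         ∀ x, ∃ y, ∀ z, z ∈ y ⇔ (∃ w, w ∈ x ∧ app p [w; z])).
Definition ax_pairing : form :=
  axiom (∀ u v, ∃ x, ∀ y, y ∈ x ⇔ (bang (y ≐ u) ∨ bang (y ≐ v))).
Definition ax_power : form :=
  axiom (∀ u, ∃ v, ∀ x, x ∈ v ⇔ bang (sub x u)).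
Definition ax_union : form :=
  axiom (∀ u, ∃ x, ∀ y, y ∈ x ⇔ (∃ z, y ∈ z ∧ z ∈ u)).
Definition ax_infinity : form :=
  axiom (∃ x, (∃ e, bang (is_empty e) ∧ e ∈ x) ∧
              ∀ y, y ∈ x → ∃ s, bang (is_succ s y) ∧ s ∈ x).
Definition ax_foundation (p : form) : form :=
  axiom ((∀ x, (∀ y, (bang (y ∈ x) ∨ quest (y ∈ x)) → app p [y]) → app p [x]) →
         ∀ u, app p [u]).
Definition ax_choice : form :=
  axiom (∀ u, classical u → (∀ x, x ∈ u → ∃ y, y ∈ x) →
         ∃ f, (∃ b, classical_fun f u b) ∧
              ∀ x, x ∈ u → ∃ y, pair_in x y f ∧ y ∈ x).
Definition ax_acla : form :=
  axiom ((∃ x, ∼ (∀ z, bang (z ∈ x) ⇒ quest (z ∈ x))) ∧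
         (∃ x, ∼ (∀ z, quest (z ∈ x) ⇒ bang (z ∈ x)))).

Inductive PZFC : theory :=
| PZFC_ext : PZFC ax_ext
| PZFC_compr p : PZFC (ax_compr p)
| PZFC_superset : PZFC ax_superset
| PZFC_repl p : PZFC (ax_repl p)
| PZFC_pairing : PZFC ax_pairing
| PZFC_power : PZFC ax_power
| PZFC_union : PZFC ax_union
| PZFC_infinity : PZFC ax_infinity
| PZFC_foundation p : PZFC (ax_foundation p)
| PZFC_choice : PZFC ax_choice.

Definition BZFC : theory := fun p => PZFC p \/ p = ax_acla.

(** * The theory ZFC *)

Definition zis_set (x : nat) (p : nat -> sform) : sform := ∀ y, y ∈ x ↔ p y.
Definition zsub (x y : nat) : sform := ∀ z, z ∈ x → z ∈ y.
Definition zis_empty (x : nat) : sform := zis_set x (fun _ => ⊥).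
Definition zis_sing (x u : nat) : sform := zis_set x (fun y => y ≐ u).
Definition zis_upair (x u v : nat) : sform :=
  zis_set x (fun y => y ≐ u ∨ y ≐ v).
Definition zis_succ (x y : nat) : sform :=
  zis_set x (fun z => z ∈ y ∨ z ≐ y).
(** Kuratowski's ordered pair *)
Definition zis_pair (x u v : nat) : sform :=
  zis_set x (fun y => zis_sing y u ∨ zis_upair y u v).
Definition zpair_in (x y r : nat) : sform := ∃ p, zis_pair p x y ∧ p ∈ r.
(** [f] is a function with domain [a]. *)
Definition zis_fun (f a : nat) : sform :=
  (∀ p, p ∈ f → ∃ x y, zis_pair p x y ∧ x ∈ a) ∧
  (∀ x, x ∈ a → ∃ y, zpair_in x y f) ∧
  (∀ x y z, (zpair_in x y f ∧ zpair_in x z f) → y ≐ z).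

Definition zax_ext : form :=
  axiom (∀ x y, (∀ z, z ∈ x ↔ z ∈ y) → x ≐ y).
Definition zax_sep (p : form) : form :=
  axiom (∀ u, ∃ x, ∀ y, y ∈ x ↔ (y ∈ u ∧ app p [y])).
Definition zax_repl (p : form) : form :=
  axiom ((∀ x y z, (app p [x; y] ∧ app p [x; z]) → y ≐ z) →
         ∀ u, ∃ v, ∀ y, y ∈ v ↔ (∃ x, x ∈ u ∧ app p [x; y])).
Definition zax_pairing : form :=
  axiom (∀ u v, ∃ x, ∀ y, y ∈ x ↔ (y ≐ u ∨ y ≐ v)).
Definition zax_power : form :=
  axiom (∀ u, ∃ v, ∀ x, x ∈ v ↔ zsub x u).
Definition zax_union : form :=
  axiom (∀ u, ∃ x, ∀ y, y ∈ x ↔ (∃ z, y ∈ z ∧ z ∈ u)).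
Definition zax_infinity : form :=
  axiom (∃ x, (∃ e, zis_empty e ∧ e ∈ x) ∧
              ∀ y, y ∈ x → ∃ s, zis_succ s y ∧ s ∈ x).
Definition zax_foundation : form :=
  axiom (∀ x, (∃ y, y ∈ x) → ∃ y, y ∈ x ∧ ∼ (∃ z, z ∈ x ∧ z ∈ y)).
Definition zax_choice : form :=
  axiom (∀ u, (∀ x, x ∈ u → ∃ y, y ∈ x) →
         ∃ f, zis_fun f u ∧ ∀ x, x ∈ u → ∃ y, zpair_in x y f ∧ y ∈ x).

Inductive ZFC : theory :=
| ZFC_ext : ZFC zax_ext
| ZFC_sep p : ZFC (zax_sep p)
| ZFC_repl p : ZFC (zax_repl p)
| ZFC_pairing : ZFC zax_pairing
| ZFC_power : ZFC zax_power
| ZFC_union : ZFC zax_union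
| ZFC_infinity : ZFC zax_infinity
| ZFC_foundation : ZFC zax_foundation
| ZFC_choice : ZFC zax_choice.

(** * The class 𝕎, in ZFC *)

Definition zord (a : nat) : sform :=
  (∀ b, b ∈ a → zsub b a) ∧
  (∀ b c, (b ∈ a ∧ c ∈ a) → b ∈ c ∨ c ∈ b ∨ b ≐ c).
(** For an ordinal [a]. *)
Definition zlim (a : nat) : sform :=
  (∃ b, b ∈ a) ∧ ∀ b, b ∈ a → ∃ s, zis_succ s b ∧ s ∈ a.

(** [f] satisfies the recursion defining [α ↦ W_α]. *)
Definition W_rec (f : nat) : sform :=
  ∀ b v, zpair_in b v f →
    (zis_empty b ∧ zis_empty v) ∨
    (∃ c w, zis_succ b c ∧ zpair_in c w f ∧
       zis_set v (fun z => ∃ x y, zis_pair z x y ∧ zsub x w ∧ zsub y w)) ∨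
    (zlim b ∧
       zis_set v (fun z => ∃ c w, c ∈ b ∧ zpair_in c w f ∧ z ∈ w)).
(** [v = W_a]; the recursion is run on the domain [a ∪ {a}]. *)
Definition is_W_at (a v : nat) : sform :=
  zord a ∧ ∃ d f, zis_succ d a ∧ zis_fun f d ∧ W_rec f ∧ zpair_in a v f.

Definition W : form := class1 (fun x => ∃ a v, is_W_at a v ∧ x ∈ v).
Definition W_in : form := class2 (fun x y =>
  ∃ c d, zis_pair y c d ∧ x ∈ c).
Definition W_notin : form := class2 (fun x y =>
  ∃ c d, zis_pair y c d ∧ x ∉ d).
Definition W_eq : form := class2 (fun x y => x ≐ y).
Definition W_neq : form := class2 (fun x y =>
  ∃ a b c d, zis_pair x a b ∧ zis_pair y c d ∧
    ((∃ z, z ∈ a ∧ z ∉ d) ∨ (∃ z, z ∈ c ∧ z ∉ b))).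

Definition apply2 (r : form) (i j : nat) : form :=
  ren (fun k => match k with 0 => i | _ => j end) r.

(** The formulas [φ^{𝕎,T}] and [φ^{𝕎,F}]. The bound variable of a quantifier
    has index 0, so [W] as it stands says that it is in 𝕎. *)
Fixpoint W_T (p : form) : form :=
  match p with
  | fIn i j => apply2 W_in i j
  | fEq i j => apply2 W_eq i j
  | fBot => fBot
  | fNeg p => W_F p
  | fAnd p q => fAnd (W_T p) (W_T q)
  | fOr p q => fOr (W_T p) (W_T q)
  | fImp p q => fImp (W_T p) (W_T q)
  | fAll p => fAll (fImp W (W_T p))
  | fEx p => fEx (fAnd W (W_T p))
  end
with W_F (p : form) : form :=
  match p with
  | fIn i j => apply2 W_notin i j
  | fEq i j => apply2 W_neq i j
  | fBot => fNeg fBot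
  | fNeg p => W_T p
  | fAnd p q => fOr (W_F p) (W_F q)
  | fOr p q => fAnd (W_F p) (W_F q)
  | fImp p q => fAnd (W_T p) (W_F q)
  | fAll p => fEx (fAnd W (W_F p))
  | fEx p => fAll (fImp W (W_F p))
  end.

(** * The class ℍℂ𝕃, in BZFC *)

Definition ord (a : nat) : sform :=
  classical a ∧ (∀ b, b ∈ a → classical b) ∧
  (∀ b, b ∈ a → sub b a) ∧
  (∀ b c, (b ∈ a ∧ c ∈ a) → b ∈ c ∨ c ∈ b ∨ b ≐ c).
(** For an ordinal [a]. *)
Definition lim (a : nat) : sform :=
  (∃ b, b ∈ a) ∧ ∀ b, b ∈ a → ∃ s, bang (is_succ s b) ∧ s ∈ a.

(** [f] satisfies the recursion defining [α ↦ HCL_α]. *)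
Definition HCL_rec (f : nat) : sform :=
  ∀ b v, pair_in b v f →
    (is_empty b ∧ is_empty v) ∨
    (∃ c w, is_succ b c ∧ pair_in c w f ∧
       is_set v (fun x => bang (sub x w) ∧ classical x)) ∨
    (lim b ∧
       is_set v (fun z => ∃ c w, c ∈ b ∧ pair_in c w f ∧ z ∈ w)).
Definition is_HCL_at (a v : nat) : sform :=
  ord a ∧ ∃ d f, is_succ d a ∧ (∃ b, classical_fun f d b) ∧
                 HCL_rec f ∧ pair_in a v f.

(** [bang] makes this a classical formula, i.e. one that is false exactly when
    it is not true, so that a quantifier relativized to [HCL] ranges over
    ℍℂ𝕃 in its falsity condition too. *)
Definition HCL : form := class1 (fun x => bang (∃ a v, is_HCL_at a v ∧ x ∈ v)).

(** [φ] with its quantifiers restricted to ℍℂ𝕃. *)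
Fixpoint HCL_rel (p : form) : form :=
  match p with
  | fIn i j => fIn i j
  | fEq i j => fEq i j
  | fBot => fBot
  | fNeg p => fNeg (HCL_rel p)
  | fAnd p q => fAnd (HCL_rel p) (HCL_rel q)
  | fOr p q => fOr (HCL_rel p) (HCL_rel q)
  | fImp p q => fImp (HCL_rel p) (HCL_rel q)
  | fAll p => fAll (fImp HCL (HCL_rel p))
  | fEx p => fEx (fAnd HCL (HCL_rel p))
  end.

(** * Class isomorphisms

    [j] is a bijective operation from [(V, ∈, ∉, =, ≠)] onto the class [c]
    equipped with [rin], [rnotin], [req], [rneq]. In classical logic, the
    first clause is a tautology and [bang] has no effect. *)

Definition class_iso (j c rin rnotin req rneq : form) : form :=
  axiom (
    (∀ x y, circ (app j [x; y])) ∧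
    (∀ x, ∃ y, app j [x; y] ∧ ∀ z, app j [x; z] → bang (y ≐ z)) ∧
    (∀ x y, app j [x; y] → app c [y]) ∧
    (∀ x x' y, (app j [x; y] ∧ app j [x'; y]) → bang (x ≐ x')) ∧
    (∀ y, app c [y] → ∃ x, app j [x; y]) ∧
    (∀ x y u v, (app j [x; u] ∧ app j [y; v]) →
       (x ∈ y ↔ app rin [u; v]) ∧ (x ∉ y ↔ app rnotin [u; v]) ∧
       (x ≐ y ↔ app req [u; v]) ∧ (x ≠ y ↔ app rneq [u; v]))).

(** ℍℂ𝕃^𝕎 *)
Definition HCL_in_W : form := fAnd W (W_T HCL).

(** 𝕎^ℍℂ𝕃 *)
Definition W_in_HCL : form := fAnd HCL (HCL_rel W).

(* Main.v *)
(** ZFC and BZFC are compared through their models: natural deduction is complete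
    for classical models, and BS4 is defined by T/F-models. A T/F-model of BZFC
    is a universe with two membership relations, [y ∊ x] (truth) and [y ∊? x]
    (non-falsity), and ACLA makes these two extensions of a set independent of
    each other. The hereditarily classical sets form a model of ZFC and coincide with
    HCL; conversely the pairs in W realise all pairs of extensions. Both
    isomorphisms are the recursion [j x = (j[x^!], j[x^?])] (with [x^! = x^?] in
    ZFC), which is definable without ordinals: [j x = y] iff some bisimulation
    relates [x] and [y]. Part (3) then follows by transporting truth
    along these isomorphisms. *)

From Stdlib Require Import List Arith Lia Classical ClassicalEpsilon.
From Stdlib Require Import FunctionalExtensionality PropExtensionality ProofIrrelevance Cantor.
Require Import Defs.
Import ListNotations.

(** Both theories have schemas, so a class inside a model yields a set only when it is definable
    there. [Def] records definability, with parameters, of predicates stated in Rocq; since →, ⊥ and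
    ∃ have classical truth conditions even in a T/F-model, [Def] is closed under all classical
    connectives, and set theory can be done directly on the models. What behaves like ordinary set
    theory in a T/F-model are the classical sets: [small P] says that [P] is the extension of one.
    The classes [WS0] and [WS] isolate principles about them that hold in both kinds of model, so
    that transitive closures, the hereditarily classical sets and the isomorphism [J] are developed
    once; a model of ZFC is the case where the two memberships agree. The main obstacle is that W
    and HCL are given by formulas that code a transfinite recursion, each with its own pairing.
    [hcl_iff] and [hcl_ind] replace the stages by closure under an operation on members, after which
    ordinals are no longer mentioned. *)

(** * Renaming of variables *)

Lemma ren_agree p : forall r r', (forall i, i < fvb p -> r i = r' i) -> ren r p = ren r' p.
Proof.
  induction p; cbn; intros r r' H; f_equal; auto; try (apply H; lia);
    try (apply IHp1; intros; apply H; lia); try (apply IHp2; intros; apply H; lia);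
    apply IHp; intros [|i] Hi; cbn; auto; f_equal; apply H; lia.
Qed.

Lemma ren_ext p r r' : (forall i, r i = r' i) -> ren r p = ren r' p.
Proof. intros H; apply ren_agree; auto. Qed.

Lemma ren_id p r : (forall i, i < fvb p -> r i = i) -> ren r p = p.
Proof.
  revert r; induction p; cbn; intros r H; f_equal; auto; try (apply H; lia);
    try (apply IHp1; intros; apply H; lia); try (apply IHp2; intros; apply H; lia);
    apply IHp; intros [|i] Hi; cbn; auto; f_equal; apply H; lia.
Qed.

Lemma ren_comp p : forall r q, ren r (ren q p) = ren (fun i => r (q i)) p.
Proof.
  induction p; cbn; intros; f_equal; auto;
    rewrite IHp; apply ren_ext; intros [|i]; reflexivity.
Qed.

Lemma ren_shift r p : ren (up r) (shift p) = shift (ren r p).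
Proof. unfold shift; rewrite !ren_comp; reflexivity. Qed.

Lemma map_ren_shift r G :
  map (ren (up r)) (map shift G) = map shift (map (ren r) G).
Proof. rewrite !map_map; apply map_ext; intros; apply ren_shift. Qed.

Lemma ren_inst r k p : ren r (inst k p) = inst (r k) (ren (up r) p).
Proof. unfold inst; rewrite !ren_comp; apply ren_ext; intros [|i]; reflexivity. Qed.

Lemma inst_ren_up k r p : inst k (ren (up r) p) = ren (scons k r) p.
Proof. unfold inst; rewrite !ren_comp; apply ren_ext; intros [|i]; reflexivity. Qed.

(** * Satisfaction *)

Lemma sat_agree (M : TFmodel) p : forall s s' : nat -> M,
  (forall i, i < fvb p -> s i = s' i) ->
  (satT M s p <-> satT M s' p) /\ (satF M s p <-> satF M s' p).
Proof.
  induction p; cbn; intros s s' H;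
    try (rewrite !H by lia; tauto);
    try (destruct (IHp s s' H); tauto);
    try (destruct (IHp1 s s'), (IHp2 s s'); try tauto; intros; apply H; lia);
    try tauto;
    assert (E : forall d i, i < fvb p -> scons d s i = scons d s' i)
      by (intros d [|i] Hi; cbn; auto; apply H; lia);
    split; split;
    first [ intros [d Hd]; exists d | intros Hd d; specialize (Hd d) ];
    destruct (IHp _ _ (E d)); tauto.
Qed.

Lemma scons_up {D : Type} (d : D) s r :
  (fun i => scons d s (up r i)) = scons d (fun i => s (r i)).
Proof. apply functional_extensionality; intros [|i]; reflexivity. Qed.

Lemma sat_ren (M : TFmodel) p : forall (s : nat -> M) r,
  (satT M s (ren r p) <-> satT M (fun i => s (r i)) p) /\
  (satF M s (ren r p) <-> satF M (fun i => s (r i)) p).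
Proof.
  induction p; cbn; intros s r; try tauto.
  - destruct (IHp s r); tauto.
  - destruct (IHp1 s r), (IHp2 s r); tauto.
  - destruct (IHp1 s r), (IHp2 s r); tauto.
  - destruct (IHp1 s r), (IHp2 s r); tauto.
  - split; split;
    first [ intros [d Hd]; exists d | intros Hd d; specialize (Hd d) ];
      destruct (IHp (scons d s) (up r)) as [A B]; rewrite scons_up in *; tauto.
  - split; split;
    first [ intros [d Hd]; exists d | intros Hd d; specialize (Hd d) ];
      destruct (IHp (scons d s) (up r)) as [A B]; rewrite scons_up in *; tauto.
Qed.

Lemma sat_closure (M : TFmodel) p : modelsT M (closure p) <-> modelsT M p.
Proof.
  unfold closure; induction (fvb p) as [|n IH]; cbn; [tauto|].
  rewrite <- IH; unfold modelsT; cbn; split.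
  - intros H s. specialize (H (fun i => s (S i)) (s 0)).
    replace (scons _ _) with s in H; auto.
    apply functional_extensionality; intros [|i]; reflexivity.
  - intros H s d; apply H.
Qed.

Lemma fvb_closure p : fvb (closure p) = 0.
Proof.
  assert (H : forall n, fvb (Nat.iter n fAll p) = fvb p - n).
  { intros n; induction n as [|n IH]; [cbn; lia|].
    change (Nat.pred (fvb (Nat.iter n fAll p)) = fvb p - S n). lia. }
  unfold closure; rewrite H; lia.
Qed.

Lemma models_sentence (M : TFmodel) p s : sentence p -> satT M s p -> modelsT M p.
Proof.
  intros Hp H s'. apply (sat_agree M p s s'); auto. unfold sentence in Hp; lia.
Qed.

(** * Two-valued models and soundness of natural deduction *)

Definition classicalM (M : TFmodel) : Prop :=
  (forall x y, inF M x y <-> ~ inT M x y) /\ (forall x y, neq M x y <-> x <> y).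

Lemma satF_classical (M : TFmodel) p : classicalM M ->
  forall s, satF M s p <-> ~ satT M s p.
Proof.
  intros [H1 H2]; induction p; cbn; intros s; auto; try tauto.
  - destruct (classic (satT M s p)); specialize (IHp s); tauto.
  - destruct (classic (satT M s p1)); specialize (IHp1 s); specialize (IHp2 s); tauto.
  - specialize (IHp1 s); specialize (IHp2 s); tauto.
  - destruct (classic (satT M s p1)); specialize (IHp1 s); specialize (IHp2 s); tauto.
  - split.
    + intros [d Hd] H; apply IHp in Hd; auto.
    + intros H; apply NNPP; intros H'. apply H; intros d; apply NNPP; intros H3.
      apply H'; exists d; apply IHp; auto.
  - split.
    + intros H [d Hd]; apply IHp in Hd; auto.
    + intros H d; apply IHp; intros H'; apply H; eauto.
Qed.

Definition cmodel (D : Type) (d0 : D) (E : D -> D -> Prop) : TFmodel :=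
  Build_TFmodel D d0 E (fun a b => ~ E a b) (fun a b => a <> b)
    (fun a b => @not_eq_sym D a b).

Lemma cmodel_classical D d0 E : classicalM (cmodel D d0 E).
Proof. split; cbn; tauto. Qed.

Theorem nd_sound G p : nd G p -> forall M, classicalM M -> forall s,
  (forall q, In q G -> satT M s q) -> satT M s p.
Proof.
  induction 1; intros M HM s HG; cbn in *.
  - auto.
  - destruct (IHnd M HM s HG).
  - apply satF_classical; auto. intros H1. apply (IHnd M HM s).
    intros q [<-|Hq]; auto.
  - specialize (IHnd1 M HM s HG). specialize (IHnd2 M HM s HG).
    cbn in IHnd2. apply satF_classical in IHnd2; auto.
  - apply NNPP; intros H1. apply (IHnd M HM s).
    intros q [<-|Hq]; auto. cbn; apply satF_classical; auto.
  - split; auto.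
  - apply (IHnd M HM s HG).
  - apply (IHnd M HM s HG).
  - left; auto.
  - right; auto.
  - destruct (IHnd1 M HM s HG); [apply (IHnd2 M HM s) | apply (IHnd3 M HM s)];
      intros ? [<-|?]; auto.
  - intros Hp; apply (IHnd M HM s); intros ? [<-|?]; auto.
  - apply (IHnd1 M HM s HG); auto.
  - intros d; apply IHnd; auto. intros q Hq. apply in_map_iff in Hq.
    destruct Hq as (q' & <- & Hq'). apply (sat_ren M q'). apply HG; auto.
  - specialize (IHnd M HM s HG (s k)). apply (sat_ren M p).
    replace (fun i => _) with (scons (s k) s); auto.
    apply functional_extensionality; intros [|i]; reflexivity.
  - exists (s k). specialize (IHnd M HM s HG). apply (sat_ren M p) in IHnd.
    replace (scons _ _) with (fun i => s (match i with 0 => k | S j => j end)); auto.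
    apply functional_extensionality; intros [|i]; reflexivity.
  - destruct (IHnd1 M HM s HG) as [d Hd].
    apply (sat_ren M q (scons d s) S). apply IHnd2; auto.
    intros r [<-|Hr]; auto. apply in_map_iff in Hr.
    destruct Hr as (q' & <- & Hq'). apply (sat_ren M q'). apply HG; auto.
  - reflexivity.
  - specialize (IHnd1 M HM s HG); specialize (IHnd2 M HM s HG); cbn in *.
    apply (sat_ren M p) in IHnd2. apply (sat_ren M p).
    replace (fun k => s (match k with 0 => j | S l => l end))
      with (fun k => s (match k with 0 => i | S l => l end)); auto.
    apply functional_extensionality; intros [|l]; auto.
Qed.

Lemma CL_sound T p : CL_proves T p -> forall M, classicalM M ->
  (forall q, T q -> modelsT M q) -> modelsT M p.
Proof.
  intros (G & HG & H) M HM HT s. apply (nd_sound G p H M HM s).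
  intros q Hq; apply HT; auto.
Qed.

(** * Completeness of natural deduction *)

(** Any renaming is allowed, even one that identifies variables. [add_con] uses it to exchange a
    fresh variable for the one bound in ∃-elimination. *)
Lemma nd_ren G p : nd G p -> forall f, nd (map (ren f) G) (ren f p).
Proof.
  induction 1; intros f; cbn in *.
  - apply nd_ax, in_map; auto.
  - apply nd_botE; auto.
  - apply nd_negI; apply IHnd.
  - eapply nd_negE; [apply IHnd1 | apply IHnd2].
  - apply nd_raa; apply IHnd.
  - apply nd_andI; auto.
  - eapply nd_andE1; apply IHnd.
  - eapply nd_andE2; apply IHnd.
  - apply nd_orI1; auto.
  - apply nd_orI2; auto.
  - eapply nd_orE; [apply IHnd1 | apply IHnd2 | apply IHnd3].
  - apply nd_impI; apply IHnd.
  - eapply nd_impE; [apply IHnd1 | apply IHnd2].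
  - apply nd_allI. rewrite <- map_ren_shift. apply IHnd.
  - rewrite ren_inst. apply nd_allE. apply IHnd.
  - apply nd_exI with (k := f k). rewrite <- ren_inst. apply IHnd.
  - eapply nd_exE; [apply IHnd1|]. rewrite <- map_ren_shift, <- ren_shift. apply IHnd2.
  - apply nd_eqI.
  - rewrite ren_inst. eapply nd_eqE; [apply IHnd1|]. rewrite <- ren_inst. apply IHnd2.
Qed.

Lemma nd_weak G p : nd G p -> forall G', incl G G' -> nd G' p.
Proof.
  induction 1; intros G' HG.
  - apply nd_ax; auto.
  - apply nd_botE; auto.
  - apply nd_negI, IHnd; intros ? [<-|?]; cbn; auto.
  - eapply nd_negE; eauto.
  - apply nd_raa, IHnd; intros ? [<-|?]; cbn; auto.
  - apply nd_andI; auto.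
  - eapply nd_andE1; eauto.
  - eapply nd_andE2; eauto.
  - apply nd_orI1; auto.
  - apply nd_orI2; auto.
  - eapply nd_orE; [apply IHnd1 | apply IHnd2 | apply IHnd3]; auto;
      intros ? [<-|?]; cbn; auto.
  - apply nd_impI, IHnd; intros ? [<-|?]; cbn; auto.
  - eapply nd_impE; eauto.
  - apply nd_allI, IHnd. apply incl_map; auto.
  - apply nd_allE; auto.
  - eapply nd_exI; eauto.
  - eapply nd_exE; [apply IHnd1; auto|]. apply IHnd2.
    intros ? [<-|?]; cbn; auto. right; eapply incl_map; eauto.
  - apply nd_eqI.
  - eapply nd_eqE; eauto.
Qed.

Definition extend (T : theory) (p : form) : theory := fun q => T q \/ q = p.

(** Gathers all uses of the added hypothesis at the head of the context, where [nd_negI], [nd_raa]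
    and the like can discharge it. *)
Lemma CL_extend T p q : CL_proves (extend T p) q ->
  exists G, (forall r, In r G -> T r) /\ nd (p :: G) q.
Proof.
  intros (G & HG & H).
  assert (K : exists G', (forall r, In r G' -> T r) /\ incl G (p :: G')).
  { clear H. induction G as [|a G IH].
    - exists []; split; [intros ? []|]. intros ? [].
    - destruct IH as (G' & H1 & H2); [intros; apply HG; cbn; auto|].
      destruct (HG a) as [Ha| ->]; cbn; auto.
      + exists (a :: G'); split; [intros ? [<-|?]; auto|].
        intros r [<-|Hr]; cbn; auto. destruct (H2 r Hr) as [->|]; cbn; auto.
      + exists G'; split; auto. intros r [<-|Hr]; cbn; auto.
        apply (H2 r Hr). }
  destruct K as (G' & H1 & H2). exists G'; split; auto. eapply nd_weak; eauto.
Qed.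

Lemma CL_mono (T T' : theory) p : (forall q, T q -> T' q) -> CL_proves T p -> CL_proves T' p.
Proof. intros H (G & HG & HH); exists G; auto. Qed.

(** Gödel numbers. Stage [n] of the Henkin construction treats the formula coded by [n], if there is
    one, so by injectivity every formula has its own stage. *)
Fixpoint code (p : form) : nat :=
  match p with
  | fIn i j => to_nat (0, to_nat (i, j))
  | fEq i j => to_nat (1, to_nat (i, j))
  | fBot => to_nat (2, 0)
  | fNeg p => to_nat (3, code p)
  | fAnd p q => to_nat (4, to_nat (code p, code q))
  | fOr p q => to_nat (5, to_nat (code p, code q))
  | fImp p q => to_nat (6, to_nat (code p, code q))
  | fAll p => to_nat (7, code p)
  | fEx p => to_nat (8, code p)
  end.

Lemma to_nat_inj a b c d : to_nat (a, b) = to_nat (c, d) -> a = c /\ b = d.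
Proof.
  intros H. assert (E : (a, b) = (c, d)) by
    (rewrite <- (cancel_of_to (a, b)), <- (cancel_of_to (c, d)); congruence).
  now injection E.
Qed.

Lemma code_inj p : forall q, code p = code q -> p = q.
Proof.
  Local Opaque to_nat.
  induction p; destruct q; cbn; intros H; apply to_nat_inj in H as [H H'];
    try discriminate; try (apply to_nat_inj in H' as [H1 H2]); f_equal; auto.
Qed.

(** * Henkin construction with free variables as witnesses *)

Section Henkin.
Variable T : theory.
(** Since [T] has no free variables, a variable that is fresh for a finite list is fresh for the
    whole theory. Variables can therefore play the part of Henkin constants, and the language stays
    the same. *)
Hypothesis T_sent : forall q, T q -> sentence q.

Definition con (L : list form) : Prop :=
  ~ CL_proves (fun q => T q \/ In q L) fBot.

Definition fresh (L : list form) : nat := list_max (map fvb L).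

Lemma fresh_le q L : In q L -> fvb q <= fresh L.
Proof.
  intros H. pose proof (proj1 (list_max_le (map fvb L) _) (le_n _)) as K.
  rewrite Forall_forall in K. apply K, in_map; auto.
Qed.

Definition add (q : form) (L : list form) : list form :=
  match q with
  | fEx r => inst (fresh (q :: L)) r :: q :: L
  | _ => q :: L
  end.

Lemma add_incl q L : incl (q :: L) (add q L).
Proof. destruct q; intros r Hr; cbn in *; auto. Qed.

Lemma add_con q L : con (q :: L) -> con (add q L).
Proof.
  destruct q; auto. intros H HB. apply H; clear H.
  set (k := fresh (fEx q :: L)) in *.
  destruct (CL_extend (fun r => T r \/ In r (fEx q :: L)) (inst k q) fBot) as (G & HG & H).
  { eapply CL_mono; [|exact HB]. cbn; intros r [Hr|[<-|Hr]]; unfold extend; tauto. }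
  exists (fEx q :: G). split; [intros r [<-|Hr]; cbn; auto|].
  apply nd_exE with (p := q); [apply nd_ax; cbn; auto|].
  assert (Hf : forall r, In r (fEx q :: L) -> fvb r <= k) by (intros; apply fresh_le; auto).
  clearbody k; clear HB.
  (* [k] becomes 0, the variable bound by ∃-elimination, and every other variable is shifted. The
     instance turns back into [q], and the hypotheses, in which [k] is not free, turn into their
     shifts. *)
  apply nd_ren with (f := fun i => if Nat.eqb i k then 0 else S i) in H.
  cbn in H. unfold inst in H; rewrite ren_comp in H.
  rewrite ren_id in H.
  2: { intros [|i] Hi; [now rewrite Nat.eqb_refl|].
       specialize (Hf (fEx q) (or_introl eq_refl)). cbn in Hf.
       destruct (Nat.eqb_spec i k); lia. }
  eapply nd_weak; [exact H|].
  intros r [<-|Hr]; cbn; auto. right. apply in_map_iff in Hr as (r' & <- & Hr').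
  right. apply in_map_iff. exists r'; split; auto. apply ren_agree.
  intros i Hi. destruct (Nat.eqb_spec i k); auto. exfalso.
  destruct (HG r' Hr') as [Hs|Hs].
  - apply T_sent in Hs. unfold sentence in Hs; lia.
  - apply Hf in Hs. lia.
Qed.

(** The list grows by the formula with code [n] if it stays consistent; an existential formula
    brings a witnessing instance along through [add]. *)
Definition step (n : nat) (L : list form) : list form :=
  match excluded_middle_informative (exists q, code q = n /\ con (q :: L)) with
  | left H => add (proj1_sig (constructive_indefinite_description _ H)) L
  | right _ => L
  end.

Lemma step_incl n L : incl L (step n L).
Proof.
  unfold step; destruct (excluded_middle_informative _) as [H|H]; [|apply incl_refl].
  intros r Hr. apply add_incl; cbn; auto.
Qed.

Lemma step_con n L : con L -> con (step n L).
Proof.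
  unfold step; destruct (excluded_middle_informative _) as [H|H]; auto.
  destruct (constructive_indefinite_description _ H) as (q & H1 & H2); cbn.
  intros _; apply add_con; auto.
Qed.

Lemma step_add q L : con (q :: L) -> incl (add q L) (step (code q) L).
Proof.
  intros Hq. unfold step; destruct (excluded_middle_informative _) as [H|H].
  - destruct (constructive_indefinite_description _ H) as (q' & H1 & H2); cbn.
    apply code_inj in H1 as ->. apply incl_refl.
  - destruct H; eauto.
Qed.

Variable L0 : list form.
Hypothesis L0_con : con L0.

Fixpoint stage (n : nat) : list form :=
  match n with 0 => L0 | S m => step m (stage m) end.

Definition Gam : theory := fun q => T q \/ exists n, In q (stage n).

Lemma stage_mono m n : m <= n -> incl (stage m) (stage n).
Proof.
  induction 1; [apply incl_refl|]. eapply incl_tran; eauto. apply step_incl.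
Qed.

Lemma Gam_con : ~ CL_proves Gam fBot.
Proof.
  intros (G & HG & H).
  (* Compactness: a derivation has finitely many hypotheses, so a single stage contains those
     outside [T]. *)
  assert (K : exists n, forall q, In q G -> T q \/ In q (stage n)).
  { clear H. induction G as [|a G IH].
    - exists 0; intros ? [].
    - destruct IH as [n Hn]; [intros; apply HG; cbn; auto|].
      destruct (HG a) as [Ha|[m Hm]]; cbn; auto.
      + exists n; intros q [<-|Hq]; auto.
      + exists (max m n); intros q [<-|Hq].
        * right; eapply stage_mono; [|exact Hm]; lia.
        * destruct (Hn q Hq); auto. right; eapply stage_mono; [|eassumption]; lia. }
  destruct K as [n Hn].
  assert (C : con (stage n)) by (clear Hn; induction n; cbn; auto; apply step_con; auto).
  apply C. exists G; auto.
Qed.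

(** A formula consistent with the limit is consistent with the stage at which it comes up, so it is
    added there, together with its witness. *)
Lemma Gam_add q : ~ CL_proves (extend Gam q) fBot ->
  incl (add q (stage (code q))) (stage (S (code q))).
Proof.
  intros H; cbn [stage]. apply step_add. intros HC; apply H.
  eapply CL_mono; [|exact HC]. intros r [Hr|[<-|Hr]]; unfold extend, Gam; eauto.
Qed.

Lemma Gam_max q : ~ CL_proves (extend Gam q) fBot -> Gam q.
Proof.
  intros H; right. exists (S (code q)). apply (Gam_add q H), add_incl; cbn; auto.
Qed.

Lemma Gam_ded q : CL_proves Gam q -> Gam q.
Proof.
  intros (G & HG & H). apply Gam_max. intros HC. apply CL_extend in HC as (G' & HG' & H').
  apply Gam_con. exists (G ++ G'); split.
  { intros r Hr; apply in_app_iff in Hr as []; auto. }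
  apply nd_impE with q.
  - apply nd_impI. eapply nd_weak; [exact H'|]. intros r [<-|Hr]; cbn; auto.
    right; apply in_app_iff; auto.
  - eapply nd_weak; [exact H|]. intros r Hr; apply in_app_iff; auto.
Qed.

Lemma Gam_nd G q : (forall r, In r G -> Gam r) -> nd G q -> Gam q.
Proof. intros; apply Gam_ded; exists G; auto. Qed.

Lemma Gam_bot : ~ Gam fBot.
Proof.
  intros H; apply Gam_con. exists [fBot]; split; [intros r [<-|[]]; auto|].
  apply nd_ax; cbn; auto.
Qed.

Ltac gam l := apply (Gam_nd l); [ cbn; intuition (subst; auto) | ].
Ltac ax := apply nd_ax; cbn; auto.

Lemma Gam_neg q : Gam (fNeg q) <-> ~ Gam q.
Proof.
  split.
  - intros H1 H2. apply Gam_bot. gam [q; fNeg q]. apply nd_negE with q; ax.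
  - intros H. apply Gam_ded.
    assert (HC : CL_proves (extend Gam q) fBot) by (apply NNPP; intros H'; apply H, Gam_max, H').
    apply CL_extend in HC as (G & HG & HC). exists G; split; auto. apply nd_negI; auto.
Qed.

Lemma Gam_and p q : Gam (fAnd p q) <-> Gam p /\ Gam q.
Proof.
  split.
  - intros H; split; gam [fAnd p q]; [eapply nd_andE1 | eapply nd_andE2]; ax.
  - intros [H1 H2]; gam [p; q]. apply nd_andI; ax.
Qed.

Lemma Gam_or p q : Gam (fOr p q) <-> Gam p \/ Gam q.
Proof.
  split.
  - intros H. apply NNPP; intros H'. apply not_or_and in H' as [H1 H2].
    apply Gam_neg in H1, H2. apply Gam_bot. gam [fOr p q; fNeg p; fNeg q].
    eapply nd_orE; [ax| |]; [apply nd_negE with p | apply nd_negE with q]; ax.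
  - intros [H|H]; [gam [p]; apply nd_orI1 | gam [q]; apply nd_orI2]; ax.
Qed.

Lemma Gam_imp p q : Gam (fImp p q) <-> (Gam p -> Gam q).
Proof.
  split.
  - intros H1 H2; gam [fImp p q; p]. apply nd_impE with p; ax.
  - intros H. destruct (classic (Gam p)) as [Hp|Hp].
    + gam [q]. apply nd_impI; ax.
    + apply Gam_neg in Hp. gam [fNeg p]. apply nd_impI, nd_botE, nd_negE with p; ax.
Qed.

Lemma Gam_ex p : Gam (fEx p) <-> exists k, Gam (inst k p).
Proof.
  split.
  - intros H.
    assert (HC : ~ CL_proves (extend Gam (fEx p)) fBot).
    { intros HC; apply Gam_con. eapply CL_mono; [|exact HC].
      intros r [Hr| ->]; auto. }
    exists (fresh (fEx p :: stage (code (fEx p)))).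
    right; exists (S (code (fEx p))). apply (Gam_add _ HC). cbn; auto.
  - intros [k H]; gam [inst k p]. apply nd_exI with k; ax.
Qed.

Lemma inst_shift p : inst 0 (ren (up S) p) = p.
Proof. rewrite inst_ren_up. apply ren_id; intros [|i]; reflexivity. Qed.

(** If the universal formula is missing, [Gam] contains ∃∼p, whose witness refutes one of the
    instances. *)
Lemma Gam_all p : Gam (fAll p) <-> forall k, Gam (inst k p).
Proof.
  split.
  - intros H k; gam [fAll p]. apply nd_allE; ax.
  - intros H. apply NNPP; intros H'.
    apply (proj2 (Gam_neg _)) in H'.
    assert (K : Gam (fEx (fNeg p))).
    { gam [fNeg (fAll p)]. apply nd_raa. apply nd_negE with (fAll p); [|ax].
      apply nd_allI. apply nd_raa. cbn.
      apply nd_negE with (shift (fEx (fNeg p))); [|ax].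
      apply nd_exI with 0. cbn. change (nd [fNeg p; shift (fNeg (fEx (fNeg p)));
        shift (fNeg (fAll p))] (fNeg (inst 0 (ren (up S) p)))).
      rewrite inst_shift. ax. }
    apply Gam_ex in K as [k K]. apply (proj1 (Gam_neg (inst k p))) in K. auto.
Qed.

Lemma Gam_eq_refl i : Gam (fEq i i).
Proof. apply (Gam_nd []); [intros ? []|apply nd_eqI]. Qed.

Lemma Gam_eqE i j p : Gam (fEq i j) -> Gam (inst i p) -> Gam (inst j p).
Proof. intros H1 H2. gam [fEq i j; inst i p]. apply nd_eqE with i; ax. Qed.

Lemma Gam_eq_sym i j : Gam (fEq i j) -> Gam (fEq j i).
Proof.
  intros H. apply (Gam_eqE i j (fEq 0 (S i))); auto. apply Gam_eq_refl.
Qed.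

(** Satisfaction reads = as identity, so variables are divided by provable equality. Classes are
    predicates, and extensionality makes equal classes equal. *)
Definition cls (i : nat) : nat -> Prop := fun j => Gam (fEq i j).
Definition Hdom : Type := { P : nat -> Prop | exists i, P = cls i }.
Definition hc (i : nat) : Hdom := exist _ (cls i) (ex_intro _ i eq_refl).

Lemma hc_eq i j : hc i = hc j <-> Gam (fEq i j).
Proof.
  split.
  - intros H. apply (f_equal (@proj1_sig _ _)) in H. cbn in H.
    change (cls i j). rewrite H. apply Gam_eq_refl.
  - intros H. apply eq_sig_hprop; [intros; apply proof_irrelevance|]. cbn.
    apply functional_extensionality; intros k. apply propositional_extensionality.
    unfold cls; split; intros K.
    + apply (Gam_eqE i j (fEq 0 (S k))); auto.
    + apply (Gam_eqE j i (fEq 0 (S k))); auto. apply Gam_eq_sym; auto.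
Qed.

Lemma hc_surj d : exists i, d = hc i.
Proof.
  destruct d as (P & i & ->). exists i.
  apply eq_sig_hprop; [intros; apply proof_irrelevance|reflexivity].
Qed.

Definition Hmodel : TFmodel :=
  cmodel Hdom (hc 0) (fun a b => exists i j, a = hc i /\ b = hc j /\ Gam (fIn i j)).

Lemma Hin i j : inT Hmodel (hc i) (hc j) <-> Gam (fIn i j).
Proof.
  split; [|cbn; eauto]. cbn. intros (k & l & H1 & H2 & H).
  apply hc_eq, Gam_eq_sym in H1, H2.
  apply (Gam_eqE k i (fIn 0 (S j))); auto.
  apply (Gam_eqE l j (fIn (S k) 0)); auto.
Qed.

(** The truth lemma. Assignments that come from renamings suffice for the induction, because every
    element of the model is the class of a variable. *)
Lemma Htruth p : forall r,
  satT Hmodel (fun i => hc (r i)) p <-> Gam (ren r p).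
Proof.
  pose proof (cmodel_classical Hdom (hc 0) _ : classicalM Hmodel) as HC.
  assert (E : forall k r, scons (hc k) (fun i => hc (r i)) = fun i => hc (scons k r i)).
  { intros; apply functional_extensionality; intros [|i]; reflexivity. }
  induction p; intros r; cbn [satT ren].
  - apply Hin.
  - apply hc_eq.
  - split; [tauto|apply Gam_bot].
  - rewrite (satF_classical _ _ HC), IHp, Gam_neg; tauto.
  - rewrite IHp1, IHp2, Gam_and; tauto.
  - rewrite IHp1, IHp2, Gam_or; tauto.
  - rewrite IHp1, IHp2, Gam_imp; tauto.
  - rewrite Gam_all. split.
    + intros H k. specialize (H (hc k)). rewrite E, IHp in H. rewrite inst_ren_up; auto.
    + intros H d. destruct (hc_surj d) as [k ->]. rewrite E, IHp, <- inst_ren_up; auto.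
  - rewrite Gam_ex. split.
    + intros [d H]. destruct (hc_surj d) as [k ->]. rewrite E, IHp in H.
      exists k. rewrite inst_ren_up; auto.
    + intros [k H]. exists (hc k). rewrite E, IHp, <- inst_ren_up; auto.
Qed.

End Henkin.

Theorem CL_complete (T : theory) p : (forall q, T q -> sentence q) ->
  (forall M, classicalM M -> (forall q, T q -> modelsT M q) -> modelsT M p) ->
  CL_proves T p.
Proof.
  intros HT H. apply NNPP; intros Hp.
  assert (C : con T [fNeg p]).
  { intros HC. apply Hp.
    destruct (CL_extend T (fNeg p) fBot) as (G & HG & HH).
    { eapply CL_mono; [|exact HC]. intros r [Hr|[<-|[]]]; unfold extend; auto. }
    exists G; split; auto. apply nd_raa; auto. }
  pose (M := Hmodel T [fNeg p]).
  assert (HM : classicalM M) by apply cmodel_classical.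
  assert (K : forall q, Gam T [fNeg p] q -> satT M (hc T [fNeg p]) q).
  { intros q Hq. apply (Htruth T HT _ C q (fun i => i)). rewrite ren_id; auto. }
  assert (Hn : satT M (hc T [fNeg p]) (fNeg p)) by (apply K; right; exists 0; cbn; auto).
  cbn in Hn. apply satF_classical in Hn; auto. apply Hn, H; auto.
  intros q Hq. apply models_sentence with (s := hc T [fNeg p]); auto. apply K; left; auto.
Qed.

Ltac same_env := match goal with
  | |- context [satT _ ?a ?p <-> satT _ ?b ?p] => replace a with b; [tauto|] end;
  apply functional_extensionality.

(** * Definability with parameters *)

Definition tail {D : Type} (s : nat -> D) : nat -> D := fun i => s (S i).

Definition look {D : Type} (s : nat -> D) (v : nat + D) : D :=
  match v with inl j => s j | inr c => c end.

(** [r] sends each variable of [p] to a variable of the assignment or to a parameter. Only truth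
    matters: a falsity condition is the truth condition of a ∼-formula, and ordinary negation is
    expressed by p → ⊥. *)
Definition Def (M : TFmodel) (P : (nat -> M) -> Prop) : Prop :=
  exists (p : form) (r : nat -> nat + M), forall s, P s <-> satT M (fun i => look s (r i)) p.

Definition DefT (M : TFmodel) (F : (nat -> M) -> M) : Prop :=
  Def M (fun s => s 0 = F (tail s)).

Section Def.
Context {M : TFmodel}.
Implicit Types P Q : (nat -> M) -> Prop.

Lemma def_iff P Q : Def M P -> (forall s, P s <-> Q s) -> Def M Q.
Proof. intros (p & r & H) E; exists p, r; intros s; rewrite <- E; auto. Qed.

Lemma def_imp P Q : Def M P -> Def M Q -> Def M (fun s => P s -> Q s).
Proof.
  intros (p & r & H) (q & r' & H').
  (* The two formulas get disjoint variables, even and odd ones, so that the two lookup maps can be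
     interleaved. *)
  exists (fImp (ren (fun i => 2 * i) p) (ren (fun i => 2 * i + 1) q)),
    (fun i => if Nat.even i then r (Nat.div2 i) else r' (Nat.div2 i)).
  intros s. cbn [satT]. rewrite H, H'.
  rewrite (proj1 (sat_ren M p _ _)), (proj1 (sat_ren M q _ _)).
  replace (fun i => look s (if Nat.even (2 * i) then r (Nat.div2 (2 * i)) else r' (Nat.div2 (2 * i))))
    with (fun i => look s (r i)).
  2: { apply functional_extensionality; intros i.
       rewrite Nat.div2_double. replace (Nat.even (2 * i)) with true; auto.
       symmetry; apply Nat.even_spec; exists i; auto. }
  replace (fun i => look s (if Nat.even (2 * i + 1) then r (Nat.div2 (2 * i + 1)) else r' (Nat.div2 (2 * i + 1))))
    with (fun i => look s (r' i)); [tauto|].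
  apply functional_extensionality; intros i. rewrite Nat.add_1_r.
  rewrite Nat.div2_succ_double. replace (Nat.even (S (2 * i))) with false; auto.
  rewrite Nat.even_succ, <- Nat.negb_even, Nat.even_mul; auto.
Qed.

Lemma def_false : Def M (fun _ => False).
Proof. exists fBot, (fun _ => inl 0); cbn; tauto. Qed.

Lemma def_not P : Def M P -> Def M (fun s => ~ P s).
Proof. intros H; apply def_imp; auto using def_false. Qed.

Lemma def_true : Def M (fun _ => True).
Proof. eapply def_iff; [apply def_not, def_false|]; tauto. Qed.

Lemma def_or P Q : Def M P -> Def M Q -> Def M (fun s => P s \/ Q s).
Proof.
  intros HP HQ. eapply def_iff; [apply def_imp; [apply def_not, HP | exact HQ]|].
  cbn; intros s; destruct (classic (P s)); tauto.
Qed.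

Lemma def_and P Q : Def M P -> Def M Q -> Def M (fun s => P s /\ Q s).
Proof.
  intros HP HQ. eapply def_iff; [apply def_not, def_imp; [exact HP | apply def_not, HQ]|].
  cbn; intros s; destruct (classic (P s)), (classic (Q s)); tauto.
Qed.

Lemma def_equiv P Q : Def M P -> Def M Q -> Def M (fun s => P s <-> Q s).
Proof. intros HP HQ; apply def_and; apply def_imp; auto. Qed.

Lemma def_ex (R : M -> (nat -> M) -> Prop) :
  Def M (fun s => R (s 0) (tail s)) -> Def M (fun s => exists d, R d s).
Proof.
  intros (p & r & H).
  exists (fEx (ren (fun i => match r i with inl 0 => 0 | _ => S i end) p)).
  (* Variables of [p] that referred to 0 are now bound, so the value [point M] given to them outside
     the quantifier is never read. *)
  exists (fun i => match r i with inl (S j) => inl j | inr c => inr c | inl 0 => inr (point M) end).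
  intros s; cbn [satT]. split; intros [d Hd]; exists d.
  - apply (sat_ren M p). change (R (scons d s 0) (tail (scons d s))) in Hd. apply H in Hd.
    revert Hd. match goal with |- satT M ?a p -> satT M ?b p => replace a with b; auto end.
    apply functional_extensionality; intros i. destruct (r i) as [[|j]|c] eqn:E; cbn; auto;
    rewrite E; reflexivity.
  - apply (sat_ren M p) in Hd. change (R (scons d s 0) (tail (scons d s))). apply H.
    revert Hd. match goal with |- satT M ?a p -> satT M ?b p => replace a with b; auto end.
    apply functional_extensionality; intros i. destruct (r i) as [[|j]|c] eqn:E; cbn; auto;
    rewrite E; reflexivity.
Qed.

Lemma def_all (R : M -> (nat -> M) -> Prop) :
  Def M (fun s => R (s 0) (tail s)) -> Def M (fun s => forall d, R d s).
Proof.
  intros H. eapply def_iff.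
  - apply def_not, (def_ex (fun d s => ~ R d s)), def_not, H.
  - cbn; intros s; split.
    + intros K d; apply NNPP; intros K'; apply K; eauto.
    + intros K [d Hd]; auto.
Qed.

Lemma def_map P (f : nat -> nat) : Def M P -> Def M (fun s => P (fun i => s (f i))).
Proof.
  intros (p & r & H).
  exists p, (fun i => match r i with inl j => inl (f j) | inr c => inr c end).
  intros s; rewrite H.
  same_env; intros i. destruct (r i); reflexivity.
Qed.

Lemma defT_var i : DefT M (fun s => s i).
Proof.
  exists (fEq 0 1), (fun k => match k with 0 => inl 0 | _ => inl (S i) end).
  intros s; cbn; reflexivity.
Qed.

Lemma defT_const c : DefT M (fun _ => c).
Proof.
  exists (fEq 0 1), (fun k => match k with 0 => inl 0 | _ => inr c end).
  intros s; cbn; reflexivity.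
Qed.

Lemma defT_map F (f : nat -> nat) : DefT M F -> DefT M (fun s => F (fun i => s (f i))).
Proof.
  intros H. unfold DefT.
  apply (def_map _ (fun i => match i with 0 => 0 | S j => S (f j) end)) in H.
  exact H.
Qed.

(** The language has no function symbols; a definable function is substituted by quantifying over
    its value. *)
Lemma def_sub1 (R : M -> Prop) F :
  Def M (fun s => R (s 0)) -> DefT M F -> Def M (fun s => R (F s)).
Proof.
  intros HR HF. eapply def_iff.
  - apply (def_ex (fun a s => a = F s /\ R a)). apply def_and; [exact HF|exact HR].
  - cbn; intros s; split; [intros (? & -> & ?); auto | eauto].
Qed.

Lemma def_sub2 (R : M -> M -> Prop) F G :
  Def M (fun s => R (s 0) (s 1)) -> DefT M F -> DefT M G -> Def M (fun s => R (F s) (G s)).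
Proof.
  intros HR HF HG. eapply def_iff.
  - apply (def_ex (fun a s => a = F s /\ exists b, b = G s /\ R a b)).
    apply def_and; [exact HF|].
    apply (def_ex (fun b s => b = G (tail s) /\ R (s 0) b)).
    apply def_and; [exact (defT_map _ S HG)|].
    apply (def_map _ (fun i => match i with 0 => 1 | _ => 0 end) HR).
  - cbn; intros s; split; [intros (? & -> & ? & -> & ?); auto | eauto 6].
Qed.

Lemma def_sub3 (R : M -> M -> M -> Prop) F G H :
  Def M (fun s => R (s 0) (s 1) (s 2)) -> DefT M F -> DefT M G -> DefT M H ->
  Def M (fun s => R (F s) (G s) (H s)).
Proof.
  intros HR HF HG HH. eapply def_iff.
  - apply (def_ex (fun a s => a = F s /\ exists b, b = G s /\ exists c, c = H s /\ R a b c)).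
    apply def_and; [exact HF|].
    apply (def_ex (fun b s => b = G (tail s) /\ exists c, c = H (tail s) /\ R (s 0) b c)).
    apply def_and; [exact (defT_map _ S HG)|].
    apply (def_ex (fun c s => c = H (tail (tail s)) /\ R (s 1) (s 0) c)).
    apply def_and; [exact (defT_map _ (fun i => S (S i)) HH)|].
    apply (def_map _ (fun i => match i with 0 => 2 | 1 => 1 | _ => 0 end) HR).
  - cbn; intros s; split; [intros (? & -> & ? & -> & ? & -> & ?); auto | eauto 8].
Qed.

Lemma defT_sub1 (h : M -> M) F :
  DefT M (fun s => h (s 0)) -> DefT M F -> DefT M (fun s => h (F s)).
Proof.
  intros Hh HF. apply (def_sub2 (fun x y => x = h y) (fun s => s 0)); auto.
  - apply defT_var.
  - exact (defT_map _ S HF).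
Qed.

Lemma defT_sub2 (h : M -> M -> M) F G :
  DefT M (fun s => h (s 0) (s 1)) -> DefT M F -> DefT M G -> DefT M (fun s => h (F s) (G s)).
Proof.
  intros Hh HF HG. apply (def_sub3 (fun x y z => x = h y z) (fun s => s 0)); auto.
  - apply defT_var.
  - exact (defT_map _ S HF).
  - exact (defT_map _ S HG).
Qed.

Lemma def_eq F G : DefT M F -> DefT M G -> Def M (fun s => F s = G s).
Proof.
  apply (def_sub2 (fun x y => x = y)). apply defT_var.
Qed.

Lemma def_inT F G : DefT M F -> DefT M G -> Def M (fun s => inT M (F s) (G s)).
Proof.
  apply (def_sub2 (fun x y => inT M x y)).
  exists (fIn 0 1), inl; intros s; cbn; tauto.
Qed.

Lemma def_inF F G : DefT M F -> DefT M G -> Def M (fun s => inF M (F s) (G s)).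
Proof.
  apply (def_sub2 (fun x y => inF M x y)).
  exists (fNeg (fIn 0 1)), inl; intros s; cbn; tauto.
Qed.

Lemma def_neq F G : DefT M F -> DefT M G -> Def M (fun s => neq M (F s) (G s)).
Proof.
  apply (def_sub2 (fun x y => neq M x y)).
  exists (fNeg (fEq 0 1)), inl; intros s; cbn; tauto.
Qed.

Lemma def_cst (P : Prop) : Def M (fun _ => P).
Proof.
  destruct (classic P); [eapply def_iff; [apply def_true|]|eapply def_iff; [apply def_false|]];
    tauto.
Qed.

(** Moves the parameters into the tail of the environment, the form in which the axiom schemas take
    them. *)
Lemma def_formula1 (R : M -> Prop) : Def M (fun s => R (s 0)) ->
  exists p t, forall x, R x <-> satT M (scons x t) p.
Proof.
  intros (p & r & H).
  exists (ren (fun i => match r i with inl 0 => 0 | _ => S i end) p).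
  exists (fun i => look (fun _ => point M) (r i)).
  intros x. rewrite (H (scons x (fun _ => point M))).
  rewrite (proj1 (sat_ren M p _ _)).
  same_env; intros i. destruct (r i) as [[|j]|c] eqn:E; cbn;
    rewrite ?E; reflexivity.
Qed.

Lemma def_formula2 (R : M -> M -> Prop) : Def M (fun s => R (s 0) (s 1)) ->
  exists p t, forall x y, R x y <-> satT M (scons x (scons y t)) p.
Proof.
  intros (p & r & H).
  exists (ren (fun i => match r i with inl 0 => 0 | inl 1 => 1 | _ => S (S i) end) p).
  exists (fun i => look (fun _ => point M) (r i)).
  intros x y. rewrite (H (scons x (scons y (fun _ => point M)))).
  rewrite (proj1 (sat_ren M p _ _)).
  same_env; intros i. destruct (r i) as [[|[|j]]|c] eqn:E; cbn;
    rewrite ?E; reflexivity.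
Qed.

Lemma def_formula3 (R : M -> M -> M -> Prop) : Def M (fun s => R (s 0) (s 1) (s 2)) ->
  exists p t, forall x y z, R x y z <-> satT M (scons x (scons y (scons z t))) p.
Proof.
  intros (p & r & H).
  exists (ren (fun i => match r i with inl 0 => 0 | inl 1 => 1 | inl 2 => 2 | _ => S (S (S i)) end) p).
  exists (fun i => look (fun _ => point M) (r i)).
  intros x y z. rewrite (H (scons x (scons y (scons z (fun _ => point M))))).
  rewrite (proj1 (sat_ren M p _ _)).
  same_env; intros i. destruct (r i) as [[|[|[|j]]]|c] eqn:E; cbn;
    rewrite ?E; reflexivity.
Qed.

Lemma def_sat1 p (t : nat -> M) : Def M (fun s => satT M (scons (s 0) t) p).
Proof.
  exists p, (fun i => match i with 0 => inl 0 | S j => inr (t j) end). intros s.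
  same_env; intros [|i]; reflexivity.
Qed.

Lemma def_sat2 p (t : nat -> M) : Def M (fun s => satT M (scons (s 0) (scons (s 1) t)) p).
Proof.
  exists p, (fun i => match i with 0 => inl 0 | 1 => inl 1 | S (S j) => inr (t j) end). intros s.
  same_env; intros [|[|i]]; reflexivity.
Qed.

Lemma def_sat3 p (t : nat -> M) :
  Def M (fun s => satT M (scons (s 0) (scons (s 1) (scons (s 2) t))) p).
Proof.
  exists p, (fun i => match i with 0 => inl 0 | 1 => inl 1 | 2 => inl 2 | S (S (S j)) => inr (t j) end).
  intros s.
  same_env; intros [|[|[|i]]]; reflexivity.
Qed.

End Def.

(* Proof search by the outermost symbol of the predicate. After a quantifier, [dn] unfolds [tail],
   so that the goal is again expressed through [s 0], [s 1] and so on. *)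
Create HintDb defs.
Ltac dn := cbn beta; unfold tail; cbn beta.
#[export] Hint Extern 1 (Def _ (fun s => _ -> _)) => simple apply def_imp : defs.
#[export] Hint Extern 1 (Def _ (fun s => ~ _)) => simple apply def_not : defs.
#[export] Hint Extern 1 (Def _ (fun s => _ /\ _)) => simple apply def_and : defs.
#[export] Hint Extern 1 (Def _ (fun s => _ \/ _)) => simple apply def_or : defs.
#[export] Hint Extern 1 (Def _ (fun s => _ <-> _)) => simple apply def_equiv : defs.
#[export] Hint Extern 1 (Def _ (fun s => _ = _)) => simple apply def_eq : defs.
#[export] Hint Extern 1 (Def _ (fun s => inT _ _ _)) => simple apply def_inT : defs.
#[export] Hint Extern 1 (Def _ (fun s => inF _ _ _)) => simple apply def_inF : defs.
#[export] Hint Extern 1 (Def _ (fun s => neq _ _ _)) => simple apply def_neq : defs.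
#[export] Hint Extern 1 (Def _ (fun s => exists d, _)) => apply def_ex; dn : defs.
#[export] Hint Extern 2 (Def _ (fun s => forall d, _)) => apply def_all; dn : defs.
#[export] Hint Extern 0 (Def _ (fun s => False)) => simple apply def_false : defs.
#[export] Hint Extern 0 (Def _ (fun s => True)) => simple apply def_true : defs.
#[export] Hint Extern 0 (Def _ (fun s => ?P)) => simple apply def_cst : defs.
#[export] Hint Extern 0 (DefT _ (fun s => s _)) => simple apply defT_var : defs.
#[export] Hint Extern 0 (DefT _ (fun s => ?c)) => simple apply defT_const : defs.
Ltac def := dn; solve [auto 100 with defs nocore].

Local Notation "x ∊ y" := (inT _ x y) (at level 70, no associativity).
Local Notation "x ∊? y" := (~ inF _ x y) (at level 70, no associativity).

(** * Evaluating formulas *)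

(* [Q] is non-falsity. In these terms ∧, ∨, ∀, ∃ act on [P] and [Q] separately,
   ∼ swaps them up to negation, and [p → q] is evaluated as [(P -> P', P -> Q')];
   so [Q] is what the context writes as [?p]. *)
Definition ev (M : TFmodel) (s : nat -> M) (p : form) (P Q : Prop) : Prop :=
  (satT M s p <-> P) /\ (satF M s p <-> ~ Q).

Section Ev.
Context {M : TFmodel}.
Implicit Types (s : nat -> M) (n : nat) (p q : sform).

Lemma evT s f P Q R : ev M s f P Q -> (P <-> R) -> (satT M s f <-> R).
Proof. intros [H _]; rewrite H; auto. Qed.

Lemma look_new n s d : scons d s (S n - S n) = d.
Proof. rewrite Nat.sub_diag; reflexivity. Qed.

Lemma look_old n s d x a : x < n -> s (n - S x) = a -> scons d s (S n - S x) = a.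
Proof. intros H <-. rewrite Nat.sub_succ. replace (n - x) with (S (n - S x)) by lia. reflexivity. Qed.

Lemma ev_in n s x y a b : s (n - S x) = a -> s (n - S y) = b ->
  ev M s (sIn x y n) (a ∊ b) (a ∊? b).
Proof. intros <- <-; split; cbn; [tauto|]. split; [tauto|apply NNPP]. Qed.

Lemma ev_eq n s x y a b : s (n - S x) = a -> s (n - S y) = b ->
  ev M s (sEq x y n) (a = b) (~ neq M a b).
Proof. intros <- <-; split; cbn; [tauto|]. split; [tauto|apply NNPP]. Qed.

Lemma ev_bot n s : ev M s (sBot n) False False.
Proof. split; cbn; tauto. Qed.

Lemma ev_neg n s p P Q : ev M s (p n) P Q -> ev M s (sNeg p n) (~ Q) (~ P).
Proof. intros [H1 H2]; split; cbn; [tauto|]. rewrite H1; split; [tauto|apply NNPP]. Qed.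

Lemma ev_and n s p q P Q P' Q' : ev M s (p n) P Q -> ev M s (q n) P' Q' ->
  ev M s (sAnd p q n) (P /\ P') (Q /\ Q').
Proof.
  intros [H1 H2] [H3 H4]; split; cbn; [tauto|]. rewrite H2, H4.
  destruct (classic Q), (classic Q'); tauto.
Qed.

Lemma ev_or n s p q P Q P' Q' : ev M s (p n) P Q -> ev M s (q n) P' Q' ->
  ev M s (sOr p q n) (P \/ P') (Q \/ Q').
Proof. intros [H1 H2] [H3 H4]; split; cbn; tauto. Qed.

Lemma ev_imp n s p q P Q P' Q' : ev M s (p n) P Q -> ev M s (q n) P' Q' ->
  ev M s (sImp p q n) (P -> P') (P -> Q').
Proof.
  intros [H1 H2] [H3 H4]; split; cbn; [tauto|]. rewrite H1, H4.
  destruct (classic P), (classic Q'); tauto.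
Qed.

Lemma ev_all n s (p : nat -> sform) P Q :
  (forall d, ev M (scons d s) (p n (S n)) (P d) (Q d)) ->
  ev M s (sAll p n) (forall d, P d) (forall d, Q d).
Proof.
  intros H; split; cbn.
  - split; intros K d; apply (proj1 (H d)); auto.
  - split.
    + intros [d K] K'. apply H in K; auto.
    + intros K. apply not_all_ex_not in K as [d K]. exists d. apply (proj2 (H d)); auto.
Qed.

Lemma ev_ex n s (p : nat -> sform) P Q :
  (forall d, ev M (scons d s) (p n (S n)) (P d) (Q d)) ->
  ev M s (sEx p n) (exists d, P d) (exists d, Q d).
Proof.
  intros H; split; cbn.
  - split; intros [d K]; exists d; apply (proj1 (H d)); auto.
  - split.
    + intros K [d K']. specialize (K d). apply H in K; auto.
    + intros K d. apply (proj2 (H d)); eauto.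
Qed.

Lemma ev_iff n s p q P Q P' Q' : ev M s (p n) P Q -> ev M s (q n) P' Q' ->
  ev M s (sIff p q n) (P <-> P') ((P -> Q') /\ (P' -> Q)).
Proof. intros; eapply ev_and; eapply ev_imp; eauto. Qed.

Lemma ev_conv s f P P' Q Q' : ev M s f P Q -> (P <-> P') -> (Q <-> Q') -> ev M s f P' Q'.
Proof. unfold ev; tauto. Qed.

Lemma ev_simp n s p q P Q P' Q' : ev M s (p n) P Q -> ev M s (q n) P' Q' ->
  ev M s (sSImp p q n) ((P -> P') /\ (Q -> Q')) (P -> Q').
Proof.
  intros; eapply ev_conv; [eapply ev_and; eapply ev_imp; try eapply ev_neg; eauto | |];
    destruct (classic Q); destruct (classic Q'); tauto.
Qed.

Lemma ev_siff n s p q P Q P' Q' : ev M s (p n) P Q -> ev M s (q n) P' Q' ->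
  ev M s (sSIff p q n) ((P <-> P') /\ (Q <-> Q')) ((P -> Q') /\ (P' -> Q)).
Proof.
  intros; eapply ev_conv; [eapply ev_and; eapply ev_iff; try eapply ev_neg; eauto | |];
    destruct (classic Q); destruct (classic Q'); tauto.
Qed.

Lemma ev_not n s p P Q : ev M s (p n) P Q -> ev M s (sNot p n) (~ P) (~ P).
Proof. intros H; apply (ev_imp n s p sBot P Q False False); auto using ev_bot. Qed.

Lemma ev_bang n s p P Q : ev M s (p n) P Q -> ev M s (bang p n) P P.
Proof.
  intros H; eapply ev_conv; [apply ev_neg, (ev_not _ _ _ _ _ H)| |];
    split; try tauto; apply NNPP.
Qed.

Lemma ev_quest n s p P Q : ev M s (p n) P Q -> ev M s (quest p n) Q Q.
Proof.
  intros H; eapply ev_conv; [apply (ev_not _ _ _ _ _ (ev_neg _ _ _ _ _ H))| |];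
    split; try tauto; apply NNPP.
Qed.

Lemma ev_circ n s p P Q : ev M s (p n) P Q -> ev M s (circ p n) (P <-> Q) (P <-> Q).
Proof. intros H; apply ev_iff; [eapply ev_bang | eapply ev_quest]; eauto. Qed.

Lemma ev_form s (p : form) : ev M s p (satT M s p) (~ satF M s p).
Proof. split; [tauto|]. split; [tauto|apply NNPP]. Qed.

Lemma ev_app1 (p : form) n s x a t : s (n - S x) = a -> (forall i, s (n + i) = t i) ->
  ev M s (app p [x] n) (satT M (scons a t) p) (~ satF M (scons a t) p).
Proof.
  intros <- Ht. destruct (sat_ren M p s (fun i => match nth_error [x] i with
                | Some l => n - S l | None => n + (i - length [x]) end)) as [H1 H2].
  unfold app, ev; rewrite H1, H2.
  replace (fun i => s _) with (scons (s (n - S x)) t); [apply ev_form|].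
  apply functional_extensionality; intros [|i]; cbn; auto.
  rewrite Nat.sub_0_r, <- Ht. destruct i; reflexivity.
Qed.

Lemma ev_app2 (p : form) n s x y a b t : s (n - S x) = a -> s (n - S y) = b ->
  (forall i, s (n + i) = t i) ->
  ev M s (app p [x; y] n) (satT M (scons a (scons b t)) p) (~ satF M (scons a (scons b t)) p).
Proof.
  intros <- <- Ht. destruct (sat_ren M p s (fun i => match nth_error [x; y] i with
                | Some l => n - S l | None => n + (i - length [x; y]) end)) as [H1 H2].
  unfold app, ev; rewrite H1, H2.
  replace (fun i => s _) with (scons (s (n - S x)) (scons (s (n - S y)) t)); [apply ev_form|].
  apply functional_extensionality; intros [|[|i]]; cbn; auto.
  rewrite Nat.sub_0_r, <- Ht. destruct i; reflexivity.
Qed.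

Lemma models_axiom (p : sform) : modelsT M (axiom p) <-> forall s, satT M s (p 0).
Proof. apply sat_closure. Qed.

End Ev.

(* The rules [ev_*] are selected by the head symbol of the formula and synthesize its truth and
   non-falsity conditions. [lk] evaluates a de Bruijn level in an extended environment. *)
Create HintDb ev.
Ltac lk := solve [ eassumption | eapply look_new | eapply look_old; [lia | lk] | reflexivity ].
#[export] Hint Extern 0 (_ < _) => lia : ev.
#[export] Hint Extern 0 (@eq (dom _) (_ _) _) => lk : ev.
#[export] Hint Extern 0 (forall i, @eq (dom _) (_ _) _) => intros ?; reflexivity : ev.
#[export] Hint Extern 0 (ev _ _ (sIn _ _ _) _ _) => eapply ev_in : ev.
#[export] Hint Extern 0 (ev _ _ (sEq _ _ _) _ _) => eapply ev_eq : ev.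
#[export] Hint Extern 0 (ev _ _ (sBot _) _ _) => eapply ev_bot : ev.
#[export] Hint Extern 0 (ev _ _ (sNeg _ _) _ _) => eapply ev_neg : ev.
#[export] Hint Extern 0 (ev _ _ (sAnd _ _ _) _ _) => eapply ev_and : ev.
#[export] Hint Extern 0 (ev _ _ (sOr _ _ _) _ _) => eapply ev_or : ev.
#[export] Hint Extern 0 (ev _ _ (sImp _ _ _) _ _) => eapply ev_imp : ev.
#[export] Hint Extern 0 (ev _ _ (sIff _ _ _) _ _) => eapply ev_iff : ev.
#[export] Hint Extern 0 (ev _ _ (sSImp _ _ _) _ _) => eapply ev_simp : ev.
#[export] Hint Extern 0 (ev _ _ (sSIff _ _ _) _ _) => eapply ev_siff : ev.
#[export] Hint Extern 0 (ev _ _ (sNot _ _) _ _) => eapply ev_not : ev.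
#[export] Hint Extern 1 (ev _ _ (bang _ _) _ _) => eapply ev_bang : ev.
#[export] Hint Extern 0 (ev _ _ (quest _ _) _ _) => eapply ev_quest : ev.
#[export] Hint Extern 0 (ev _ _ (circ _ _) _ _) => eapply ev_circ : ev.
#[export] Hint Extern 0 (ev _ _ (sAll _ _) _ _) => eapply ev_all; intros ? : ev.
#[export] Hint Extern 0 (ev _ _ (sEx _ _) _ _) => eapply ev_ex; intros ? : ev.
#[export] Hint Extern 0 (ev _ _ (app _ [_] _) _ _) => eapply ev_app1 : ev.
#[export] Hint Extern 0 (ev _ _ (app _ [_; _] _) _ _) => eapply ev_app2 : ev.
Ltac evs := solve [eauto 1000 with ev nocore].

(** * The abbreviations of BS4 *)

Section Abbrev.
Context {M : TFmodel}.
Implicit Types (x y z a b c u v : M).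

Definition iset x (P Q : M -> Prop) : Prop :=
  forall y, (y ∊ x <-> P y) /\ (y ∊? x <-> Q y).
Definition cl x : Prop := forall y, y ∊ x <-> y ∊? x.
Definition isub x y : Prop := forall z, (z ∊ x -> z ∊ y) /\ (z ∊? x -> z ∊? y).
Definition iempty x := iset x (fun _ => False) (fun _ => False).
Definition ising x u := iset x (fun y => y = u) (fun y => y = u).
Definition iupair x u v := iset x (fun y => y = u \/ y = v) (fun y => y = u \/ y = v).
Definition isucc x y := iset x (fun z => z ∊ y \/ z = y) (fun z => z ∊? y \/ z = y).
Definition ikpair x u v := iset x (fun y => ising y u \/ iupair y u v)
  (fun y => ising y u \/ iupair y u v).
Definition itag0 z x := exists e, iempty e /\ ikpair z x e.
Definition itag1 z x := exists e o, iempty e /\ ising o e /\ ikpair z x o.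
Definition ipair p a b :=
  iset p (fun z => (exists x, itag0 z x /\ x ∊ a) \/ (exists y, itag1 z y /\ y ∊ b))
    (fun z => (exists x, itag0 z x /\ x ∊? a) \/ (exists y, itag1 z y /\ y ∊? b)).

End Abbrev.

(** The formula φ ⇔ ψ is not false when the truth of either side implies the non-falsity of the
    other. This is weaker than [iset], and it disappears wherever the source puts [bang] in
    front. *)
Definition isetQ {M : TFmodel} (x : M) (P Q : M -> Prop) : Prop :=
  forall y, (y ∊ x -> Q y) /\ (P y -> y ∊? x).

Lemma ev_set {M : TFmodel} n (s : nat -> M) x (p : nat -> sform) a P Q : s (n - S x) = a -> x < n ->
  (forall d, ev M (scons d s) (p n (S n)) (P d) (Q d)) ->
  ev M s (is_set x p n) (iset a P Q) (isetQ a P Q).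
Proof. intros; unfold is_set, iset, isetQ. evs. Qed.
#[export] Hint Extern 0 (ev _ _ (is_set _ _ _) _ _) => eapply ev_set; [| |intros ?] : ev.

Lemma ev_sub {M : TFmodel} n (s : nat -> M) x y a b : s (n - S x) = a -> s (n - S y) = b -> x < n -> y < n ->
  ev M s (sub x y n) (isub a b) (forall z, z ∊ a -> z ∊? b).
Proof. intros; unfold sub, isub; evs. Qed.

Lemma ev_classical {M : TFmodel} n (s : nat -> M) x a : s (n - S x) = a -> x < n ->
  ev M s (classical x n) (cl a) (cl a).
Proof. intros; unfold classical, cl. eapply ev_conv; [evs| |]; reflexivity. Qed.

Lemma ev_empty {M : TFmodel} n (s : nat -> M) x a : s (n - S x) = a -> x < n ->
  ev M s (is_empty x n) (iempty a) (isetQ a (fun _ => False) (fun _ => False)).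
Proof. intros; unfold is_empty, iempty. evs. Qed.

Lemma ev_sing {M : TFmodel} n (s : nat -> M) x u a b : s (n - S x) = a -> s (n - S u) = b -> x < n -> u < n ->
  ev M s (is_sing x u n) (ising a b) (isetQ a (fun y => y = b) (fun y => y = b)).
Proof. intros; unfold is_sing, ising. evs. Qed.

Lemma ev_upair {M : TFmodel} n (s : nat -> M) x u v a b c : s (n - S x) = a -> s (n - S u) = b -> s (n - S v) = c ->
  x < n -> u < n -> v < n ->
  ev M s (is_upair x u v n) (iupair a b c)
    (isetQ a (fun y => y = b \/ y = c) (fun y => y = b \/ y = c)).
Proof. intros; unfold is_upair, iupair. evs. Qed.

Lemma ev_succ {M : TFmodel} n (s : nat -> M) x y a b : s (n - S x) = a -> s (n - S y) = b -> x < n -> y < n ->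
  ev M s (is_succ x y n) (isucc a b)
    (isetQ a (fun z => z ∊ b \/ z = b) (fun z => z ∊? b \/ z = b)).
Proof. intros; unfold is_succ, isucc. evs. Qed.

#[export] Hint Extern 0 (ev _ _ (sub _ _ _) _ _) => eapply ev_sub : ev.
#[export] Hint Extern 0 (ev _ _ (classical _ _) _ _) => eapply ev_classical : ev.
#[export] Hint Extern 0 (ev _ _ (is_empty _ _) _ _) => eapply ev_empty : ev.
#[export] Hint Extern 0 (ev _ _ (is_sing _ _ _) _ _) => eapply ev_sing : ev.
#[export] Hint Extern 0 (ev _ _ (is_upair _ _ _ _) _ _) => eapply ev_upair : ev.
#[export] Hint Extern 0 (ev _ _ (is_succ _ _ _) _ _) => eapply ev_succ : ev.

Lemma ev_kpair {M : TFmodel} n (s : nat -> M) x u v a b c : s (n - S x) = a -> s (n - S u) = b -> s (n - S v) = c ->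
  x < n -> u < n -> v < n ->
  ev M s (is_kpair x u v n) (ikpair a b c)
    (isetQ a (fun y => ising y b \/ iupair y b c) (fun y => ising y b \/ iupair y b c)).
Proof. intros; unfold is_kpair, ikpair. evs. Qed.
#[export] Hint Extern 0 (ev _ _ (is_kpair _ _ _ _) _ _) => eapply ev_kpair : ev.

Lemma ev_tag0 {M : TFmodel} n (s : nat -> M) z x a b : s (n - S z) = a -> s (n - S x) = b -> z < n -> x < n ->
  ev M s (bang (is_tag0 z x) n) (itag0 a b) (itag0 a b).
Proof. intros; unfold is_tag0, itag0. evs. Qed.

Lemma ev_tag1 {M : TFmodel} n (s : nat -> M) z x a b : s (n - S z) = a -> s (n - S x) = b -> z < n -> x < n ->
  ev M s (bang (is_tag1 z x) n) (itag1 a b) (itag1 a b).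
Proof. intros; unfold is_tag1, itag1. evs. Qed.
#[export] Hint Extern 0 (ev _ _ (bang (is_tag0 _ _) _) _ _) => eapply ev_tag0 : ev.
#[export] Hint Extern 0 (ev _ _ (bang (is_tag1 _ _) _) _ _) => eapply ev_tag1 : ev.

(** Each clause of [is_pair] compares two formulas that are false exactly when not true; hence truth
    and non-falsity of the whole agree. *)
Lemma ev_pair {M : TFmodel} n (s : nat -> M) x u v a b c : s (n - S x) = a -> s (n - S u) = b -> s (n - S v) = c ->
  x < n -> u < n -> v < n ->
  ev M s (is_pair x u v n) (ipair a b c) (ipair a b c).
Proof.
  intros; unfold is_pair, ipair, iset. eapply ev_conv; [evs| |]; cbn beta;
    (split; [intros [H5 H6] z; specialize (H5 z); specialize (H6 z); tauto
            | intros H5; split; intros z; specialize (H5 z); tauto]).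
Qed.
#[export] Hint Extern 0 (ev _ _ (is_pair _ _ _ _) _ _) => eapply ev_pair : ev.

Definition ipair_in {M : TFmodel} (x y f : M) := exists p, ipair p x y /\ p ∊ f.
Definition ipair_inQ {M : TFmodel} (x y f : M) := exists p, ipair p x y /\ p ∊? f.

Lemma ev_pair_in {M : TFmodel} n (s : nat -> M) x y f a b c :
  s (n - S x) = a -> s (n - S y) = b -> s (n - S f) = c ->
  x < n -> y < n -> f < n ->
  ev M s (pair_in x y f n) (ipair_in a b c) (ipair_inQ a b c).
Proof. intros; unfold pair_in, ipair_in, ipair_inQ. evs. Qed.
#[export] Hint Extern 0 (ev _ _ (pair_in _ _ _ _) _ _) => eapply ev_pair_in : ev.

Definition icfun {M : TFmodel} (f a b : M) :=
  cl a /\ cl f /\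
  (forall z, (z ∊ f -> exists x y, ipair z x y /\ x ∊ a /\ y ∊ b) /\
     (z ∊? f -> exists x y, ipair z x y /\ x ∊? a /\ y ∊? b)) /\
  iset a (fun x => exists y, ipair_in x y f) (fun x => exists y, ipair_inQ x y f) /\
  (forall x y z, ipair_in x y f /\ ipair_in x z f -> y = z).

Definition icfunQ {M : TFmodel} (f a b : M) :=
  cl a /\ cl f /\ (forall z, z ∊ f -> exists x y, ipair z x y /\ x ∊? a /\ y ∊? b) /\
  isetQ a (fun x => exists y, ipair_in x y f) (fun x => exists y, ipair_inQ x y f) /\
  (forall x y z, ipair_in x y f /\ ipair_in x z f -> y = z).

Lemma ev_cfun {M : TFmodel} n (s : nat -> M) x y f a b c :
  s (n - S x) = a -> s (n - S y) = b -> s (n - S f) = c ->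
  x < n -> y < n -> f < n ->
  ev M s (classical_fun f x y n) (icfun c a b) (icfunQ c a b).
Proof. intros; unfold classical_fun, in_prod, icfun, icfunQ. evs. Qed.
#[export] Hint Extern 0 (ev _ _ (classical_fun _ _ _ _) _ _) => eapply ev_cfun : ev.

Definition ilim {M : TFmodel} (a : M) :=
  (exists b, b ∊ a) /\ forall b, b ∊ a -> exists s, isucc s b /\ s ∊ a.
Definition iord {M : TFmodel} (a : M) :=
  cl a /\ (forall b, b ∊ a -> cl b) /\ (forall b, b ∊ a -> isub b a) /\
  (forall b c, b ∊ a /\ c ∊ a -> b ∊ c \/ c ∊ b \/ b = c).
Definition iHCL_rec {M : TFmodel} (f : M) :=
  forall b v, ipair_in b v f ->
    (iempty b /\ iempty v) \/
    (exists c w, isucc b c /\ ipair_in c w f /\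
       iset v (fun x => isub x w /\ cl x) (fun x => isub x w /\ cl x)) \/
    (ilim b /\ iset v (fun z => exists c w, c ∊ b /\ ipair_in c w f /\ z ∊ w)
       (fun z => exists c w, c ∊? b /\ ipair_inQ c w f /\ z ∊? w)).
Definition iHCL_at {M : TFmodel} (a v : M) :=
  iord a /\ exists d f, isucc d a /\ (exists b, icfun f d b) /\ iHCL_rec f /\ ipair_in a v f.
Definition iHCL {M : TFmodel} (x : M) := exists a v, iHCL_at a v /\ x ∊ v.

(** The non-falsity condition can stay anonymous, since [HCL] applies [bang] to the formula built
    from this one. *)
Lemma ev_HCL_at {M : TFmodel} n (s : nat -> M) x y a b :
  s (n - S x) = a -> s (n - S y) = b -> x < n -> y < n ->
  exists Q, ev M s (is_HCL_at x y n) (iHCL_at a b) Q.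
Proof.
  intros; eexists. unfold is_HCL_at, iHCL_at, HCL_rec, iHCL_rec, lim, ilim, ord, iord. evs.
Qed.

Lemma ev_HCL {M : TFmodel} (s : nat -> M) : ev M s HCL (iHCL (s 0)) (iHCL (s 0)).
Proof.
  (* [ev_ex] expects the non-falsity condition as a function of the witnesses, so the anonymous
     conditions are collected by two applications of choice. *)
  assert (E : exists Q, forall d d', ev M (scons d' (scons d s)) (is_HCL_at 1 2 3) (iHCL_at d d') (Q d d')).
  { apply choice with (R := fun d Q => forall d', ev M (scons d' (scons d s)) (is_HCL_at 1 2 3) (iHCL_at d d') (Q d')).
    intros d. apply choice with (R := fun d' Q => ev M (scons d' (scons d s)) (is_HCL_at 1 2 3) (iHCL_at d d') Q).
    intros d'. apply ev_HCL_at; auto; lia. }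
  destruct E as [Q E]. unfold HCL, class1, iHCL. eapply ev_bang.
  eapply ev_ex with (Q := fun d => exists v, Q d v /\ s 0 ∊? v); intros a.
  eapply ev_ex with (Q := fun v => Q a v /\ s 0 ∊? v); intros v.
  apply ev_and; [apply E|]. eapply ev_in; reflexivity.
Qed.

(** * The axioms of BZFC, semantically *)

Lemma models_closed (M : TFmodel) (p : sform) R :
  (forall s, satT M s (p 0) <-> R) -> (modelsT M (axiom p) <-> R).
Proof.
  intros H; rewrite models_axiom. split; [|intros K s; apply H; auto].
  intros K. exact (proj1 (H (fun _ => point M)) (K _)).
Qed.

Lemma models_schema (M : TFmodel) (p : sform) R :
  (forall s, satT M s (p 0) <-> R s) -> (modelsT M (axiom p) <-> forall s, R s).
Proof. intros H; rewrite models_axiom. split; intros K s; apply H; auto. Qed.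

Ltac closed := apply models_closed; intros ?; eapply evT; [evs | cbn beta].
Ltac schema := apply models_schema; intros ?; eapply evT; [evs | cbn beta].

Section BAxioms.
Variable M : TFmodel.

Lemma models_ext : modelsT M ax_ext <-> forall x y : M,
  (x = y <-> forall z, (z ∊ x <-> z ∊ y) /\ (z ∊? x <-> z ∊? y)) /\
  (~ neq M x y <-> forall z, (z ∊ x -> z ∊? y) /\ (z ∊ y -> z ∊? x)).
Proof. closed. reflexivity. Qed.

Lemma models_compr p : modelsT M (ax_compr p) <-> forall s (u : M), exists x,
  iset x (fun y => y ∊ u /\ satT M (scons y s) p) (fun y => y ∊? u /\ ~ satF M (scons y s) p).
Proof. schema.
reflexivity. Qed.

Lemma models_superset : modelsT M ax_superset <-> forall x : M, exists c, isub x c /\ cl c.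
Proof. closed. reflexivity. Qed.

Lemma models_repl p : modelsT M (ax_repl p) <-> forall s,
  (forall x y, satT M (scons x (scons y s)) p <-> ~ satF M (scons x (scons y s)) p) /\
  (forall x, exists y, satT M (scons x (scons y s)) p /\
     forall z, satT M (scons x (scons z s)) p -> y = z) ->
  forall x : M, exists y, iset y
    (fun z => exists w, w ∊ x /\ satT M (scons w (scons z s)) p)
    (fun z => exists w, w ∊? x /\ ~ satF M (scons w (scons z s)) p).
Proof. schema. reflexivity. Qed.

Lemma models_pairing : modelsT M ax_pairing <-> forall u v : M, exists x, iupair x u v.
Proof. closed. reflexivity. Qed.

Lemma models_power : modelsT M ax_power <-> forall u : M, exists v,
  iset v (fun x => isub x u) (fun x => isub x u).
Proof. closed. reflexivity. Qed.

Lemma models_union : modelsT M ax_union <-> forall u : M, exists x,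
  iset x (fun y => exists z, y ∊ z /\ z ∊ u) (fun y => exists z, y ∊? z /\ z ∊? u).
Proof. closed. reflexivity. Qed.

Lemma models_infinity : modelsT M ax_infinity <-> exists x : M,
  (exists e, iempty e /\ e ∊ x) /\ forall y, y ∊ x -> exists s, isucc s y /\ s ∊ x.
Proof. closed. reflexivity. Qed.

Lemma models_foundation p : modelsT M (ax_foundation p) <-> forall s,
  (forall x, (forall y, y ∊ x \/ y ∊? x -> satT M (scons y s) p) -> satT M (scons x s) p) ->
  forall u : M, satT M (scons u s) p.
Proof. schema. reflexivity. Qed.

Lemma models_choice : modelsT M ax_choice <-> forall u : M, cl u ->
  (forall x, x ∊ u -> exists y, y ∊ x) ->
  exists f, (exists b, icfun f u b) /\ forall x, x ∊ u -> exists y, ipair_in x y f /\ y ∊ x.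
Proof. closed. reflexivity. Qed.

Lemma models_acla : modelsT M ax_acla <->
  (exists x : M, ~ forall z, z ∊ x -> z ∊? x) /\ (exists x : M, ~ forall z, z ∊? x -> z ∊ x).
Proof. closed. reflexivity. Qed.
End BAxioms.

(** * The axioms of ZFC, semantically *)

(** The one-component analogue of [ev], for formulas of ZFC: in a two-valued model falsity is the
    complement of truth. Only [tv_neg] appeals to this. *)
Definition tv (M : TFmodel) (s : nat -> M) (p : form) (P : Prop) : Prop := satT M s p <-> P.

Section Tv.
Context {M : TFmodel}.
Implicit Types (s : nat -> M) (n : nat) (p q : sform).

Lemma tv_in n s x y a b : s (n - S x) = a -> s (n - S y) = b -> tv M s (sIn x y n) (a ∊ b).
Proof. intros <- <-; unfold tv; cbn; tauto. Qed.

Lemma tv_eq n s x y a b : s (n - S x) = a -> s (n - S y) = b -> tv M s (sEq x y n) (a = b).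
Proof. intros <- <-; unfold tv; cbn; tauto. Qed.

Lemma tv_bot n s : tv M s (sBot n) False.
Proof. unfold tv; cbn; tauto. Qed.

Lemma tv_neg n s p P : classicalM M -> tv M s (p n) P -> tv M s (sNeg p n) (~ P).
Proof. intros HM H; unfold tv in *; cbn. rewrite satF_classical, H; tauto. Qed.

Lemma tv_and n s p q P P' : tv M s (p n) P -> tv M s (q n) P' -> tv M s (sAnd p q n) (P /\ P').
Proof. unfold tv; cbn; tauto. Qed.

Lemma tv_or n s p q P P' : tv M s (p n) P -> tv M s (q n) P' -> tv M s (sOr p q n) (P \/ P').
Proof. unfold tv; cbn; tauto. Qed.

Lemma tv_imp n s p q P P' : tv M s (p n) P -> tv M s (q n) P' -> tv M s (sImp p q n) (P -> P').
Proof. unfold tv; cbn; tauto. Qed.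

Lemma tv_iff n s p q P P' : tv M s (p n) P -> tv M s (q n) P' -> tv M s (sIff p q n) (P <-> P').
Proof. unfold tv; cbn; tauto. Qed.

Lemma tv_all n s (p : nat -> sform) P :
  (forall d, tv M (scons d s) (p n (S n)) (P d)) -> tv M s (sAll p n) (forall d, P d).
Proof. intros H; unfold tv; cbn. split; intros K d; apply H; auto. Qed.

Lemma tv_ex n s (p : nat -> sform) P :
  (forall d, tv M (scons d s) (p n (S n)) (P d)) -> tv M s (sEx p n) (exists d, P d).
Proof. intros H; unfold tv; cbn. split; intros [d K]; exists d; apply H; auto. Qed.

Lemma tv_app1 (p : form) n s x a t : s (n - S x) = a -> (forall i, s (n + i) = t i) ->
  tv M s (app p [x] n) (satT M (scons a t) p).
Proof. intros; eapply ev_app1; eauto. Qed.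

Lemma tv_app2 (p : form) n s x y a b t : s (n - S x) = a -> s (n - S y) = b ->
  (forall i, s (n + i) = t i) ->
  tv M s (app p [x; y] n) (satT M (scons a (scons b t)) p).
Proof. intros; eapply ev_app2; eauto. Qed.

Lemma tvT s f P R : tv M s f P -> (P <-> R) -> (satT M s f <-> R).
Proof. unfold tv; tauto. Qed.
End Tv.

Create HintDb tv.
#[export] Hint Extern 0 (_ < _) => lia : tv.
#[export] Hint Extern 0 (@eq (dom _) (_ _) _) => lk : tv.
#[export] Hint Extern 0 (forall i, @eq (dom _) (_ _) _) => intros ?; reflexivity : tv.
#[export] Hint Extern 0 (tv _ _ (sIn _ _ _) _) => eapply tv_in : tv.
#[export] Hint Extern 0 (tv _ _ (sEq _ _ _) _) => eapply tv_eq : tv.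
#[export] Hint Extern 0 (tv _ _ (sBot _) _) => eapply tv_bot : tv.
#[export] Hint Extern 0 (tv _ _ (sNeg _ _) _) => eapply tv_neg; [assumption|] : tv.
#[export] Hint Extern 0 (tv _ _ (sAnd _ _ _) _) => eapply tv_and : tv.
#[export] Hint Extern 0 (tv _ _ (sOr _ _ _) _) => eapply tv_or : tv.
#[export] Hint Extern 0 (tv _ _ (sImp _ _ _) _) => eapply tv_imp : tv.
#[export] Hint Extern 0 (tv _ _ (sIff _ _ _) _) => eapply tv_iff : tv.
#[export] Hint Extern 0 (tv _ _ (sAll _ _) _) => eapply tv_all; intros ? : tv.
#[export] Hint Extern 0 (tv _ _ (sEx _ _) _) => eapply tv_ex; intros ? : tv.
#[export] Hint Extern 0 (tv _ _ (app _ [_] _) _) => eapply tv_app1 : tv.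
#[export] Hint Extern 0 (tv _ _ (app _ [_; _] _) _) => eapply tv_app2 : tv.
Ltac tvs := solve [eauto 1000 with tv nocore].

Definition zset {M : TFmodel} (x : M) (P : M -> Prop) := forall y, y ∊ x <-> P y.
Definition zupair {M : TFmodel} (x u v : M) := zset x (fun y => y = u \/ y = v).
Definition zpair {M : TFmodel} (x u v : M) :=
  zset x (fun y => zset y (fun z => z = u) \/ zupair y u v).
Definition zpairin {M : TFmodel} (x y r : M) := exists p, zpair p x y /\ p ∊ r.

Lemma tv_set {M : TFmodel} n (s : nat -> M) x (p : nat -> sform) a P : s (n - S x) = a -> x < n ->
  (forall d, tv M (scons d s) (p n (S n)) (P d)) ->
  tv M s (zis_set x p n) (zset a P).
Proof. intros; unfold zis_set, zset. tvs. Qed.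
#[export] Hint Extern 0 (tv _ _ (zis_set _ _ _) _) => eapply tv_set; [| |intros ?] : tv.

Lemma tv_pair {M : TFmodel} n (s : nat -> M) x u v a b c :
  s (n - S x) = a -> s (n - S u) = b -> s (n - S v) = c -> x < n -> u < n -> v < n ->
  tv M s (zis_pair x u v n) (zpair a b c).
Proof. intros; unfold zis_pair, zpair, zupair, zis_sing, zis_upair. tvs. Qed.
#[export] Hint Extern 0 (tv _ _ (zis_pair _ _ _ _) _) => eapply tv_pair : tv.

Lemma tv_pairin {M : TFmodel} n (s : nat -> M) x u v a b c :
  s (n - S x) = a -> s (n - S u) = b -> s (n - S v) = c -> x < n -> u < n -> v < n ->
  tv M s (zpair_in x u v n) (zpairin a b c).
Proof. intros; unfold zpair_in, zpairin. tvs. Qed.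
#[export] Hint Extern 0 (tv _ _ (zpair_in _ _ _ _) _) => eapply tv_pairin : tv.

Definition zfun {M : TFmodel} (f a : M) :=
  (forall p, p ∊ f -> exists x y, zpair p x y /\ x ∊ a) /\
  (forall x, x ∊ a -> exists y, zpairin x y f) /\
  (forall x y z, zpairin x y f /\ zpairin x z f -> y = z).

Lemma tv_fun {M : TFmodel} n (s : nat -> M) x y a b :
  s (n - S x) = a -> s (n - S y) = b -> x < n -> y < n ->
  tv M s (zis_fun x y n) (zfun a b).
Proof. intros; unfold zis_fun, zfun. tvs. Qed.
#[export] Hint Extern 0 (tv _ _ (zis_fun _ _ _) _) => eapply tv_fun : tv.

Ltac zclosed := apply models_closed; intros ?; eapply tvT; [tvs | reflexivity].
Ltac zschema := apply models_schema; intros ?; eapply tvT; [tvs | reflexivity].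

Section ZAxioms.
Variable M : TFmodel.

Lemma zmodels_ext : modelsT M zax_ext <-> forall x y : M, (forall z, z ∊ x <-> z ∊ y) -> x = y.
Proof. unfold zax_ext. zclosed. Qed.

Lemma zmodels_sep p : modelsT M (zax_sep p) <-> forall s (u : M),
  exists x, zset x (fun y => y ∊ u /\ satT M (scons y s) p).
Proof. zschema. Qed.

Lemma zmodels_repl p : modelsT M (zax_repl p) <-> forall s,
  (forall x y z, satT M (scons x (scons y s)) p /\ satT M (scons x (scons z s)) p -> y = z) ->
  forall u : M, exists v, zset v (fun y => exists x, x ∊ u /\ satT M (scons x (scons y s)) p).
Proof. zschema. Qed.

Lemma zmodels_pairing : modelsT M zax_pairing <-> forall u v : M, exists x, zupair x u v.
Proof. zclosed. Qed.

Lemma zmodels_power : modelsT M zax_power <-> forall u : M, exists v,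
  zset v (fun x => forall z, z ∊ x -> z ∊ u).
Proof. unfold zax_power, zsub. zclosed. Qed.

Lemma zmodels_union : modelsT M zax_union <-> forall u : M, exists x,
  zset x (fun y => exists z, y ∊ z /\ z ∊ u).
Proof. zclosed. Qed.

Lemma zmodels_infinity : modelsT M zax_infinity <-> exists x : M,
  (exists e, zset e (fun _ => False) /\ e ∊ x) /\
  forall y, y ∊ x -> exists s, zset s (fun z => z ∊ y \/ z = y) /\ s ∊ x.
Proof. unfold zax_infinity, zis_empty, zis_succ. zclosed. Qed.

Lemma zmodels_foundation : classicalM M -> (modelsT M zax_foundation <-> forall x : M,
  (exists y, y ∊ x) -> exists y, y ∊ x /\ ~ exists z, z ∊ x /\ z ∊ y).
Proof. intros; zclosed. Qed.

Lemma zmodels_choice : modelsT M zax_choice <-> forall u : M,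
  (forall x, x ∊ u -> exists y, y ∊ x) ->
  exists f, zfun f u /\ forall x, x ∊ u -> exists y, zpairin x y f /\ y ∊ x.
Proof. zclosed. Qed.

Definition zsubset (x y : M) := forall z, z ∊ x -> z ∊ y.
Definition zordinal (a : M) := (forall b, b ∊ a -> zsubset b a) /\
  (forall b c, b ∊ a /\ c ∊ a -> b ∊ c \/ c ∊ b \/ b = c).
Definition zlimit (a : M) := (exists b, b ∊ a) /\
  forall b, b ∊ a -> exists s, zset s (fun z => z ∊ b \/ z = b) /\ s ∊ a.
Definition zW_rec (f : M) := forall b v, zpairin b v f ->
  (zset b (fun _ => False) /\ zset v (fun _ => False)) \/
  (exists c w, zset b (fun z => z ∊ c \/ z = c) /\ zpairin c w f /\
     zset v (fun z => exists x y, zpair z x y /\ zsubset x w /\ zsubset y w)) \/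
  (zlimit b /\ zset v (fun z => exists c w, c ∊ b /\ zpairin c w f /\ z ∊ w)).
Definition zW_at (a v : M) := zordinal a /\ exists d f, zset d (fun z => z ∊ a \/ z = a) /\
  zfun f d /\ zW_rec f /\ zpairin a v f.

Lemma tv_W_at n (s : nat -> M) x y a b :
  s (n - S x) = a -> s (n - S y) = b -> x < n -> y < n ->
  tv M s (is_W_at x y n) (zW_at a b).
Proof.
  intros; unfold is_W_at, zW_at, zord, zordinal, zis_succ, W_rec, zW_rec, zlim, zlimit,
    zis_empty, zis_succ, zsub, zsubset. tvs.
Qed.

Lemma tv_W (s : nat -> M) : satT M s W <-> exists a v, zW_at a v /\ s 0 ∊ v.
Proof.
  unfold W, class1.
  eapply tv_ex; intros a. eapply tv_ex; intros v. eapply tv_and; [|tvs].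
  eapply tv_W_at; auto.
Qed.

Lemma tv_W_in (s : nat -> M) : satT M s W_in <-> exists c d, zpair (s 1) c d /\ s 0 ∊ c.
Proof. unfold W_in, class2. eapply tvT; [tvs | reflexivity]. Qed.

Lemma tv_W_notin (s : nat -> M) : classicalM M ->
  (satT M s W_notin <-> exists c d, zpair (s 1) c d /\ ~ s 0 ∊ d).
Proof. intros; unfold W_notin, class2. eapply tvT; [tvs | reflexivity]. Qed.

Lemma tv_W_neq (s : nat -> M) : classicalM M ->
  (satT M s W_neq <-> exists a b c d, zpair (s 0) a b /\ zpair (s 1) c d /\
    ((exists z, z ∊ a /\ ~ z ∊ d) \/ (exists z, z ∊ c /\ ~ z ∊ b))).
Proof. intros; unfold W_neq, class2. eapply tvT; [tvs | reflexivity]. Qed.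
End ZAxioms.
Arguments zsubset {M}. Arguments zordinal {M}. Arguments zlimit {M}.
Arguments zW_rec {M}. Arguments zW_at {M}.

(** * Set theory common to the models of ZFC and of BZFC *)

Definition both {M : TFmodel} (y x : M) : Prop := y ∊ x \/ y ∊? x.
Definition small {M : TFmodel} (P : M -> Prop) : Prop := exists x, cl x /\ forall y, y ∊ x <-> P y.

(** All set existence here concerns classical sets. Other sets are governed by [ws_ext] and
    [ws_sup], which bounds x^! and x^? together by a classical set. In a model of ZFC every set is
    classical, [small] means being a set, and [ws_sup] is trivial. *)
Class WS0 (M : TFmodel) : Prop := {
  ws_ext : forall x y : M, (forall z, z ∊ x <-> z ∊ y) -> (forall z, z ∊? x <-> z ∊? y) -> x = y;
  ws_sep : forall (P : M -> Prop) u, Def M (fun s => P (s 0)) -> small (fun y => y ∊ u /\ P y);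
  ws_repl : forall (R : M -> M -> Prop) u, Def M (fun s => R (s 0) (s 1)) ->
    (forall x y z, R x y -> R x z -> y = z) -> small (fun y => exists x, x ∊ u /\ R x y);
  ws_sup : forall u : M, exists c, cl c /\ forall z, both z u -> z ∊ c;
  ws_pair : forall a b : M, small (fun y => y = a \/ y = b);
  ws_union : forall u : M, small (fun y => exists z, y ∊ z /\ z ∊ u);
  ws_power : forall u : M, small (fun x => isub x u)
}.

Class WS (M : TFmodel) : Prop := {
  ws_ws0 :: WS0 M;
  ws_ind : forall P : M -> Prop, Def M (fun s => P (s 0)) ->
    (forall x, (forall y, both y x -> P y) -> P x) -> forall x, P x
}.

(** Set-builder notation. The value is meaningful only for small [P], and extensionality then makes
    it unique. *)
Definition mkc {M : TFmodel} (P : M -> Prop) : M :=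
  epsilon (inhabits (point M)) (fun x => cl x /\ forall y, y ∊ x <-> P y).

Section WS.
Context {M : TFmodel} {HW : WS0 M}.
Implicit Types (x y z u v w a b c : M) (P Q : M -> Prop).

Lemma mkc_spec P : small P -> cl (mkc P) /\ forall y, y ∊ mkc P <-> P y.
Proof. intros H. exact (epsilon_spec (inhabits (point M)) _ H). Qed.

Lemma mkc_in P y : small P -> (y ∊ mkc P <-> P y).
Proof. intros H; apply (proj2 (mkc_spec P H)). Qed.

Lemma mkc_cl P : small P -> cl (mkc P).
Proof. intros H; apply (proj1 (mkc_spec P H)). Qed.

Lemma cl_ext x y : cl x -> cl y -> (forall z, z ∊ x <-> z ∊ y) -> x = y.
Proof.
  intros Hx Hy H; apply ws_ext; auto. intros z. rewrite <- (Hx z), <- (Hy z); auto.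
Qed.

Lemma eq_mkc x P : small P -> (x = mkc P <-> cl x /\ forall y, y ∊ x <-> P y).
Proof.
  intros H. destruct (mkc_spec P H) as [H1 H2]. split; [intros ->; auto|].
  intros [H3 H4]. apply cl_ext; auto. intros z. rewrite H2; auto.
Qed.

Lemma iset_mkc x P P' Q : small P -> (forall y, P' y <-> P y) -> (forall y, Q y <-> P y) ->
  (iset x P' Q <-> x = mkc P).
Proof.
  intros H H1 H2. rewrite eq_mkc by auto. unfold iset, cl. split.
  - intros K; split; intros y; destruct (K y); rewrite ?H1, ?H2 in *; tauto.
  - intros [K1 K2] y. rewrite H1, H2, <- K1, K2. tauto.
Qed.

Lemma def_small P : small P -> Def M (fun s => P (s 0)).
Proof.
  intros (x & _ & H). eapply def_iff with (P := fun s => s 0 ∊ x); [def|].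
  intros s; cbn; auto.
Qed.

Lemma small_iff P Q : small P -> (forall y, Q y <-> P y) -> small Q.
Proof. intros (x & H1 & H2) H; exists x; split; auto. intros y; rewrite H; auto. Qed.

Lemma small_sub P Q : small P -> Def M (fun s => Q (s 0)) -> (forall y, Q y -> P y) -> small Q.
Proof.
  intros (x & H1 & H2) HQ H. eapply small_iff; [apply (ws_sep Q x HQ)|].
  cbn; intros y; rewrite H2; firstorder.
Qed.

Lemma small_in u : small (fun y => y ∊ u).
Proof. eapply small_iff; [apply (ws_sep (fun _ => True) u); def|]. cbn; tauto. Qed.

(** Separation starts from the truth-members of a set; a classical superset has the non-false
    members of [u] among these. *)
Lemma small_inQ u : small (fun y => y ∊? u).
Proof.
  destruct (ws_sup u) as (c & H1 & H2). apply small_sub with (fun y => y ∊ c).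
  - apply small_in.
  - def.
  - intros; apply H2; right; auto.
Qed.

Lemma small_eq a : small (fun y => y = a).
Proof. eapply small_iff; [apply (ws_pair a a)|]; cbn; tauto. Qed.

Lemma small_union P : small P -> small (fun y => exists z, y ∊ z /\ P z).
Proof.
  intros (x & H1 & H2). eapply small_iff; [apply (ws_union x)|]. cbn; intros y.
  split; intros (z & ? & ?); exists z; rewrite ?H2 in *; auto; split; auto; apply H2; auto.
Qed.

Lemma small_or P Q : small P -> small Q -> small (fun y => P y \/ Q y).
Proof.
  intros HP HQ. eapply small_iff; [apply (small_union _ (ws_pair (mkc P) (mkc Q)))|].
  cbn; intros y; split.
  - intros [H|H]; [exists (mkc P) | exists (mkc Q)]; rewrite mkc_in; auto.
  - intros (z & H & [->| ->]); rewrite mkc_in in H; auto.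
Qed.

Lemma small_repl P (R : M -> M -> Prop) : small P -> Def M (fun s => R (s 0) (s 1)) ->
  (forall x y z, P x -> R x y -> R x z -> y = z) -> small (fun y => exists x, P x /\ R x y).
Proof.
  intros HP HR H. pose proof (def_small P HP) as HD. destruct HP as (u & H1 & H2).
  eapply small_iff; [apply (ws_repl (fun x y => x ∊ u /\ R x y) u)|].
  - apply def_and; [def|exact HR].
  - intros x y z [] []; eapply H; eauto; apply H2; auto.
  - cbn; intros y; split; intros (x & ?); exists x; rewrite ?H2 in *; tauto.
Qed.

Lemma small_img P (f : M -> M) : small P -> DefT M (fun s => f (s 0)) ->
  small (fun y => exists x, P x /\ y = f x).
Proof.
  intros HP Hf. apply (small_repl P (fun x y => y = f x)); auto.
  - apply def_eq; [apply defT_var|]. exact Hf.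
  - intros; congruence.
Qed.

(** Although [mkc] is chosen by [epsilon], [eq_mkc] describes its graph by a first-order condition
    on the value. *)
Lemma defT_mkc (P : M -> (nat -> M) -> Prop) : (forall s, small (fun y => P y s)) ->
  Def M (fun s => P (s 0) (tail s)) -> DefT M (fun s => mkc (fun y => P y s)).
Proof.
  intros H HP. unfold DefT.
  eapply def_iff with (P := fun s => (forall y, y ∊ s 0 <-> y ∊? s 0) /\
    forall y, y ∊ s 0 <-> P y (tail s)).
  - apply def_and; [def|]. apply def_all. apply def_equiv; [def|].
    apply (def_map _ (fun i => match i with 0 => 0 | S j => S (S j) end) HP).
  - intros s. rewrite eq_mkc by auto. reflexivity.
Qed.

Lemma small_false : small (fun _ : M => False).
Proof. apply small_sub with (fun y => y = point M); [apply small_eq|def|tauto]. Qed.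

Definition emp : M := mkc (fun _ => False).
Definition sg a : M := mkc (fun y => y = a).
Definition upr a b : M := mkc (fun y => y = a \/ y = b).
Definition kp a b : M := upr (sg a) (upr a b).

Lemma in_emp y : y ∊ emp <-> False.
Proof. apply mkc_in, small_false. Qed.
Lemma in_sg y a : y ∊ sg a <-> y = a.
Proof. apply (mkc_in (fun y => y = a)), small_eq. Qed.
Lemma in_upr y a b : y ∊ upr a b <-> y = a \/ y = b.
Proof. apply (mkc_in (fun y => y = a \/ y = b)), ws_pair. Qed.
Lemma in_kp y a b : y ∊ kp a b <-> y = sg a \/ y = upr a b.
Proof. apply in_upr. Qed.

Lemma defT_sg F : DefT M F -> DefT M (fun s => sg (F s)).
Proof.
  apply (defT_sub1 sg). apply (defT_mkc (fun y s => y = s 0)); [intros; apply small_eq|def].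
Qed.

Lemma defT_upr F G : DefT M F -> DefT M G -> DefT M (fun s => upr (F s) (G s)).
Proof.
  apply (defT_sub2 upr). apply (defT_mkc (fun y s => y = s 0 \/ y = s 1)); [|def].
  intros; apply ws_pair.
Qed.

Lemma defT_kp F G : DefT M F -> DefT M G -> DefT M (fun s => kp (F s) (G s)).
Proof. intros; apply defT_upr; [apply defT_sg|apply defT_upr]; auto. Qed.

Lemma sg_inj a b : sg a = sg b -> a = b.
Proof. intros H. apply in_sg. rewrite <- H. apply in_sg; auto. Qed.

Lemma upr_cases a b c d : upr a b = upr c d -> (a = c /\ b = d) \/ (a = d /\ b = c).
Proof.
  intros H. assert (K : forall y, (y = a \/ y = b) <-> (y = c \/ y = d))
    by (intros; rewrite <- !in_upr, H; tauto).
  destruct (proj1 (K a) (or_introl eq_refl)) as [->| ->];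
    destruct (proj1 (K b) (or_intror eq_refl)) as [->| ->]; auto.
  - destruct (proj2 (K d) (or_intror eq_refl)) as [->| ->]; auto.
  - destruct (proj2 (K c) (or_introl eq_refl)) as [->| ->]; auto.
Qed.

Lemma sg_upr' a b c : sg a = upr b c -> a = b /\ a = c.
Proof.
  intros H; split; symmetry; apply in_sg; rewrite H; apply in_upr; auto.
Qed.

Lemma kp_inj a b c d : kp a b = kp c d -> a = c /\ b = d.
Proof.
  intros H. apply upr_cases in H as [[H1 H2]|[H1 H2]].
  - apply sg_inj in H1 as ->. split; auto.
    apply upr_cases in H2 as [[_ H2]|[H2 H3]]; congruence.
  - apply sg_upr' in H1 as [H1 H3]. symmetry in H2. apply sg_upr' in H2 as [H2 H4].
    split; congruence.
Qed.

Lemma iempty_eq x : iempty x <-> x = emp.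
Proof. apply iset_mkc; try tauto. apply small_false. Qed.
Lemma ising_eq x u : ising x u <-> x = sg u.
Proof. apply iset_mkc; try tauto. apply small_eq. Qed.
Lemma iupair_eq x u v : iupair x u v <-> x = upr u v.
Proof. apply iset_mkc; try tauto. apply ws_pair. Qed.
Lemma ikpair_eq x u v : ikpair x u v <-> x = kp u v.
Proof.
  apply iset_mkc; [apply ws_pair| |]; intros y; rewrite ising_eq, iupair_eq; tauto.
Qed.

Definition trans x : Prop := forall u, u ∊ x -> forall w, both w u -> w ∊ x.

Lemma def_both F G : DefT M F -> DefT M G -> Def M (fun s => both (F s) (G s)).
Proof. intros; unfold both; def. Qed.
Lemma def_cl F : DefT M F -> Def M (fun s => cl (F s)).
Proof. apply (def_sub1 cl). unfold cl; def. Qed.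
Lemma def_trans F : DefT M F -> Def M (fun s => trans (F s)).
Proof. apply (def_sub1 trans). unfold trans, both; def. Qed.
End WS.

Arguments emp M : clear implicits.
#[export] Hint Extern 1 (DefT _ (fun s => sg _)) => simple apply @defT_sg; [exact _|] : defs.
#[export] Hint Extern 1 (DefT _ (fun s => upr _ _)) => simple apply @defT_upr; [exact _| |] : defs.
#[export] Hint Extern 1 (DefT _ (fun s => kp _ _)) => simple apply @defT_kp; [exact _| |] : defs.
#[export] Hint Extern 1 (Def _ (fun s => both _ _)) => simple apply def_both : defs.
#[export] Hint Extern 1 (Def _ (fun s => cl _)) => simple apply def_cl : defs.
#[export] Hint Extern 1 (Def _ (fun s => trans _)) => simple apply def_trans : defs.

Definition sc {M : TFmodel} (a : M) : M := mkc (fun z => z ∊ a \/ z = a).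

Lemma in_sc {M : TFmodel} {HW : WS0 M} (z a : M) : z ∊ sc a <-> z ∊ a \/ z = a.
Proof. apply (mkc_in (fun z => z ∊ a \/ z = a)), small_or; [apply small_in|apply small_eq]. Qed.

Lemma defT_sc {M : TFmodel} {HW : WS0 M} F : DefT M F -> DefT M (fun s => sc (F s)).
Proof.
  apply (defT_sub1 sc). apply (defT_mkc (fun z s => z ∊ s 0 \/ z = s 0)); [|def].
  intros; apply small_or; [apply small_in|apply small_eq].
Qed.
#[export] Hint Extern 1 (DefT _ (fun s => sc _)) => simple apply @defT_sc; [exact _|] : defs.

Lemma sc_emp {M : TFmodel} {HW : WS0 M} (a : M) : sc a <> emp M.
Proof. intros H. apply (in_emp a). rewrite <- H. apply in_sc; auto. Qed.

Ltac ws_induction := match goal with |- forall x, @?P x => apply (ws_ind P) end; cbn beta.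

Section TC.
Context {M : TFmodel} {HW : WS M}.
Implicit Types (x y z u v w a b c t : M) (P Q : M -> Prop).

Lemma small_both x : small (fun y => both y x).
Proof. apply small_or; [apply small_in|apply small_inQ]. Qed.

(** By induction: {x} together with the union of the least transitive classical sets around the
    members of x, in either sense of membership. *)
Lemma tc_ex x : exists t, cl t /\ x ∊ t /\ trans t.
Proof.
  revert x; ws_induction; [def|]. intros x IH.
  (* Replacement needs a functional relation, so the arbitrary transitive sets of the induction
     hypothesis give way to the least ones. *)
  pose (isTC := fun y v => cl v /\ y ∊ v /\ trans v /\
    forall t, cl t -> y ∊ t -> trans t -> forall u, u ∊ v -> u ∊ t).
  assert (U : forall y v v', isTC y v -> isTC y v' -> v = v').
  { intros y v v' (H1 & H2 & H3 & H4) (H5 & H6 & H7 & H8). apply cl_ext; auto.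
    intros z; split; auto. }
  assert (E : forall y, both y x -> exists v, isTC y v).
  { intros y Hy. destruct (IH y Hy) as (t & H1 & H2 & H3).
    assert (K : small (fun u => forall t, cl t -> y ∊ t -> trans t -> u ∊ t)).
    { apply small_sub with (fun u => u ∊ t); [apply small_in|def|]. intros; auto. }
    exists (mkc (fun u => forall t, cl t -> y ∊ t -> trans t -> u ∊ t)).
    repeat split; [apply mkc_cl, K..| | |].
    - apply mkc_in; auto.
    - intros u Hu w Hw. rewrite mkc_in in * by auto. intros t' H4 H5 H6.
      apply (H6 u); auto.
    - intros t' H4 H5 H6 u Hu. rewrite mkc_in in Hu by auto. auto. }
  assert (K : small (fun z => z = x \/ exists v, z ∊ v /\ exists y, both y x /\ isTC y v)).
  { apply small_or; [apply small_eq|]. apply small_union. apply small_repl.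
    - apply small_both.
    - unfold isTC. def.
    - intros; eauto. }
  exists (mkc (fun z => z = x \/ exists v, z ∊ v /\ exists y, both y x /\ isTC y v)).
  split; [apply mkc_cl, K|]. split; [apply mkc_in; auto|].
  intros u Hu w Hw. rewrite mkc_in in * by auto. right.
  destruct Hu as [->|(v & Hv & y & Hy & HT)].
  - destruct (E w Hw) as [v Hv]. exists v; split; eauto. exact (proj1 (proj2 Hv)).
  - exists v; split; eauto. destruct HT as (_ & _ & HT & _). apply (HT u); auto.
Qed.

(** * Hereditarily classical sets *)

(** A transitive witness takes the place of a recursion, which makes the class first-order
    definable. [HC_iff] recovers the recursive description. *)
Definition HC x : Prop := exists t, cl t /\ x ∊ t /\ trans t /\ forall u, u ∊ t -> cl u.

Lemma def_HC F : DefT M F -> Def M (fun s => HC (F s)).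
Proof. apply (def_sub1 HC). unfold HC; def. Qed.

Lemma HC_cl x : HC x -> cl x.
Proof. intros (t & H1 & H2 & H3 & H4); auto. Qed.

Lemma HC_in x y : HC x -> both y x -> HC y.
Proof. intros (t & H1 & H2 & H3 & H4) H. exists t.
  refine (conj H1 (conj _ (conj H3 H4))). apply (H3 x); auto. Qed.

Lemma HC_iff x : HC x <-> cl x /\ forall y, y ∊ x -> HC y.
Proof.
  split.
  - intros H; split; [apply HC_cl; auto|]. intros y Hy; apply (HC_in x); auto. left; auto.
  - intros [Hx H]. destruct (tc_ex x) as (t & H1 & H2 & H3).
    (* A transitive set around [x] may contain sets that are not hereditarily classical; the witness
       keeps [x] and the elements already in [HC]. *)
    assert (K : small (fun u => u ∊ t /\ (u = x \/ HC u))).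
    { apply small_sub with (fun u => u ∊ t); [apply small_in| |tauto].
      apply def_and; [def|]. apply def_or; [def|]. apply def_HC; def. }
    exists (mkc (fun u => u ∊ t /\ (u = x \/ HC u))).
    split; [apply mkc_cl; auto|]. split; [apply mkc_in; auto|]. split.
    + intros u Hu w Hw. rewrite mkc_in in * by auto. destruct Hu as [Hu Hu'].
      split; [apply (H3 u); auto|]. right. destruct Hu' as [->|Hu'].
      * apply H. destruct Hw; auto. apply Hx; auto.
      * apply (HC_in u); auto.
    + intros u Hu. rewrite mkc_in in Hu by auto. destruct Hu as [_ [->|Hu]]; auto.
      apply HC_cl; auto.
Qed.

Lemma HC_mkc P : small P -> (forall y, P y -> HC y) -> HC (mkc P).
Proof.
  intros H1 H2. apply HC_iff. split; [apply mkc_cl; auto|].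
  intros y Hy. rewrite mkc_in in Hy; auto.
Qed.

Lemma HC_emp : HC (emp M).
Proof. apply HC_mkc; [apply small_false|tauto]. Qed.
Lemma HC_sg a : HC a -> HC (sg a).
Proof. intros H. apply HC_mkc; [apply small_eq|]. intros y ->; auto. Qed.
Lemma HC_upr a b : HC a -> HC b -> HC (upr a b).
Proof. intros H H'. apply HC_mkc; [apply ws_pair|]. intros y [->| ->]; auto. Qed.
Lemma HC_kp a b : HC a -> HC b -> HC (kp a b).
Proof. intros; apply HC_upr; [apply HC_sg|apply HC_upr]; auto. Qed.

Lemma HC_kp_inv a b : HC (kp a b) -> HC a /\ HC b.
Proof.
  intros H. assert (K : HC (upr a b)).
  { apply HC_iff in H as [_ H]. apply H, in_kp; auto. }
  apply HC_iff in K as [_ K]. split; apply K, in_upr; auto.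
Qed.

(** * The recursion [j x = (j[x^!], j[x^?])], as a bisimulation *)

(** Only a back-and-forth condition between [a] and the members of [x]. That [a] is the exact image
    follows once [J] is known to be functional. *)
Definition img (x : M) (a : M) (f : M) (m : M -> M -> Prop) : Prop :=
  (forall z, z ∊ a -> exists w, m w x /\ kp w z ∊ f) /\
  (forall w, m w x -> exists z, z ∊ a /\ kp w z ∊ f).
Definition bis (f : M) : Prop := forall u v, kp u v ∊ f ->
  exists a b, cl a /\ cl b /\ v = kp a b /\
    img u a f (fun w u => w ∊ u) /\ img u b f (fun w u => w ∊? u).
Definition J (x y : M) : Prop := exists f, kp x y ∊ f /\ bis f.

Lemma def_J F G : DefT M F -> DefT M G -> Def M (fun s => J (F s) (G s)).
Proof. apply (def_sub2 J). unfold J, bis, img. def. Qed.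

Lemma J_step x y : J x y -> exists a b, cl a /\ cl b /\ y = kp a b /\
  (forall z, z ∊ a -> exists w, w ∊ x /\ J w z) /\
  (forall w, w ∊ x -> exists z, z ∊ a /\ J w z) /\
  (forall z, z ∊ b -> exists w, w ∊? x /\ J w z) /\
  (forall w, w ∊? x -> exists z, z ∊ b /\ J w z).
Proof.
  intros (f & H & Hf). destruct (Hf x y H) as (a & b & H1 & H2 & H3 & [H4 H5] & [H6 H7]).
  exists a, b. unfold J. refine (conj H1 (conj H2 (conj H3 _))).
  repeat split; intros z Hz; [apply H4 in Hz|apply H5 in Hz|apply H6 in Hz|apply H7 in Hz];
    destruct Hz as (w & ? & ?); eauto 6.
Qed.

(** Induction on [x]: an element of a component of [y] has a partner in [x], that partner has
    another one in the matching component of [y'], and the induction hypothesis identifies the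
    two. *)
Lemma J_fun x : forall y y', J x y -> J x y' -> y = y'.
Proof.
  revert x; ws_induction.
  { repeat (apply def_all; dn). apply def_imp; [apply def_J; def|].
    apply def_imp; [apply def_J; def|def]. }
  intros x IH y y' H H'.
  apply J_step in H as (a & b & H1 & H2 & -> & H3 & H4 & H5 & H6).
  apply J_step in H' as (a' & b' & H1' & H2' & -> & H3' & H4' & H5' & H6').
  f_equal; apply cl_ext; auto; intros z; split; intros Hz.
  - destruct (H3 z Hz) as (w & Hw & K). destruct (H4' w Hw) as (z' & Hz' & K').
    rewrite (IH w) with (y := z) (y' := z'); auto. left; auto.
  - destruct (H3' z Hz) as (w & Hw & K). destruct (H4 w Hw) as (z' & Hz' & K').
    rewrite (IH w) with (y := z) (y' := z'); auto. left; auto.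
  - destruct (H5 z Hz) as (w & Hw & K). destruct (H6' w Hw) as (z' & Hz' & K').
    rewrite (IH w) with (y := z) (y' := z'); auto. right; auto.
  - destruct (H5' z Hz) as (w & Hw & K). destruct (H6 w Hw) as (z' & Hz' & K').
    rewrite (IH w) with (y := z) (y' := z'); auto. right; auto.
Qed.

(** The two components of the value determine x^! and x^? respectively, and extensionality compares
    exactly these. *)
Lemma J_inj x : forall x' y, J x y -> J x' y -> x = x'.
Proof.
  revert x; ws_induction.
  { repeat (apply def_all; dn). apply def_imp; [apply def_J; def|].
    apply def_imp; [apply def_J; def|def]. }
  intros x IH x' y H H'.
  apply J_step in H as (a & b & H1 & H2 & -> & H3 & H4 & H5 & H6).
  apply J_step in H' as (a' & b' & H1' & H2' & E & H3' & H4' & H5' & H6').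
  apply kp_inj in E as [<- <-].
  apply ws_ext; intros w; split; intros Hw.
  - destruct (H4 w Hw) as (z & Hz & K). destruct (H3' z Hz) as (w' & Hw' & K').
    rewrite (IH w) with (x' := w') (y := z); auto. left; auto.
  - destruct (H4' w Hw) as (z & Hz & K). destruct (H3 z Hz) as (w' & Hw' & K').
    rewrite <- (IH w') with (x' := w) (y := z); auto. left; auto.
  - destruct (H6 w Hw) as (z & Hz & K). destruct (H5' z Hz) as (w' & Hw' & K').
    rewrite (IH w) with (x' := w') (y := z); auto. right; auto.
  - destruct (H6' w Hw) as (z & Hz & K). destruct (H5 z Hz) as (w' & Hw' & K').
    rewrite <- (IH w') with (x' := w) (y := z); auto. right; auto.
Qed.

Lemma small_J P : small P -> small (fun z => exists w, P w /\ J w z).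
Proof.
  intros H; apply (small_repl P J); auto; [apply def_J; def|].
  intros; eapply J_fun; eauto.
Qed.

Definition jimg (P : M -> Prop) : M := mkc (fun z => exists w, P w /\ J w z).

Lemma in_jimg P z : small P -> (z ∊ jimg P <-> exists w, P w /\ J w z).
Proof. intros; apply (mkc_in (fun z => exists w, P w /\ J w z)), small_J; auto. Qed.

Lemma J_mk x : (forall w, both w x -> exists z, J w z) ->
  J x (kp (jimg (fun w => w ∊ x)) (jimg (fun w => w ∊? x))).
Proof.
  intros IH. set (y := kp _ _). destruct (tc_ex x) as (t & H1 & H2 & H3).
  (* The bisimulation is the graph of [J] on a transitive set around [x], with the new pair for [x]
     on top; transitivity keeps the partners of all members inside. *)
  pose (Q := fun p => p = kp x y \/ exists u, u ∊ t /\ exists v, J u v /\ p = kp u v).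
  assert (HQ : small Q).
  { apply small_or; [apply small_eq|].
    apply (small_repl (fun u => u ∊ t) (fun u p => exists v, J u v /\ p = kp u v)).
    - apply small_in.
    - apply def_ex; dn. apply def_and; [apply def_J; def|def].
    - intros u p p' _ (v & Hv & ->) (v' & Hv' & ->). f_equal; eapply J_fun; eauto. }
  assert (HJ : forall u v, u ∊ t -> J u v -> kp u v ∊ mkc Q).
  { intros; apply mkc_in; auto. right; eauto 6. }
  exists (mkc Q). split; [apply mkc_in; auto; left; auto|].
  intros u v H. apply (mkc_in Q) in H; auto. destruct H as [H|(u' & Hu & v' & HJ' & H)].
  - apply kp_inj in H as [-> ->].
    exists (jimg (fun w => w ∊ x)), (jimg (fun w => w ∊? x)).
    split; [apply mkc_cl, small_J, small_in|]. split; [apply mkc_cl, small_J, small_inQ|].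
    split; auto. split; split.
    + intros z Hz. apply in_jimg in Hz as (w & Hw & K); [|apply small_in].
      exists w; split; auto. apply HJ; auto. apply (H3 x); auto. left; auto.
    + intros w Hw. destruct (IH w) as [z Hz]; [left; auto|]. exists z. split.
      * apply in_jimg; [apply small_in|eauto].
      * apply HJ; auto. apply (H3 x); auto. left; auto.
    + intros z Hz. apply in_jimg in Hz as (w & Hw & K); [|apply small_inQ].
      exists w; split; auto. apply HJ; auto. apply (H3 x); auto. right; auto.
    + intros w Hw. destruct (IH w) as [z Hz]; [right; auto|]. exists z. split.
      * apply in_jimg; [apply small_inQ|eauto].
      * apply HJ; auto. apply (H3 x); auto. right; auto.
  - apply kp_inj in H as [<- <-].
    destruct (J_step u v HJ') as (a & b & K1 & K2 & K3 & K4 & K5 & K6 & K7).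
    exists a, b. refine (conj K1 (conj K2 (conj K3 _))). repeat split; intros z Hz;
      [destruct (K4 z Hz) as (w & Hw & K)|destruct (K5 z Hz) as (w & Hw & K)
      |destruct (K6 z Hz) as (w & Hw & K)|destruct (K7 z Hz) as (w & Hw & K)]; exists w; split; auto; apply HJ; auto;
      apply (H3 u); auto; unfold both; auto.
Qed.

Lemma J_tot x : exists y, J x y.
Proof.
  revert x; ws_induction; [apply def_ex; apply def_J; def|].
  intros x IH. eexists; apply J_mk; auto.
Qed.

Lemma J_iff x y : J x y <-> y = kp (jimg (fun w => w ∊ x)) (jimg (fun w => w ∊? x)).
Proof.
  assert (H : J x (kp (jimg (fun w => w ∊ x)) (jimg (fun w => w ∊? x))))
    by (apply J_mk; intros; apply J_tot).
  split; [intros K; eapply J_fun; eauto | intros ->; auto].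
Qed.

Lemma J_jimg P w z : small P -> J w z -> (z ∊ jimg P <-> P w).
Proof.
  intros HP Hw. rewrite in_jimg by auto. split; eauto.
  intros (w' & H & H'). rewrite (J_inj w w' z); auto.
Qed.
Lemma small_prod P Q : small P -> small Q -> small (fun p => exists x y, P x /\ Q y /\ p = kp x y).
Proof.
  intros HP HQ.
  assert (E : forall x, small (fun p => exists y, Q y /\ p = kp x y)).
  { intros x. apply (small_img Q (fun y => kp x y)); [auto|def]. }
  eapply small_iff; [apply (small_union (fun v => exists x, P x /\ v = mkc (fun p => exists y, Q y /\ p = kp x y)))|].
  - apply (small_img P (fun x => mkc (fun p => exists y, Q y /\ p = kp x y))); auto.
    apply (defT_mkc (fun p s => exists y, Q y /\ p = kp (s 0) y)); [intros; apply E|].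
    apply def_ex; dn. apply def_and; [|def]. apply (def_sub1 Q); [apply def_small; auto|def].
  - cbn; intros p; split.
    + intros (x & y & H1 & H2 & ->). exists (mkc (fun p => exists y, Q y /\ p = kp x y)).
      rewrite mkc_in by auto. split; [exists y|exists x]; auto.
    + intros (v & Hp & x & Hx & ->). rewrite mkc_in in Hp by auto.
      destruct Hp as (y & Hy & ->); eauto.
Qed.
(** The disjoint union behind the ordered pair (a,b): it describes (a,b)^! when applied to
    truth-membership and (a,b)^? when applied to non-falsity. *)
Definition tagc (A B : M -> Prop) z : Prop :=
  (exists x, z = kp x (emp M) /\ A x) \/ (exists y, z = kp y (sg (emp M)) /\ B y).

Lemma emp_sg : emp M <> sg (emp M).
Proof. intros H. apply (in_emp (emp M)). rewrite H at 2. apply in_sg; auto. Qed.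

Lemma tagc0 A B x : tagc A B (kp x (emp M)) <-> A x.
Proof.
  split; [|left; eauto]. intros [(y & H & HA)|(y & H & HA)]; apply kp_inj in H as [-> H]; auto.
  destruct emp_sg; auto.
Qed.

Lemma tagc1 A B x : tagc A B (kp x (sg (emp M))) <-> B x.
Proof.
  split; [|right; eauto]. intros [(y & H & HA)|(y & H & HA)]; apply kp_inj in H as [-> H]; auto.
  destruct emp_sg; auto.
Qed.

Lemma small_tagc A B : small A -> small B -> small (tagc A B).
Proof.
  intros HA HB. unfold tagc. apply small_or.
  - eapply small_iff; [apply (small_img A (fun x => kp x (emp M))); [auto|def]|].
    cbn; intros z; split; intros (x & H1 & H2); exists x; auto.
  - eapply small_iff; [apply (small_img B (fun x => kp x (sg (emp M)))); [auto|def]|].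
    cbn; intros z; split; intros (x & H1 & H2); exists x; auto.
Qed.

Lemma itag0_eq z x : itag0 z x <-> z = kp x (emp M).
Proof.
  unfold itag0. split.
  - intros (e & He & H). apply iempty_eq in He as ->. apply ikpair_eq; auto.
  - intros ->. exists (emp M). rewrite iempty_eq, ikpair_eq; auto.
Qed.

Lemma itag1_eq z x : itag1 z x <-> z = kp x (sg (emp M)).
Proof.
  unfold itag1. split.
  - intros (e & o & He & Ho & H). apply iempty_eq in He as ->. apply ising_eq in Ho as ->.
    apply ikpair_eq; auto.
  - intros ->. exists (emp M), (sg (emp M)). rewrite iempty_eq, ising_eq, ikpair_eq; auto.
Qed.

End TC.

#[export] Hint Extern 1 (Def _ (fun s => HC _)) => simple apply def_HC : defs.
#[export] Hint Extern 1 (Def _ (fun s => J _ _)) => simple apply @def_J; [exact _| |] : defs.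

(** * Models of ZFC *)

Definition ZFCmodel (M : TFmodel) : Prop := classicalM M /\ forall q, ZFC q -> modelsT M q.

Section FromZFC.
Variable M : TFmodel.
Hypothesis HM : ZFCmodel M.
Implicit Types (x y z u v w a b c t : M).

Lemma inQ_classical x y : classicalM M -> (x ∊? y <-> x ∊ y).
Proof. intros [H _]. rewrite H. split; [apply NNPP|tauto]. Qed.

Lemma cl_classical x : classicalM M -> cl x.
Proof. intros H y. rewrite inQ_classical; tauto. Qed.

Lemma small_z (P : M -> Prop) : (exists x, zset x P) -> small P.
Proof. intros [x Hx]. exists x; split; auto. apply cl_classical, HM. Qed.

Lemma ZFC_WS0 : WS0 M.
Proof.
  destruct HM as [HC HZ]. split.
  - intros x y H _. apply (proj1 (zmodels_ext M)); auto. apply HZ; constructor.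
  - intros P u HP. apply small_z. apply def_formula1 in HP as (p & t & H).
    destruct (proj1 (zmodels_sep M p) (HZ _ (ZFC_sep p)) t u) as [x Hx].
    exists x; intros y; rewrite (Hx y), H; tauto.
  - intros R u HR Hf. apply small_z. apply def_formula2 in HR as (p & t & H).
    destruct (proj1 (zmodels_repl M p) (HZ _ (ZFC_repl p)) t) with (u := u) as [x Hx].
    { intros x y z; rewrite <- !H. intros []; eauto. }
    exists x; intros y; rewrite (Hx y). split; intros (z & ?); exists z; rewrite H in *; auto.
  - intros u. exists u; split; [apply cl_classical, HC|].
    intros z [Hz|Hz]; auto. apply inQ_classical; auto.
  - intros a b. apply small_z. apply (proj1 (zmodels_pairing M)). apply HZ; constructor.
  - intros u. apply small_z. apply (proj1 (zmodels_union M)). apply HZ; constructor.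
  - intros u. apply small_z. destruct (proj1 (zmodels_power M) (HZ _ ZFC_power) u) as [v Hv].
    exists v; intros x. rewrite (Hv x). unfold isub.
    split; intros H z; [|apply H]. specialize (H z).
    rewrite !inQ_classical by auto; auto.
Qed.

Lemma ZFC_foundation_set x : (exists y, y ∊ x) -> exists y, y ∊ x /\ ~ exists z, z ∊ x /\ z ∊ y.
Proof. apply (zmodels_foundation M (proj1 HM)). apply HM; constructor. Qed.

Local Existing Instance ZFC_WS0.

Lemma small_succ a : small (fun z => z ∊ a \/ z = a).
Proof. apply small_or; [apply small_in|apply small_eq]. Qed.

Lemma ZFC_infinity_set : exists I : M, emp M ∊ I /\
  forall y, y ∊ I -> mkc (fun z => z ∊ y \/ z = y) ∊ I.
Proof.
  destruct (proj1 (zmodels_infinity M) (proj2 HM _ ZFC_infinity)) as (I & (e & He & HeI) & HI).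
  exists I; split.
  - replace (emp M) with e; auto. apply eq_mkc; [apply small_false|].
    split; [apply cl_classical, HM|auto].
  - intros y Hy. destruct (HI y Hy) as (s & Hs & HsI).
    rewrite <- (proj2 (eq_mkc s _ (small_succ y))); auto.
    split; [apply cl_classical, HM|auto].
Qed.

(** * Natural numbers, transitive closures and ∈-induction in ZFC *)

Lemma ZFC_sc_inj a b : sc a = sc b -> a = b.
Proof.
  intros H. assert (Ha : a ∊ b \/ a = b) by (rewrite <- in_sc, <- H; apply in_sc; auto).
  assert (Hb : b ∊ a \/ b = a) by (rewrite <- in_sc, H; apply in_sc; auto).
  destruct Ha as [Ha|]; auto. destruct Hb as [Hb|]; auto. exfalso.
  destruct (ZFC_foundation_set (upr a b)) as (y & Hy & Hn); [exists a; apply in_upr; auto|].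
  apply Hn. apply in_upr in Hy as [->| ->]; [exists b|exists a]; rewrite in_upr; auto.
Qed.

(** The elements of ω. Induction for classes has to be derived from Foundation for sets, hence
    transitive closures are required beforehand, and they are built by iterating unions along ω. *)
Definition natural a := forall I : M, emp M ∊ I -> (forall y, y ∊ I -> sc y ∊ I) -> a ∊ I.

Lemma small_natural : small natural.
Proof.
  destruct ZFC_infinity_set as (I & H1 & H2). apply small_sub with (fun y => y ∊ I).
  - apply small_in.
  - unfold natural. apply def_all; dn. apply def_imp; [def|]. apply def_imp; [|def].
    apply def_all; dn. apply def_imp; [def|]. apply def_inT; [|def]. apply defT_sc; def.
  - intros y Hy; apply Hy; auto.
Qed.

Lemma natural_ind (P : M -> Prop) : Def M (fun s => P (s 0)) -> P (emp M) ->
  (forall a, natural a -> P a -> P (sc a)) -> forall a, natural a -> P a.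
Proof.
  intros HP H0 HS a Ha.
  assert (K : small (fun y => natural y /\ P y)).
  { apply small_sub with natural; [apply small_natural| |tauto].
    apply def_and; auto. apply def_small, small_natural. }
  assert (K' : a ∊ mkc (fun y => natural y /\ P y)).
  { apply Ha; [rewrite mkc_in; auto; split; auto; intros I HI _; auto|].
    intros y. rewrite !mkc_in by auto. intros [H1 H2]; split; auto.
    intros I HI HI'. apply HI', H1; auto. }
  rewrite mkc_in in K' by auto; tauto.
Qed.

Definition Un x : M := mkc (fun y => exists z, y ∊ z /\ z ∊ x).

Lemma in_Un y x : y ∊ Un x <-> exists z, y ∊ z /\ z ∊ x.
Proof. apply (mkc_in (fun y => exists z, y ∊ z /\ z ∊ x)), ws_union. Qed.

Lemma defT_Un F : DefT M F -> DefT M (fun s => Un (F s)).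
Proof.
  apply (defT_sub1 Un). apply (defT_mkc (fun y s => exists z, y ∊ z /\ z ∊ s 0)); [|def].
  intros; apply ws_union.
Qed.

(* The relation [y = ⋃^n x], given by approximating functions. *)
Definition iter_un x n y := exists f, kp n y ∊ f /\ forall k z, kp k z ∊ f ->
  (k = emp M /\ z = x) \/ (exists k' w, k = sc k' /\ kp k' w ∊ f /\ z = Un w).

Lemma def_iter_un x : Def M (fun s => iter_un x (s 0) (s 1)).
Proof.
  unfold iter_un. apply def_ex; dn. apply def_and; [def|].
  repeat (apply def_all; dn). apply def_imp; [def|]. apply def_or; [def|].
  repeat (apply def_ex; dn). apply def_and; [|apply def_and; [def|]].
  - apply def_eq; [def|]. apply defT_sc; def.
  - apply def_eq; [def|]. apply defT_Un; def.
Qed.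

Lemma iter_un_step x n y : iter_un x n y -> (n = emp M /\ y = x) \/
  (exists k w, n = sc k /\ iter_un x k w /\ y = Un w).
Proof.
  intros (f & H & Hf). destruct (Hf n y H) as [|(k & w & -> & H1 & ->)]; auto.
  right; exists k, w. repeat split; auto. exists f; auto.
Qed.

Lemma iter_un_fun x n : natural n -> forall y y', iter_un x n y -> iter_un x n y' -> y = y'.
Proof.
  revert n. apply (natural_ind (fun n => forall y y', iter_un x n y -> iter_un x n y' -> y = y')).
  { repeat (apply def_all; dn).
    apply def_imp; [apply (def_map _ (fun i => match i with 0 => 2 | _ => 1 end) (def_iter_un x))|].
    apply def_imp; [apply (def_map _ (fun i => match i with 0 => 2 | _ => 0 end) (def_iter_un x))|].
    def. }
  - intros y y' H H'. apply iter_un_step in H as [[_ ->]|(k & w & H & _)], H' as [[_ ->]|(k' & w' & H' & _)];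
      auto; exfalso; eapply sc_emp; eauto.
  - intros a Ha IH y y' H H'.
    apply iter_un_step in H as [[H _]|(k & w & H & K & ->)]; [exfalso; eapply sc_emp; eauto|].
    apply iter_un_step in H' as [[H' _]|(k' & w' & H' & K' & ->)]; [exfalso; eapply sc_emp; eauto|].
    apply ZFC_sc_inj in H as <-. apply ZFC_sc_inj in H' as <-. f_equal. auto.
Qed.

Lemma iter_un_0 x : iter_un x (emp M) x.
Proof.
  exists (sg (kp (emp M) x)). split; [apply in_sg; auto|].
  intros k z H. apply in_sg, kp_inj in H. auto.
Qed.

Lemma iter_un_S x n y : iter_un x n y -> iter_un x (sc n) (Un y).
Proof.
  intros (f & H & Hf).
  assert (K : small (fun p => p ∊ f \/ p = kp (sc n) (Un y)))
    by (apply small_or; [apply small_in|apply small_eq]).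
  exists (mkc (fun p => p ∊ f \/ p = kp (sc n) (Un y))).
  split; [apply mkc_in; auto|]. intros k z Hz. rewrite mkc_in in Hz by auto.
  destruct Hz as [Hz|Hz].
  - destruct (Hf k z Hz) as [|(k' & w & -> & H1 & ->)]; auto.
    right; exists k', w; rewrite mkc_in; auto.
  - apply kp_inj in Hz as [-> ->]. right; exists n, y; rewrite mkc_in; auto.
Qed.

(** The union of the iterates ⋃^n x. A member of an element of one iterate belongs to the next one,
    which gives transitivity. *)
Lemma trans_closure x : exists t, (forall y, y ∊ x -> y ∊ t) /\
  forall u, u ∊ t -> forall w, w ∊ u -> w ∊ t.
Proof.
  assert (K : small (fun u => exists y, u ∊ y /\ exists n, natural n /\ iter_un x n y)).
  { apply small_union. apply small_repl.
    - apply small_natural.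
    - apply def_iter_un.
    - intros; eapply iter_un_fun; eauto. }
  exists (mkc (fun u => exists y, u ∊ y /\ exists n, natural n /\ iter_un x n y)). split.
  - intros y Hy. apply mkc_in; auto. exists x; split; auto. exists (emp M).
    split; [intros I HI _; auto|apply iter_un_0].
  - intros u Hu w Hw. rewrite mkc_in in * by auto. destruct Hu as (y & Hy & n & Hn & H).
    exists (Un y). split; [apply in_Un; eauto|]. exists (sc n).
    split; [|apply iter_un_S; auto]. intros I HI HI'. apply HI', Hn; auto.
Qed.

(** Inside a transitive set around a counterexample, all counterexamples form a set, and an
    ∈-minimal one violates the induction step. *)
Lemma ZFC_WS : WS M.
Proof.
  split; [exact _|]. intros P HP IH x. apply NNPP; intros Hx.
  destruct (trans_closure (sg x)) as (t & H1 & H2).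
  assert (K : small (fun u => u ∊ t /\ ~ P u)).
  { apply small_sub with (fun u => u ∊ t); [apply small_in| |tauto].
    apply def_and; [def|apply def_not; auto]. }
  destruct (ZFC_foundation_set (mkc (fun u => u ∊ t /\ ~ P u))) as (y & Hy & Hn).
  { exists x. apply mkc_in; auto. split; auto. apply H1, in_sg; auto. }
  rewrite mkc_in in Hy by auto. destruct Hy as [Hy Hy']. apply Hy', IH.
  intros z Hz. apply NNPP; intros Hz'. apply Hn. exists z.
  assert (z ∊ y) by (destruct Hz as [|Hz]; auto; apply inQ_classical in Hz; auto; apply HM).
  rewrite mkc_in by auto. split; auto. split; auto. apply (H2 y); auto.
Qed.

Lemma ZFC_choice_set u : (forall x, x ∊ u -> exists y, y ∊ x) ->
  exists f, zfun f u /\ forall x, x ∊ u -> exists y, zpairin x y f /\ y ∊ x.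
Proof. apply (zmodels_choice M). apply HM; constructor. Qed.
End FromZFC.

Class ZF (M : TFmodel) : Prop := { zf_classical : classicalM M; zf_ws :: WS M }.

Section ZF.
Context {M : TFmodel} {HZ : ZF M}.
Implicit Types (x y z u v w a b c d t f : M) (P Q : M -> Prop).

Lemma zf_cl x : cl x.
Proof. apply cl_classical, zf_classical. Qed.

Lemma zf_ext x y : (forall z, z ∊ x <-> z ∊ y) -> x = y.
Proof. apply cl_ext; apply zf_cl. Qed.

Lemma zf_ind P : Def M (fun s => P (s 0)) -> (forall x, (forall y, y ∊ x -> P y) -> P x) ->
  forall x, P x.
Proof.
  intros HP IH. apply ws_ind; auto. intros x Hx. apply IH. intros y Hy; apply Hx; left; auto.
Qed.

End ZF.

Ltac zf_induction := match goal with |- forall x, @?P x => apply (zf_ind P) end.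

Section Ordinals.
Context {M : TFmodel} {HZ : ZF M}.
Implicit Types (x y z u v w a b c d t f : M) (P Q : M -> Prop).

Lemma zset_eq x P : small P -> (zset x P <-> x = mkc P).
Proof. intros HP. rewrite eq_mkc by auto. pose proof (zf_cl x). unfold zset; tauto. Qed.

Lemma zemp_eq x : zset x (fun _ => False) <-> x = emp M.
Proof. apply zset_eq, small_false. Qed.

Lemma zsc_eq x a : zset x (fun z => z ∊ a \/ z = a) <-> x = sc a.
Proof. apply zset_eq, small_or; [apply small_in|apply small_eq]. Qed.

Lemma zpair_eq x u v : zpair x u v <-> x = kp u v.
Proof.
  unfold kp, upr at 1. rewrite <- zset_eq by apply ws_pair. unfold zpair, zset at 1.
  assert (E : forall y, (zset y (fun z => z = u) \/ zupair y u v) <-> (y = sg u \/ y = upr u v)).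
  { intros y. unfold sg, upr. rewrite <- !zset_eq; [tauto|apply ws_pair|apply small_eq]. }
  unfold zset at 2. split; intros H y; rewrite H, E; tauto.
Qed.

Lemma zpairin_eq x y f : zpairin x y f <-> kp x y ∊ f.
Proof.
  split; [intros (p & H & K); apply zpair_eq in H as <-; auto|].
  intros H; exists (kp x y); split; auto. apply zpair_eq; auto.
Qed.

Lemma no_cycle3 x : forall y z, x ∊ y -> y ∊ z -> z ∊ x -> False.
Proof.
  revert x. zf_induction; [def|].
  intros x IH y z H1 H2 H3. apply (IH z H3 x y); auto.
Qed.

Lemma no_cycle2 x : forall y, x ∊ y -> y ∊ x -> False.
Proof.
  revert x. zf_induction; [def|].
  intros x IH y H1 H2. apply (IH y H2 x); auto.
Qed.

Lemma no_cycle1 x : ~ x ∊ x.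
Proof. intros H; apply (no_cycle2 x x); auto. Qed.

Lemma sc_inj a b : sc a = sc b -> a = b.
Proof.
  intros H. assert (Ha : a ∊ b \/ a = b) by (rewrite <- in_sc, <- H; apply in_sc; auto).
  assert (Hb : b ∊ a \/ b = a) by (rewrite <- in_sc, H; apply in_sc; auto).
  destruct Ha as [Ha|]; auto. destruct Hb as [Hb|]; auto. destruct (no_cycle2 a b); auto.
Qed.

(** * Ordinals *)

Lemma def_ord F : DefT M F -> Def M (fun s => zordinal (F s)).
Proof. apply (def_sub1 zordinal). unfold zordinal, zsubset. def. Qed.

Lemma ord_tr a b c : zordinal a -> b ∊ a -> c ∊ b -> c ∊ a.
Proof. intros [H _] Hb Hc. apply (H b); auto. Qed.

Lemma ord_in a b : zordinal a -> b ∊ a -> zordinal b.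
Proof.
  intros Ha Hb. split.
  - intros c Hc d Hd. assert (Hc' := ord_tr a b c Ha Hb Hc).
    assert (Hd' := ord_tr a c d Ha Hc' Hd).
    destruct (proj2 Ha d b) as [H|[H|H]]; auto; exfalso.
    + apply (no_cycle3 b d c); auto.
    + subst. apply (no_cycle2 b c); auto.
  - intros c d [Hc Hd]. apply (proj2 Ha); split; eapply ord_tr; eauto.
Qed.

Lemma ord_sc a : zordinal a -> zordinal (sc a).
Proof.
  intros Ha; split.
  - intros b Hb c Hc. apply in_sc. apply in_sc in Hb as [Hb| ->]; left; auto.
    eapply ord_tr; eauto.
  - intros b c [Hb Hc]. apply in_sc in Hb, Hc. destruct Hb as [Hb| ->], Hc as [Hc| ->]; auto.
    apply (proj2 Ha); auto.
Qed.

(** Double induction. If no element of either ordinal equals or contains the other ordinal,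
    comparing elements shows that both have the same elements. *)
Lemma ord_cmp a : zordinal a -> forall b, zordinal b -> a ∊ b \/ a = b \/ b ∊ a.
Proof.
  revert a. zf_induction.
  { apply def_imp; [apply def_ord; def|]. apply def_all; dn.
    apply def_imp; [apply def_ord; def|def]. }
  intros a IHa Ha. zf_induction.
  { apply def_imp; [apply def_ord; def|def]. }
  intros b IHb Hb.
  destruct (classic (exists a', a' ∊ a /\ (a' = b \/ b ∊ a'))) as [(a' & H1 & H2)|Na].
  { right; right. destruct H2 as [->|H2]; auto. eapply ord_tr; eauto. }
  destruct (classic (exists b', b' ∊ b /\ (a = b' \/ a ∊ b'))) as [(b' & H1 & H2)|Nb].
  { left. destruct H2 as [->|H2]; auto. eapply ord_tr; eauto. }
  right; left. apply zf_ext. intros z; split; intros Hz.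
  - destruct (IHa z Hz (ord_in _ _ Ha Hz) b Hb) as [H|H]; auto.
    exfalso; apply Na; eauto.
  - destruct (IHb z Hz (ord_in _ _ Hb Hz)) as [H|[H|H]]; auto; exfalso; apply Nb; eauto.
Qed.

Definition olim a : Prop := (exists b, b ∊ a) /\ forall b, b ∊ a -> sc b ∊ a.

Lemma zlim_eq a : zlimit a <-> olim a.
Proof.
  unfold zlimit, olim. split; intros [H1 H2]; split; auto; intros b Hb.
  - destruct (H2 b Hb) as (s & Hs & H). apply zsc_eq in Hs as ->; auto.
  - exists (sc b); split; auto. apply zsc_eq; auto.
Qed.

Lemma ord_cases a : zordinal a -> a = emp M \/ (exists c, a = sc c) \/ olim a.
Proof.
  intros Ha. destruct (classic (exists b, b ∊ a)) as [He|He].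
  - right. destruct (classic (exists c, a = sc c)) as [Hs|Hs]; auto.
    right; split; auto. intros b Hb.
    destruct (ord_cmp (sc b) (ord_sc _ (ord_in _ _ Ha Hb)) a Ha) as [H|[H|H]]; auto.
    + destruct Hs; eauto.
    + apply in_sc in H as [H| ->]; exfalso; [apply (no_cycle2 a b)|apply (no_cycle1 b)]; auto.
  - left. apply zf_ext. intros z; rewrite in_emp. split; [intros H; apply He; eauto|tauto].
Qed.

Lemma ord_union u : (forall a, a ∊ u -> zordinal a) ->
  zordinal (mkc (fun y => exists z, y ∊ z /\ z ∊ u)).
Proof.
  intros H. split.
  - intros b Hb c Hc. rewrite mkc_in in * by apply ws_union. destruct Hb as (z & Hb & Hz).
    exists z; split; auto. eapply ord_tr; eauto.
  - intros b c. rewrite !mkc_in by apply ws_union. intros [(z & Hb & Hz) (z' & Hc & Hz')].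
    destruct (ord_cmp b (ord_in z b (H z Hz) Hb) c (ord_in z' c (H z' Hz') Hc)) as [|[|]]; auto.
Qed.
End Ordinals.
#[export] Hint Extern 1 (Def _ (fun s => zordinal _)) => simple apply def_ord : defs.
#[export] Hint Extern 1 (Def _ (fun s => olim _)) => unfold olim; dn : defs.

(** * Cumulative hierarchies *)

(* The classes W and HCL are instances of this: [S] is the successor
   operation, [x] enters at the first stage whose predecessor contains all
   its children [Ch _ x]; [pi] is the pairing that codes the recursion. *)
Section Hierarchy.
Context {M : TFmodel} {HZ : ZF M}.
Implicit Types (x y z u v w a b c d t f : M) (P Q : M -> Prop).
Variable pi : M -> M -> M.
Hypothesis pi_inj : forall a b c d, pi a b = pi c d -> a = c /\ b = d.
Hypothesis pi_def : DefT M (fun s => pi (s 0) (s 1)).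
Variable S : M -> M.
Hypothesis S_def : DefT M (fun s => S (s 0)).
Variable good : M -> Prop.
Variable Ch : M -> M -> Prop.
Hypothesis S_in : forall x w, x ∊ S w <-> good x /\ forall y, Ch y x -> y ∊ w.
Hypothesis Ch_def : Def M (fun s => Ch (s 0) (s 1)).
Hypothesis good_def : Def M (fun s => good (s 0)).
Hypothesis Ch_small : forall x, small (fun y => Ch y x).

Definition hfun f d : Prop :=
  (forall p, p ∊ f -> exists x y, p = pi x y /\ x ∊ d) /\
  (forall x, x ∊ d -> exists y, pi x y ∊ f) /\
  (forall x y z, pi x y ∊ f -> pi x z ∊ f -> y = z).
Definition hrec f : Prop := forall b v, pi b v ∊ f ->
  (b = emp M /\ v = emp M) \/
  (exists c w, b = sc c /\ pi c w ∊ f /\ v = S w) \/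
  (olim b /\ forall z, z ∊ v <-> exists c w, c ∊ b /\ pi c w ∊ f /\ z ∊ w).
Definition hat a v : Prop := zordinal a /\ exists f, hfun f (sc a) /\ hrec f /\ pi a v ∊ f.

Local Lemma defT_pi F G : DefT M F -> DefT M G -> DefT M (fun s => pi (F s) (G s)).
Proof. apply (defT_sub2 pi), pi_def. Qed.
Local Lemma defT_S F : DefT M F -> DefT M (fun s => S (F s)).
Proof. apply (defT_sub1 S), S_def. Qed.
Hint Extern 1 (DefT _ (fun s => pi _ _)) => simple apply defT_pi : defs.
Hint Extern 1 (DefT _ (fun s => S _)) => simple apply defT_S : defs.

Local Lemma def_hat F G : DefT M F -> DefT M G -> Def M (fun s => hat (F s) (G s)).
Proof. apply (def_sub2 hat). unfold hat, hfun, hrec. def. Qed.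
Hint Extern 1 (Def _ (fun s => hat _ _)) => simple apply def_hat : defs.

Ltac zf_induction_def := zf_induction; [try def|]; cbn beta.

(** Induction on the argument. The zero, successor and limit clauses exclude each other, and in each
    of them the value is fixed by the values below. *)
Lemma hrec_coherent d d' f f' : zordinal d -> zordinal d' -> hfun f d -> hfun f' d' ->
  hrec f -> hrec f' -> forall b v v', pi b v ∊ f -> pi b v' ∊ f' -> v = v'.
Proof.
  intros Hd Hd' Hf Hf' Hr Hr'. zf_induction_def. intros b IH v v' H H'.
  assert (Hb : b ∊ d).
  { destruct (proj1 Hf _ H) as (x & y & E & Hx). apply pi_inj in E as [-> ->]; auto. }
  assert (Hb' : b ∊ d').
  { destruct (proj1 Hf' _ H') as (x & y & E & Hx). apply pi_inj in E as [-> ->]; auto. }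
  destruct (Hr b v H) as [[E ->]|[(c & w & E & K & ->)|[K E]]];
  destruct (Hr' b v' H') as [[E' ->]|[(c' & w' & E' & K' & ->)|[K' E']]]; auto; subst.
  - destruct (sc_emp c'); auto.
  - destruct (proj1 K') as [z Hz]. destruct (proj1 (in_emp z) Hz).
  - destruct (sc_emp c); auto.
  - apply sc_inj in E' as <-. f_equal. apply (IH c); auto. apply in_sc; auto.
  - exfalso. apply (no_cycle1 (sc c)). apply (proj2 K'), in_sc; auto.
  - destruct (proj1 K) as [z Hz]. destruct (proj1 (in_emp z) Hz).
  - exfalso. apply (no_cycle1 (sc c')). apply (proj2 K), in_sc; auto.
  - apply zf_ext. intros z. rewrite E, E'. split; intros (c & w & Hc & Hw & Hz).
    + destruct (proj1 (proj2 Hf') c (ord_tr _ _ _ Hd' Hb' Hc)) as [w' Hw'].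
      assert (w = w') by eauto; subst w'. eauto.
    + destruct (proj1 (proj2 Hf) c (ord_tr _ _ _ Hd Hb Hc)) as [w' Hw'].
      assert (w' = w) by eauto; subst w'. eauto.
Qed.

Lemma hat_fun a v v' : hat a v -> hat a v' -> v = v'.
Proof.
  intros (Ha & f & H1 & H2 & H3) (_ & f' & H4 & H5 & H6).
  eapply (hrec_coherent (sc a) (sc a) f f'); eauto; apply ord_sc; auto.
Qed.

(** The restriction of [f] to the ordinals up to [c] still satisfies the recursion, since its
    clauses only look downwards. *)
Lemma hat_restrict d f c w : zordinal d -> hfun f d -> hrec f -> pi c w ∊ f -> hat c w.
Proof.
  intros Hd (H1 & H2 & H3) Hr H.
  assert (Hdom : forall x y, pi x y ∊ f -> x ∊ d).
  { intros x y Hxy. destruct (H1 _ Hxy) as (x' & y' & E & Hx). apply pi_inj in E as [-> ->]; auto. }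
  assert (Hc := Hdom _ _ H). split; [eapply ord_in; eauto|].
  assert (K : small (fun p => p ∊ f /\ exists x y, p = pi x y /\ x ∊ sc c)).
  { apply small_sub with (fun p => p ∊ f); [apply small_in|def|tauto]. }
  assert (E : forall x y, pi x y ∊ mkc (fun p => p ∊ f /\ exists x y, p = pi x y /\ x ∊ sc c) <->
    pi x y ∊ f /\ x ∊ sc c).
  { intros x y. rewrite mkc_in by auto. split; intros [K1 K2]; split; eauto.
    destruct K2 as (x' & y' & E & K2). apply pi_inj in E as [-> ->]; auto. }
  assert (Hlow : forall b x, b ∊ sc c -> x ∊ b -> x ∊ sc c).
  { intros b x Hb Hx. eapply ord_tr; eauto. apply ord_sc. eapply ord_in; eauto. }
  eexists; split; [|split; [|apply E; split; [exact H|apply in_sc; auto]]].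
  - split; [|split].
    + intros p Hp. rewrite mkc_in in Hp by auto. apply Hp.
    + intros x Hx. destruct (H2 x) as [y Hy].
      * apply in_sc in Hx as [Hx| ->]; auto. eapply ord_tr; eauto.
      * exists y. apply E; auto.
    + intros x y z Hy Hz. apply E in Hy, Hz. apply (H3 x); tauto.
  - intros b v Hb. apply E in Hb as [Hb Hbc].
    destruct (Hr b v Hb) as [K0|[(e & w' & -> & K1 & ->)|[K1 K2]]]; auto.
    + right; left. exists e, w'. rewrite E. repeat split; auto.
      apply (Hlow (sc e)); auto. apply in_sc; auto.
    + right; right. split; auto. intros z. rewrite K2.
      split; intros (e & w' & He & Hw & Hz); exists e, w'; rewrite E in *; intuition eauto.
Qed.

(** Frees the recursion equations from the approximating function: the earlier values are again
    given by [hat]. *)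
Lemma hat_step a v : hat a v ->
  (a = emp M /\ v = emp M) \/ (exists c w, a = sc c /\ hat c w /\ v = S w) \/
  (olim a /\ forall z, z ∊ v <-> exists c w, c ∊ a /\ hat c w /\ z ∊ w).
Proof.
  intros (Ha & f & Hf & Hr & H).
  assert (R : forall c w, pi c w ∊ f -> hat c w).
  { intros c w Hw; apply (hat_restrict (sc a) f); auto using ord_sc. }
  destruct (Hr a v H) as [|[(c & w & -> & Hc & ->)|[H1 H2]]]; auto.
  - right; left. exists c, w; auto.
  - right; right; split; auto. intros z. rewrite H2.
    split; intros (c & w & Hc & Hw & Hz); exists c, w; split; auto; split; auto.
    destruct (proj1 (proj2 Hf) c) as [w' Hw']; [apply in_sc; auto|].
    rewrite (hat_fun c w w'); auto.
Qed.

Lemma hat_ex a : zordinal a -> exists v, hat a v.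
Proof.
  revert a. zf_induction_def. intros a IH Ha.
  assert (E : forall b, b ∊ a -> exists v, hat b v) by (intros; apply IH; auto; eapply ord_in; eauto).
  assert (Hv : exists v, (a = emp M /\ v = emp M) \/ (exists c w, a = sc c /\ hat c w /\ v = S w) \/
    (olim a /\ forall z, z ∊ v <-> exists c w, c ∊ a /\ hat c w /\ z ∊ w)).
  { destruct (ord_cases a Ha) as [->|[[c ->]|H]]; [eauto| |].
    - destruct (E c) as [w Hw]; [apply in_sc; auto|]. eauto 8.
    - assert (K : small (fun z => exists w, z ∊ w /\ exists c, c ∊ a /\ hat c w)).
      { apply small_union. apply (small_repl (fun c => c ∊ a) hat).
        - apply small_in.
        - def.
        - intros; eapply hat_fun; eauto. }
      exists (mkc (fun z => exists w, z ∊ w /\ exists c, c ∊ a /\ hat c w)).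
      right; right; split; auto. intros z; rewrite mkc_in by auto.
      split; [intros (w & Hz & c & Hc & Hw); exists c, w; auto
             | intros (c & w & Hc & Hw & Hz); exists w; eauto]. }
  destruct Hv as [v Hv].
  (* The approximation for [a] collects the values at all smaller ordinals by Replacement and adds
     the new value at [a]. *)
  pose (Q := fun p => (exists b, b ∊ a /\ exists w, hat b w /\ p = pi b w) \/ p = pi a v).
  assert (K : small Q).
  { apply small_or; [|apply small_eq].
    apply (small_repl (fun b => b ∊ a) (fun b p => exists w, hat b w /\ p = pi b w)).
    - apply small_in.
    - def.
    - intros b p p' _ (w & Hw & ->) (w' & Hw' & ->). f_equal. eapply hat_fun; eauto. }
  assert (EQ : forall x y, pi x y ∊ mkc Q <-> (x ∊ a /\ hat x y) \/ (x = a /\ y = v)).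
  { intros x y. rewrite mkc_in by auto. unfold Q. split.
    - intros [(b & Hb & w & Hw & H)|H]; apply pi_inj in H as [-> ->]; auto.
    - intros [[H1 H2]|[-> ->]]; eauto 6. }
  exists v; split; auto. exists (mkc Q). split; [|split; [|apply EQ; auto]].
  - split; [|split].
    + intros p Hp. rewrite mkc_in in Hp by auto. destruct Hp as [(b & Hb & w & Hw & ->)| ->].
      * exists b, w; rewrite in_sc; auto.
      * exists a, v; rewrite in_sc; auto.
    + intros x Hx. apply in_sc in Hx as [Hx| ->].
      * destruct (E x Hx) as [w Hw]. exists w; apply EQ; auto.
      * exists v; apply EQ; auto.
    + intros x y z Hy Hz. apply EQ in Hy, Hz.
      destruct Hy as [[Hy Hy']|[-> ->]], Hz as [[Hz Hz']|[Hz ->]]; auto.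
      * eapply hat_fun; eauto.
      * subst. destruct (no_cycle1 a); auto.
      * destruct (no_cycle1 a); auto.
  - assert (L : forall b w, b ∊ a \/ b = a -> (b = emp M /\ w = emp M) \/
      (exists c w', b = sc c /\ hat c w' /\ w = S w') \/
      (olim b /\ forall z, z ∊ w <-> exists c w', c ∊ b /\ hat c w' /\ z ∊ w') ->
      (b = emp M /\ w = emp M) \/ (exists c w', b = sc c /\ pi c w' ∊ mkc Q /\ w = S w') \/
      (olim b /\ forall z, z ∊ w <-> exists c w', c ∊ b /\ pi c w' ∊ mkc Q /\ z ∊ w')).
    { intros b w Hb. assert (Lo : forall c, c ∊ b -> c ∊ a).
      { destruct Hb as [Hb| ->]; auto. intros; eapply ord_tr; eauto. }
      intros [H|[(c & w' & -> & H & ->)|[H1 H2]]]; auto.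
      - right; left. exists c, w'. rewrite EQ. repeat split; auto. left; split; auto.
        apply Lo, in_sc; auto.
      - right; right; split; auto. intros z; rewrite H2.
        split; intros (c & w' & Hc & Hw & Hz); exists c, w'; split; auto; split; auto.
        + apply EQ; auto.
        + apply EQ in Hw as [[]|[-> ->]]; auto. exfalso. apply (no_cycle1 a). auto. }
    intros b w Hbw. apply EQ in Hbw as [[Hb Hw]|[-> ->]]; apply L; auto.
    apply hat_step; auto.
Qed.

Lemma hat_ord a v : hat a v -> zordinal a.
Proof. intros [H _]; auto. Qed.

Lemma hat_sc a v : hat a v -> hat (sc a) (S v).
Proof.
  intros H. destruct (hat_ex (sc a)) as [w Hw]; [apply ord_sc; eapply hat_ord; eauto|].
  destruct (hat_step _ _ Hw) as [[E _]|[(c & u & E & K & ->)|[K _]]].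
  - destruct (sc_emp a); auto.
  - apply sc_inj in E as <-. rewrite (hat_fun a v u); auto.
  - exfalso. apply (no_cycle1 (sc a)). apply (proj2 K), in_sc; auto.
Qed.

Lemma S_mono u v : zsubset u v -> zsubset (S u) (S v).
Proof. intros H x Hx. apply S_in. apply S_in in Hx as [H1 H2]; split; auto. Qed.

Lemma hat_mono b : forall v, hat b v -> forall a u, a ∊ b -> hat a u -> zsubset u v.
Proof.
  revert b. zf_induction_def; [unfold zsubset; def|]. intros b IH v Hv a u Ha Hu.
  destruct (hat_step _ _ Hv) as [[-> _]|[(c & w & -> & Hw & ->)|[K E]]].
  - destruct (proj1 (in_emp _) Ha).
  - assert (Hc : c ∊ sc c) by (apply in_sc; auto).
    assert (HS : zsubset w (S w)).
    { destruct (hat_step _ _ Hw) as [[_ ->]|[(e & w' & -> & He & ->)|[K E]]].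
      - intros z Hz. destruct (proj1 (in_emp _) Hz).
      - apply S_mono. apply (IH (sc e)) with (a := e); auto.
        apply in_sc; auto.
      (* A limit stage is included in its successor: an element already appears in some w' below,
         hence in S w' by the induction hypothesis, and [S] is monotone. *)
      - intros z Hz. pose proof Hz as Hz'. rewrite E in Hz.
        destruct Hz as (e & w' & He & Hw' & Hz).
        assert (Hs : z ∊ S w').
        { apply (IH (sc e)) with (a := e) (u := w'); auto.
          - apply in_sc; left. apply K; auto.
          - apply hat_sc; auto.
          - apply in_sc; auto. }
        revert Hs. apply S_mono. intros y Hy. apply E; eauto. }
    apply in_sc in Ha as [Ha| ->].
    + intros z Hz. apply HS. apply (IH c Hc w Hw a u); auto.
    + rewrite (hat_fun c u w); auto.
  - intros z Hz. apply E; eauto.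
Qed.

Definition hcl x : Prop := exists a v, hat a v /\ x ∊ v.

Lemma def_hcl F : DefT M F -> Def M (fun s => hcl (F s)).
Proof. apply (def_sub1 hcl). unfold hcl. def. Qed.

Lemma hcl_ind P : Def M (fun s => P (s 0)) ->
  (forall x, good x -> (forall y, Ch y x -> hcl y /\ P y) -> P x) -> forall x, hcl x -> P x.
Proof.
  intros HP HI x (a & v & Ha & Hx). revert a v Ha x Hx. zf_induction_def.
  intros a IH v Hv x Hx.
  destruct (hat_step _ _ Hv) as [[_ ->]|[(c & w & -> & Hw & ->)|[K E]]].
  - destruct (proj1 (in_emp _) Hx).
  - apply S_in in Hx as [H1 H2]. apply HI; auto. intros y Hy; split.
    + exists c, w; auto.
    + apply (IH c) with (v := w); auto. apply in_sc; auto.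
  - apply E in Hx as (c & w & Hc & Hw & Hx). apply (IH c Hc w); auto.
Qed.

(** From right to left, Replacement bounds the ranks of the children, so all children occur together
    in one stage and [x] enters at the next. *)
Lemma hcl_iff x : hcl x <-> good x /\ forall y, Ch y x -> hcl y.
Proof.
  split.
  - revert x. apply hcl_ind.
    + apply def_and; auto. apply def_all; dn. apply def_imp.
      * apply (def_map _ (fun i => i) Ch_def).
      * apply def_hcl; def.
    + intros x Hx H; split; auto. intros y Hy. apply H; auto.
  - intros [Hx H].
    (* The rank of [y]: the least index of a stage containing it. Taking the least makes the
       relation functional. *)
    pose (R := fun y a => (exists v, hat a v /\ y ∊ v) /\
      forall b, b ∊ a -> ~ exists v, hat b v /\ y ∊ v).
    assert (U : forall y a a', R y a -> R y a' -> a = a').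
    { intros y a a' [(v & Hv & Hy) H2] [(v' & Hv' & Hy') H2'].
      destruct (ord_cmp a (hat_ord _ _ Hv) a' (hat_ord _ _ Hv')) as [K|[K|K]]; auto;
        exfalso; [apply (H2' a)|apply (H2 a')]; eauto. }
    assert (E : forall y, hcl y -> exists a, R y a).
    { intros y (a & v & Hv & Hy). revert a v Hv Hy.
      zf_induction_def. intros a IH v Hv Hy.
      destruct (classic (exists b, b ∊ a /\ exists v, hat b v /\ y ∊ v)) as [(b & Hb & w & K1 & K2)|K].
      - apply (IH b Hb w); auto.
      - exists a; split; eauto. }
    assert (K : small (fun a => exists y, Ch y x /\ R y a)).
    { apply small_repl.
      - apply Ch_small.
      - unfold R; def.
      - intros; eapply U; eauto. }
    set (A := mkc (fun a => exists y, Ch y x /\ R y a)).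
    assert (HA : forall a, a ∊ A -> zordinal a).
    { intros a Ha. apply (mkc_in (fun a => exists y, Ch y x /\ R y a)) in Ha; auto. destruct Ha as (y & _ & (v & Hv & _) & _).
      eapply hat_ord; eauto. }
    assert (HU := ord_union A HA).
    set (s := mkc (fun y => exists z, y ∊ z /\ z ∊ A)) in *.
    destruct (hat_ex (sc s)) as [v Hv]; [apply ord_sc; auto|].
    (* The supremum [s] may itself be a rank, while [hat_mono] compares strictly increasing indices;
       [sc s] exceeds all ranks, and one more successor makes room for [x]. *)
    exists (sc (sc s)), (S v). split; [apply hat_sc; auto|]. apply S_in; split; auto.
    intros y Hy. destruct (E y (H y Hy)) as [a Ha].
    assert (HaA : a ∊ A) by (apply (mkc_in (fun a => exists y, Ch y x /\ R y a)); eauto).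
    destruct Ha as [(w & Hw & Hyw) _].
    assert (Has : a ∊ sc s).
    { destruct (ord_cmp a (HA a HaA) (sc s) (ord_sc _ HU)) as [|[L|L]]; auto; exfalso.
      - apply (no_cycle1 s). apply (mkc_in (fun y => exists z, y ∊ z /\ z ∊ A)); [apply ws_union|].
        exists a; split; auto. rewrite L. apply in_sc; auto.
      - apply (no_cycle2 s (sc s)); [apply in_sc; auto|].
        apply (mkc_in (fun y => exists z, y ∊ z /\ z ∊ A)); [apply ws_union|]. eauto. }
    apply (hat_mono (sc s) v Hv a w); auto.
Qed.
End Hierarchy.

(** * Models of BZFC *)

(* Choice is kept apart: verifying it in W uses the BS4 pairs of W, whose theory
   rests on the other axioms. *)
Class BZ (M : TFmodel) : Prop := {
  bz_ext : modelsT M ax_ext;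
  bz_compr : forall p, modelsT M (ax_compr p);
  bz_superset : modelsT M ax_superset;
  bz_repl : forall p, modelsT M (ax_repl p);
  bz_pairing : modelsT M ax_pairing;
  bz_power : modelsT M ax_power;
  bz_union : modelsT M ax_union;
  bz_infinity : modelsT M ax_infinity;
  bz_foundation : forall p, modelsT M (ax_foundation p);
  bz_acla : modelsT M ax_acla
}.

Section BZ.
Context {M : TFmodel} {HB : BZ M}.
Implicit Types (x y z u v w a b c d t f : M) (P Q : M -> Prop).

Lemma bz_sep P u : Def M (fun s => P (s 0)) -> small (fun y => y ∊ u /\ P y).
Proof.
  intros HP.
  assert (HD : Def M (fun s => s 0 ∊ u /\ P (s 0))) by (apply def_and; [def|exact HP]).
  apply (def_formula1 (fun y => y ∊ u /\ P y)) in HD as (p & t & H).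
  destruct (proj1 (models_superset M) bz_superset u) as (c & Hc & Hcl).
  (* [fNeg (fImp p fBot)] is !p, false exactly when p is not true. Comprehension with it inside a
     classical superset of [u] gives a classical set. *)
  destruct (proj1 (models_compr M (fNeg (fImp p fBot))) (bz_compr _) t c) as [x Hx].
  cbn [satT satF] in Hx.
  assert (E : forall y, (y ∊ x <-> y ∊ u /\ P y) /\ (y ∊? x <-> y ∊ u /\ P y)).
  { intros y. destruct (Hx y) as [H1 H2]. destruct (Hcl y) as [H3 H4].
    destruct (Hc y) as [H5 _]. rewrite <- H in H1, H2. rewrite H1, H2.
    destruct (classic (P y)), (classic (y ∊ u)); tauto. }
  exists x; split.
  - intros y. destruct (E y); tauto.
  - intros y. destruct (E y); tauto.
Qed.

Lemma small_iset x P : iset x P P -> small P.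
Proof. intros H. exists x; split; intros y; destruct (H y); tauto. Qed.

Lemma bz_small_false : small (fun _ : M => False).
Proof.
  destruct (bz_sep (fun _ => False) (point M)) as (x & H1 & H2); [def|].
  exists x; split; auto. intros y; rewrite H2; tauto.
Qed.

(** The Replacement axiom asks for a total, classical operation. So [R] is given a default value
    [y0] outside its domain and made classical by !, while [u] is cut down to the domain, which
    keeps unwanted default values out of the image. *)
Lemma bz_sm_repl (R : M -> M -> Prop) u : Def M (fun s => R (s 0) (s 1)) ->
  (forall x y z, R x y -> R x z -> y = z) -> small (fun y => exists x, x ∊ u /\ R x y).
Proof.
  intros HR Hf.
  destruct (classic (exists x y, x ∊ u /\ R x y)) as [(x0 & y0 & H0)|N].
  2: { destruct bz_small_false as (e & He & H). exists e; split; auto.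
       intros y; rewrite H; firstorder. }
  destruct (bz_sep (fun x => exists y, R x y) u) as (u' & Hu & Hu').
  { apply def_ex. apply (def_map _ (fun i => match i with 0 => 1 | _ => 0 end) HR). }
  assert (HD : Def M (fun s => R (s 0) (s 1) \/ (~ (exists y, R (s 0) y) /\ s 1 = y0))).
  { apply def_or; auto. apply def_and; [|def]. apply def_not, def_ex.
    apply (def_map _ (fun i => match i with 0 => 1 | _ => 0 end) HR). }
  apply (def_formula2 (fun x y => R x y \/ (~ (exists y, R x y) /\ y = y0))) in HD as (p & t & H).
  destruct (proj1 (models_repl M (fNeg (fImp p fBot))) (bz_repl _) t) with (x := u') as [v Hv].
  - cbn [satT satF]. split; [intros; destruct (classic (satT M (scons x (scons y t)) p)); tauto|].
    intros x. destruct (classic (exists y, R x y)) as [[y Hy]|K].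
    + exists y. rewrite <- H. split; [split; auto; tauto|].
      intros z [Hz _]. apply H in Hz as [Hz|[Hz _]]; eauto. exfalso; apply Hz; eauto.
    + exists y0. rewrite <- H. split; [split; auto; tauto|].
      intros z [Hz _]. apply H in Hz as [Hz|[_ ->]]; auto. exfalso; eauto.
  - cbn [satT satF] in Hv.
    assert (E : forall z, (exists w, w ∊ u' /\ satT M (scons w (scons z t)) p) <->
      exists x, x ∊ u /\ R x z).
    { intros z; split.
      - intros (w & Hw & K). apply H in K. apply Hu' in Hw as [Hw Hw'].
        exists w; split; auto. tauto.
      - intros (w & Hw & K). exists w. rewrite <- H, Hu'. eauto. }
    exists v. split; intros z; destruct (Hv z) as [H1 H2].
    + rewrite H1, H2. split; intros (w & Hw & K); exists w; specialize (Hu w); tauto.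
    + rewrite <- E, H1. split; intros (w & Hw & K); exists w; tauto.
Qed.

#[export] Instance BZ_WS0 : WS0 M.
Proof.
  split.
  - intros x y H1 H2. apply (proj1 (models_ext M) bz_ext). intros z; split; auto.
  - intros; apply bz_sep; auto.
  - intros; apply bz_sm_repl; auto.
  - intros u. destruct (proj1 (models_superset M) bz_superset u) as (c & Hc & Hcl).
    exists c; split; auto. intros z. destruct (Hc z). specialize (Hcl z). unfold both; tauto.
  - intros a b. destruct (proj1 (models_pairing M) bz_pairing a b) as [x Hx].
    eapply small_iset; exact Hx.
  - intros u. destruct (proj1 (models_union M) bz_union u) as [x Hx].
    destruct (bz_sep (fun _ => True) x) as (v & H1 & H2); [def|].
    exists v; split; auto. intros y. rewrite H2, (proj1 (Hx y)). tauto.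
  - intros u. destruct (proj1 (models_power M) bz_power u) as [v Hv].
    eapply small_iset; exact Hv.
Qed.

#[export] Instance BZ_WS : WS M.
Proof.
  split; [exact _|]. intros P HP IH. apply def_formula1 in HP as (p & t & H).
  intros x. apply H. apply (proj1 (models_foundation M p) (bz_foundation p) t).
  intros y Hy. apply H, IH. intros z Hz. apply H, Hy, Hz.
Qed.

(* A glut g and a gap h, provided by ACLA, make the formula (P ∧ Q) ∨ (P ∧ g) ∨ (Q ∧ h)
   true exactly on P and not false exactly on Q. *)
Lemma bz_full P Q : small P -> small Q ->
  exists x, forall y, (y ∊ x <-> P y) /\ (y ∊? x <-> Q y).
Proof.
  intros HP HQ.
  destruct (proj1 (models_acla M) bz_acla) as [[x0 H0] [x1 H1]].
  apply not_all_ex_not in H0 as [z0 H0]. apply not_all_ex_not in H1 as [z1 H1].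
  set (t := scons (mkc P) (scons (mkc Q) (scons z0 (scons x0 (scons z1 (scons x1 (fun _ => x0))))))).
  destruct (proj1 (models_compr M (fOr (fAnd (fIn 0 1) (fIn 0 2))
    (fOr (fAnd (fIn 0 1) (fIn 3 4)) (fAnd (fIn 0 2) (fIn 5 6))))) (bz_compr _) t
    (mkc (fun y => P y \/ Q y))) as [x Hx].
  exists x. intros y. destruct (Hx y) as [K1 K2]. cbn in K1, K2.
  destruct (mkc_spec P HP) as [P1 P2]. destruct (mkc_spec Q HQ) as [Q1 Q2].
  destruct (mkc_spec _ (small_or P Q HP HQ)) as [R1 R2].
  specialize (P1 y). specialize (P2 y). specialize (Q1 y). specialize (Q2 y).
  specialize (R1 y). specialize (R2 y).
  rewrite K1, K2. clear K1 K2 Hx. cbn beta in *.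
  rewrite <- R1, R2. rewrite P2 in *. rewrite Q2 in *. clear - P1 Q1 H0 H1.
  split; [split; [tauto|]|split; [|tauto]].
  - intros HPy; tauto.
  - intros [HPQ K]. apply NNPP; intros N.
    assert (inF M y (mkc Q)) by (apply NNPP; tauto). tauto.
Qed.

Lemma bz_neq x y : neq M x y <-> exists z, (z ∊ x /\ inF M z y) \/ (z ∊ y /\ inF M z x).
Proof.
  destruct (proj1 (models_ext M) bz_ext x y) as [_ H].
  destruct (classic (neq M x y)) as [K|K].
  - split; auto. intros _. apply NNPP; intros N. apply (proj2 H); auto. intros z.
    split; intros Hz Hz'; apply N; exists z; auto.
  - split; [tauto|]. intros [z Hz] . exfalso. destruct (proj1 H K z). tauto.
Qed.

Lemma ipair_iff p a b : ipair p a b <-> forall z,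
  (z ∊ p <-> tagc (fun x => x ∊ a) (fun x => x ∊ b) z) /\
  (z ∊? p <-> tagc (fun x => x ∊? a) (fun x => x ∊? b) z).
Proof.
  assert (E : forall A B z, ((exists x, itag0 z x /\ A x) \/ (exists y, itag1 z y /\ B y)) <-> tagc A B z).
  { intros A B z. unfold tagc. split; (intros [(x & H1 & H2)|(x & H1 & H2)]; [left|right]; exists x);
      rewrite ?itag0_eq, ?itag1_eq in *; auto. }
  unfold ipair, iset. split; intros H z; destruct (H z) as [H1 H2]; rewrite ?H1, ?H2, ?E; split; tauto.
Qed.

(** (a,b)^! and (a,b)^? are prescribed independently, which is what [bz_full] permits; ACLA enters
    through it. *)
Lemma ipair_ex a b : exists p, ipair p a b.
Proof.
  destruct (bz_full (tagc (fun x => x ∊ a) (fun x => x ∊ b)) (tagc (fun x => x ∊? a) (fun x => x ∊? b)))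
    as [p Hp]; [apply small_tagc; apply small_in|apply small_tagc; apply small_inQ|].
  exists p. apply ipair_iff; auto.
Qed.

Lemma ipair_fun p p' a b : ipair p a b -> ipair p' a b -> p = p'.
Proof.
  rewrite !ipair_iff. intros H H'. apply ws_ext; intros z; destruct (H z), (H' z); intuition.
Qed.

(** The tags let all four extensions a^!, a^?, b^! and b^? be read off from the pair. *)
Lemma ipair_inj p a b a' b' : ipair p a b -> ipair p a' b' -> a = a' /\ b = b'.
Proof.
  rewrite !ipair_iff. intros H H'. split; apply ws_ext; intros z.
  - rewrite <- (tagc0 (fun x => x ∊ a) (fun x => x ∊ b)), <- (tagc0 (fun x => x ∊ a') (fun x => x ∊ b')).
    rewrite <- (proj1 (H _)), <- (proj1 (H' _)). tauto.
  - rewrite <- (tagc0 (fun x => x ∊? a) (fun x => x ∊? b)), <- (tagc0 (fun x => x ∊? a') (fun x => x ∊? b')).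
    rewrite <- (proj2 (H _)), <- (proj2 (H' _)). tauto.
  - rewrite <- (tagc1 (fun x => x ∊ a) (fun x => x ∊ b)), <- (tagc1 (fun x => x ∊ a') (fun x => x ∊ b')).
    rewrite <- (proj1 (H _)), <- (proj1 (H' _)). tauto.
  - rewrite <- (tagc1 (fun x => x ∊? a) (fun x => x ∊? b)), <- (tagc1 (fun x => x ∊? a') (fun x => x ∊? b')).
    rewrite <- (proj2 (H _)), <- (proj2 (H' _)). tauto.
Qed.

Lemma def_ipair F G H : DefT M F -> DefT M G -> DefT M H ->
  Def M (fun s => ipair (F s) (G s) (H s)).
Proof.
  apply (def_sub3 ipair). unfold ipair, itag0, itag1, ikpair, iset, ising, iupair, iempty, iset. def.
Qed.

Lemma HC_ipair p a b : ipair p a b -> HC a -> HC b -> HC p.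
Proof.
  intros Hp Ha Hb. rewrite ipair_iff in Hp. apply HC_iff in Ha as [Ca Ha], Hb as [Cb Hb].
  apply HC_iff. split.
  - intros z. destruct (Hp z) as [-> ->]. unfold tagc.
    split; (intros [(x & H1 & H2)|(x & H1 & H2)]; [left|right]; exists x; split; auto);
      specialize (Ca x); specialize (Cb x); tauto.
  - intros z Hz. apply Hp in Hz as [(x & -> & H)|(x & -> & H)]; apply HC_kp; auto; try apply HC_sg; apply HC_emp.
Qed.

Lemma HC_ipair_inv p a b : ipair p a b -> HC p -> HC a /\ HC b.
Proof.
  intros Hp H. rewrite ipair_iff in Hp. apply HC_iff in H as [C H].
  assert (Ha : forall x, (x ∊ a <-> x ∊? a) /\ (x ∊ a -> HC x)).
  { intros x. destruct (Hp (kp x (emp M))) as [H1 H2]. rewrite !tagc0 in *. split.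
    - rewrite <- H1, <- H2; auto.
    - rewrite <- H1. intros K; apply H, HC_kp_inv in K; tauto. }
  assert (Hb : forall x, (x ∊ b <-> x ∊? b) /\ (x ∊ b -> HC x)).
  { intros x. destruct (Hp (kp x (sg (emp M)))) as [H1 H2]. rewrite !tagc1 in *. split.
    - rewrite <- H1, <- H2; auto.
    - rewrite <- H1. intros K; apply H, HC_kp_inv in K; tauto. }
  split; apply HC_iff; split; intros x; apply Ha || apply Hb.
Qed.

Lemma HC_isub x : HC x -> forall y, isub y x /\ cl y -> HC y.
Proof.
  intros Hx y [H Hy]. apply HC_iff; split; auto. intros z Hz.
  apply HC_iff in Hx as [_ Hx]. apply Hx, H; auto.
Qed.

End BZ.
#[export] Hint Extern 1 (Def _ (fun s => ipair _ _ _)) => simple apply def_ipair : defs.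

(** * Relativized satisfaction *)

(** A two-valued satisfaction inside a T/F-model. It is meant for [C] consisting of hereditarily
    classical sets, where truth and non-falsity coincide. *)
Fixpoint rsat {M : TFmodel} (C : M -> Prop) (s : nat -> M) (p : form) : Prop :=
  match p with
  | fIn i j => s i ∊ s j
  | fEq i j => s i = s j
  | fBot => False
  | fNeg p => ~ rsat C s p
  | fAnd p q => rsat C s p /\ rsat C s q
  | fOr p q => rsat C s p \/ rsat C s q
  | fImp p q => rsat C s p -> rsat C s q
  | fAll p => forall d, C d -> rsat C (scons d s) p
  | fEx p => exists d, C d /\ rsat C (scons d s) p
  end.

(** Reduces the schemas of ZFC in the inner model to Separation and Replacement in [M]. *)
Lemma def_rsat {M : TFmodel} (C : M -> Prop) p : Def M (fun s => C (s 0)) ->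
  forall r : nat -> nat + M, Def M (fun s => rsat C (fun i => look s (r i)) p).
Proof.
  intros HC. assert (L : forall v : nat + M, DefT M (fun s => look s v))
    by (intros [i|c]; cbn; def).
  pose (r' := fun (r : nat -> nat + M) i => match i with 0 => inl 0
    | S j => match r j with inl k => inl (S k) | inr c => inr c end end).
  assert (K : forall (r : nat -> nat + M) s,
    (fun i => look s (r' r i)) = scons (s 0) (fun i => look (tail s) (r i))).
  { intros; apply functional_extensionality; intros [|i]; cbn; auto. destruct (r i); reflexivity. }
  induction p; intros r; cbn [rsat].
  - apply def_inT; auto.
  - apply def_eq; auto.
  - def.
  - apply def_not; auto.
  - apply def_and; auto.
  - apply def_or; auto.
  - apply def_imp; auto.
  - apply (def_all (fun d s => C d -> rsat C (scons d (fun i => look s (r i))) p)).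
    apply def_imp; [exact HC|].
    eapply def_iff; [apply (IHp (r' r))|]. intros s. cbv beta. rewrite K. reflexivity.
  - apply (def_ex (fun d s => C d /\ rsat C (scons d (fun i => look s (r i))) p)).
    apply def_and; [exact HC|].
    eapply def_iff; [apply (IHp (r' r))|]. intros s. cbv beta. rewrite K. reflexivity.
Qed.

(** * The hereditarily classical sets *)

Definition HCm (M : TFmodel) {HW : WS M} : TFmodel :=
  cmodel {x : M | HC x} (exist _ (emp M) HC_emp) (fun a b => proj1_sig a ∊ proj1_sig b).

Section HCm.
Context {M : TFmodel} {HB : BZ M}.
Implicit Types (x y z u v w a b c d t f : M) (P Q : M -> Prop).
Local Notation N := (HCm M).

Definition val (x : N) : M := proj1_sig x.
Lemma val_HC (x : N) : HC (val x). Proof. exact (proj2_sig x). Qed.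
Lemma val_inj (x y : N) : val x = val y -> x = y.
Proof. intros H. apply eq_sig_hprop; [intros; apply proof_irrelevance|auto]. Qed.
Lemma val_ex x : HC x -> exists x' : N, val x' = x.
Proof. intros H; exists (exist _ x H); auto. Qed.

Lemma N_classical : classicalM N.
Proof. apply cmodel_classical. Qed.

Lemma val_in (x y : N) : x ∊ y <-> val x ∊ val y.
Proof. reflexivity. Qed.

Lemma hc_mk P : small P -> (forall y, P y -> HC y) ->
  exists x : N, val x = mkc P /\ forall y : N, y ∊ x <-> P (val y).
Proof.
  intros H1 H2. exists (exist _ (mkc P) (HC_mkc P H1 H2)). split; auto.
  intros y; rewrite val_in; cbn. apply mkc_in; auto.
Qed.

(** [HC] is transitive and its elements are classical, so a description of a set by its members
    means the same in [N] and in [M]. *)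
Lemma hc_zset (x : N) (P : N -> Prop) Q : small Q -> (forall y, Q y -> HC y) ->
  (forall y : N, P y <-> Q (val y)) -> (zset x P <-> val x = mkc Q).
Proof.
  intros HQ HQ' H. split.
  - intros K. apply cl_ext; [apply HC_cl, val_HC|apply mkc_cl; auto|].
    intros z. rewrite mkc_in by auto. split.
    + intros Hz. assert (Hz' : HC z) by (apply (HC_in (val x)); [apply val_HC|left; auto]).
      apply val_ex in Hz' as [z' <-]. apply H, K; auto.
    + intros Hz. destruct (val_ex z (HQ' z Hz)) as [z' <-]. apply (K z'), H; auto.
  - intros K z. rewrite val_in, K, mkc_in, H by auto. tauto.
Qed.

Lemma hc_ext (x y : N) : (forall z : N, z ∊ x <-> z ∊ y) -> x = y.
Proof.
  intros H. apply val_inj. apply cl_ext; [apply HC_cl, val_HC..|].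
  intros z; split; intros Hz.
  - destruct (val_ex z) as [z' <-]; [apply (HC_in (val x)); [apply val_HC|left; auto]|].
    apply (H z'); auto.
  - destruct (val_ex z) as [z' <-]; [apply (HC_in (val y)); [apply val_HC|left; auto]|].
    apply (H z'); auto.
Qed.

Lemma rsat_N p : forall s : nat -> N, satT N s p <-> rsat HC (fun i => val (s i)) p.
Proof.
  assert (E : forall (d : N) s, (fun i => val (scons d s i)) = scons (val d) (fun i => val (s i))).
  { intros; apply functional_extensionality; intros [|i]; reflexivity. }
  induction p; intros s; cbn [satT rsat].
  - apply val_in.
  - split; [intros ->; auto|apply val_inj].
  - tauto.
  - rewrite (satF_classical _ _ N_classical), IHp; tauto.
  - rewrite IHp1, IHp2; tauto.
  - rewrite IHp1, IHp2; tauto.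
  - rewrite IHp1, IHp2; tauto.
  - split.
    + intros H d Hd. apply val_ex in Hd as [d' <-]. rewrite <- E, <- IHp; auto.
    + intros H d. rewrite IHp, E. apply H, val_HC.
  - split.
    + intros [d H]. exists (val d). split; [apply val_HC|]. rewrite <- E, <- IHp; auto.
    + intros (d & Hd & H). apply val_ex in Hd as [d' <-]. exists d'. rewrite IHp, E; auto.
Qed.

Lemma zsing_N (z x : N) : zset z (fun z0 : N => z0 = x) <-> val z = sg (val x).
Proof.
  apply (hc_zset z _ (fun y => y = val x)); [apply small_eq|intros ? ->; apply val_HC|].
  intros w; split; [intros ->; auto|apply val_inj].
Qed.

Lemma zupair_N (z x y : N) : zupair z x y <-> val z = upr (val x) (val y).
Proof.
  apply (hc_zset z _ (fun w => w = val x \/ w = val y)); [apply ws_pair|intros ? [->| ->]; apply val_HC|].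
  intros w; split; (intros [H|H]; [left|right]); subst; auto; apply val_inj; auto.
Qed.

Lemma zpair_N (p x y : N) : zpair p x y <-> val p = kp (val x) (val y).
Proof.
  apply (hc_zset p _ (fun w => w = sg (val x) \/ w = upr (val x) (val y))).
  - apply ws_pair.
  - intros z [->| ->]; [apply HC_sg|apply HC_upr]; apply val_HC.
  - intros z. rewrite zsing_N, zupair_N; tauto.
Qed.

Lemma zpairin_N (x y f : N) : zpairin x y f <-> kp (val x) (val y) ∊ val f.
Proof.
  split.
  - intros (p & Hp & H). apply zpair_N in Hp as <-. auto.
  - intros H. destruct (val_ex (kp (val x) (val y))) as [p Hp]; [apply HC_kp; apply val_HC|].
    exists p. rewrite zpair_N, val_in, Hp; auto.
Qed.

Hypothesis Hchoice : modelsT M ax_choice.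

Lemma HC_mem (x : N) y : y ∊ val x -> HC y.
Proof. intros H. apply (HC_in (val x)); [apply val_HC|left; auto]. Qed.

Lemma HCm_choice : modelsT N zax_choice.
Proof.
  apply zmodels_choice. intros u Hu.
  assert (Hu' : forall x, x ∊ val u -> exists y, y ∊ x).
  { intros x Hx. destruct (val_ex x (HC_mem u x Hx)) as [x' <-].
    destruct (Hu x' Hx) as [y Hy]. exists (val y); auto. }
  destruct (proj1 (models_choice M) Hchoice (val u) (HC_cl _ (val_HC u)) Hu')
    as (f & (b & C1 & C2 & C3 & C4 & C5) & Hf).
  (* Choice in [M] yields a graph of BS4 pairs, which is recoded with Kuratowski pairs. The clause y
     ∊ x ensures that the chosen values are hereditarily classical. *)
  assert (K : small (fun p => exists x, x ∊ val u /\ exists y, ipair_in x y f /\ y ∊ x /\ p = kp x y)).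
  { apply (small_repl (fun x => x ∊ val u) (fun x p => exists y, ipair_in x y f /\ y ∊ x /\ p = kp x y)).
    - apply small_in.
    - unfold ipair_in; def.
    - intros x p p' Hx (y & H1 & _ & ->) (y' & H2 & _ & ->). f_equal. apply (C5 x); auto. }
  destruct (hc_mk _ K) as (g & Hg & Hg').
  { intros p (x & Hx & y & _ & Hy & ->). apply HC_kp.
    - apply (HC_mem u); auto.
    - apply (HC_in x); [apply (HC_mem u); auto|left; auto]. }
  assert (E : forall x y : N, kp (val x) (val y) ∊ val g <->
    val x ∊ val u /\ ipair_in (val x) (val y) f /\ val y ∊ val x).
  { intros x y. rewrite Hg, mkc_in by auto. split.
    - intros (x' & Hx & y' & H1 & H2 & H). apply kp_inj in H as [-> ->]; auto.
    - intros (H1 & H2 & H3). exists (val x); split; auto. exists (val y); auto. }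
  assert (T : forall x : N, x ∊ u -> exists y : N, kp (val x) (val y) ∊ val g /\ val y ∊ val x).
  { intros x Hx. destruct (Hf (val x) Hx) as (y & Hy & Hyx).
    destruct (val_ex y (HC_mem x y Hyx)) as [y' <-]. exists y'. rewrite E; auto. }
  exists g. split; [split; [|split]|].
  - intros p Hp. apply Hg' in Hp as (x & Hx & y & _ & Hy & H).
    assert (Hx' := HC_mem u x Hx). destruct (val_ex x Hx') as [x' <-].
    destruct (val_ex y (HC_mem x' y Hy)) as [y' <-].
    exists x', y'. rewrite zpair_N, val_in; auto.
  - intros x Hx. destruct (T x Hx) as (y & Hy & _). exists y. apply zpairin_N; auto.
  - intros x y z [Hy Hz]. rewrite zpairin_N, E in *. apply val_inj. apply (C5 (val x)); tauto.
  - intros x Hx. destruct (T x Hx) as (y & Hy & Hyx). exists y. rewrite zpairin_N; auto.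
Qed.

Lemma HCm_sep p : modelsT N (zax_sep p).
Proof.
  apply zmodels_sep. intros s u.
  assert (K : small (fun y => y ∊ val u /\ rsat HC (scons y (fun i => val (s i))) p)).
  { apply small_sub with (fun y => y ∊ val u); [apply small_in| |tauto].
    apply def_and; [def|].
    eapply def_iff; [apply (def_rsat HC p) with (r := fun i => match i with 0 => inl 0 | S j => inr (val (s j)) end); def|].
    intros e; cbv beta. match goal with |- rsat HC ?a p <-> rsat HC ?b p => replace b with a; [reflexivity|] end.
    apply functional_extensionality; intros [|i]; reflexivity. }
  destruct (hc_mk _ K) as (x & _ & Hx).
  { intros y [Hy _]. apply (HC_mem u); auto. }
  exists x; intros y. rewrite Hx, rsat_N, val_in.
  match goal with |- _ /\ rsat HC ?a p <-> _ /\ rsat HC ?b p => replace b with a; [reflexivity|] end.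
  apply functional_extensionality; intros [|i]; reflexivity.
Qed.

Lemma HCm_repl p : modelsT N (zax_repl p).
Proof.
  apply zmodels_repl. intros s Hf u.
  pose (R := fun x y => HC x /\ HC y /\ rsat HC (scons x (scons y (fun i => val (s i)))) p).
  assert (E : forall x y : N, R (val x) (val y) <-> satT N (scons x (scons y s)) p).
  { intros x y. rewrite rsat_N. unfold R.
    match goal with |- _ /\ _ /\ rsat HC ?a p <-> rsat HC ?b p => replace b with a end.
    - pose proof (val_HC x). pose proof (val_HC y). tauto.
    - apply functional_extensionality; intros [|[|i]]; reflexivity. }
  assert (K : small (fun y => exists x, x ∊ val u /\ R x y)).
  { apply small_repl.
    - apply small_in.
    - unfold R. apply def_and; [def|]. apply def_and; [def|].
      eapply def_iff; [apply (def_rsat HC p) with (r := fun i => match i with 0 => inl 0 | 1 => inl 1 | S (S j) => inr (val (s j)) end); def|].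
      intros e; cbv beta. match goal with |- rsat HC ?a p <-> rsat HC ?b p => replace b with a; [reflexivity|] end.
      apply functional_extensionality; intros [|[|i]]; reflexivity.
    - intros x y z _ Hy Hz. pose proof Hy as [Hx' [Hy' _]]. pose proof Hz as [_ [Hz' _]].
      apply val_ex in Hx' as [x' <-], Hy' as [y' <-], Hz' as [z' <-].
      apply E in Hy, Hz. f_equal. eauto. }
  destruct (hc_mk _ K) as (v & _ & Hv).
  { intros y (x & _ & _ & Hy & _); auto. }
  exists v; intros y. rewrite Hv. split.
  - intros (x & Hx & H). destruct (val_ex x) as [x' <-]; [apply H|]. apply E in H. exists x'; auto.
  - intros (x & Hx & H). exists (val x). apply E in H. auto.
Qed.

(** The inductive set of [M] need not lie in [HC], but its elements in [HC] form a classical set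
    containing ∅ and closed under successor. *)
Lemma HCm_infinity : modelsT N zax_infinity.
Proof.
  apply zmodels_infinity.
  destruct (proj1 (models_infinity M) bz_infinity) as (I & (e & He & HeI) & HI).
  assert (K : small (fun y => y ∊ I /\ HC y)).
  { apply small_sub with (fun y => y ∊ I); [apply small_in|def|tauto]. }
  destruct (hc_mk _ K) as (x & _ & Hx); [tauto|].
  exists x; split.
  - apply iempty_eq in He as ->. destruct (val_ex (emp M) HC_emp) as [e He].
    exists e. split; [|rewrite Hx, He; split; auto; apply HC_emp].
    apply (hc_zset e _ (fun _ => False)); auto; try tauto. apply small_false.
  - intros y Hy. apply Hx in Hy as [Hy _]. destruct (HI _ Hy) as (s & Hs & HsI).
    assert (Hs' : small (fun z => z ∊ val y \/ z = val y)) by (apply small_or; [apply small_in|apply small_eq]).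
    assert (Hs'' : forall z, z ∊ val y \/ z = val y -> HC z).
    { intros z [Hz| ->]; [apply (HC_mem y); auto|apply val_HC]. }
    assert (E : s = mkc (fun z => z ∊ val y \/ z = val y)).
    { apply (iset_mkc s _ (fun z => z ∊ val y \/ z = val y) (fun z => z ∊? val y \/ z = val y)); auto; try tauto.
      intros z. pose proof (HC_cl _ (val_HC y) z). tauto. }
    destruct (val_ex s) as [s' <-]; [rewrite E; apply HC_mkc; auto|].
    exists s'. split; [|rewrite Hx; split; auto; apply val_HC].
    apply (hc_zset s' _ (fun z => z ∊ val y \/ z = val y)); auto.
    intros z; rewrite val_in. split; (intros [H|H]; [left|right]); subst; auto; apply val_inj; auto.
Qed.

Lemma HCm_ZFC : ZFCmodel N.
Proof.
  split; [apply N_classical|]. intros q [ |p|p| | | | | | ].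
  - apply zmodels_ext. apply hc_ext.
  - apply HCm_sep.
  - apply HCm_repl.
  - apply zmodels_pairing. intros u v.
    destruct (hc_mk (fun y => y = val u \/ y = val v) (ws_pair _ _)) as (x & _ & Hx).
    { intros y [->| ->]; apply val_HC. }
    exists x. intros y; rewrite Hx.
    split; (intros [H|H]; [left|right]); subst; auto; apply val_inj; auto.
  - apply zmodels_power. intros u.
    assert (K : small (fun x => isub x (val u) /\ cl x)).
    { apply small_sub with (fun x => isub x (val u)); [apply ws_power|unfold isub; def|tauto]. }
    destruct (hc_mk _ K) as (v & _ & Hv).
    { apply HC_isub, val_HC. }
    exists v; intros x. rewrite Hv. pose proof (HC_cl _ (val_HC x)) as Cx.
    pose proof (HC_cl _ (val_HC u)) as Cu. split.
    + intros [H _] z Hz. apply H; auto.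
    + intros H. split; auto. intros z. rewrite <- (Cx z), <- (Cu z).
      assert (L : z ∊ val x -> z ∊ val u); [|split; auto].
      intros Hz. destruct (val_ex z (HC_mem x z Hz)) as [z' <-]. apply (H z'); auto.
  - apply zmodels_union. intros u.
    destruct (hc_mk _ (ws_union (val u))) as (x & _ & Hx).
    { intros y (z & Hy & Hz). apply (HC_in z); [apply (HC_mem u); auto|left; auto]. }
    exists x; intros y. rewrite Hx. split.
    + intros (z & Hy & Hz). destruct (val_ex z (HC_mem u z Hz)) as [z' <-]. exists z'; auto.
    + intros (z & Hy & Hz). exists (val z); auto.
  - apply HCm_infinity.
  - apply zmodels_foundation; [apply N_classical|]. intros x Hne. apply NNPP; intros H.
    (* Without an ∈-minimal element, induction in [M] shows that nothing belongs to [x]. *)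
    assert (K : forall y, ~ y ∊ val x).
    { match goal with |- forall y, @?P y => apply (ws_ind P) end; [def|].
      intros y IH Hy. apply H. destruct (val_ex y (HC_mem x y Hy)) as [y' <-].
      exists y'; split; auto. intros (z & Hz & Hzy). apply (IH (val z)); auto. left; auto. }
    destruct Hne as [y Hy]. apply (K (val y)); auto.
  - apply HCm_choice.
Qed.
End HCm.

Lemma ZFCmodel_ZF M : ZFCmodel M -> ZF M.
Proof. intros H; split; [apply H|apply ZFC_WS, H]. Qed.

(** * The class HCL consists of the hereditarily classical sets *)

Section HCL.
Context {M : TFmodel} {HB : BZ M}.
Hypothesis Hchoice : modelsT M ax_choice.

Local Notation N := (HCm M).

#[local] Instance N_ZF : ZF N := ZFCmodel_ZF N (HCm_ZFC Hchoice).

Lemma val_mkc (P : N -> Prop) Q : small P -> small Q -> (forall y, Q y -> HC y) ->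
  (forall y : N, P y <-> Q (val y)) -> val (mkc P) = mkc Q.
Proof.
  intros HP HQ H1 H2. apply (hc_zset (mkc P) P Q); auto. intros y. apply mkc_in; auto.
Qed.

Lemma val_emp : val (emp N) = emp M.
Proof. apply val_mkc; try apply small_false; tauto. Qed.

Lemma val_kp (x y : N) : val (kp x y) = kp (val x) (val y).
Proof. apply zpair_N, zpair_eq; reflexivity. Qed.

Lemma val_sg (x : N) : val (sg x) = sg (val x).
Proof. apply zsing_N. intros y; apply in_sg. Qed.

(** The BS4 pair of two hereditarily classical sets, formed inside [N]. It is the pairing [pi] with
    which the recursion for HCL is coded. *)
Definition npair (a b : N) : N := mkc (tagc (fun x => x ∊ a) (fun x => x ∊ b)).

Lemma in_npair (a b z : N) : z ∊ npair a b <-> tagc (fun x => x ∊ a) (fun x => x ∊ b) z.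
Proof. apply mkc_in, small_tagc; apply small_in. Qed.

Lemma npair_inj (a b c d : N) : npair a b = npair c d -> a = c /\ b = d.
Proof.
  intros H. split; apply zf_ext; intros z.
  - rewrite <- (tagc0 (fun x => x ∊ a) (fun x => x ∊ b)), <- (tagc0 (fun x => x ∊ c) (fun x => x ∊ d)).
    rewrite <- !in_npair, H; tauto.
  - rewrite <- (tagc1 (fun x => x ∊ a) (fun x => x ∊ b)), <- (tagc1 (fun x => x ∊ c) (fun x => x ∊ d)).
    rewrite <- !in_npair, H; tauto.
Qed.

Lemma npair_def : DefT N (fun s => npair (s 0) (s 1)).
Proof.
  unfold npair. apply (defT_mkc (fun z s => tagc (fun x => x ∊ s 0) (fun x => x ∊ s 1) z)).
  - intros; apply small_tagc; apply small_in.
  - unfold tagc; def.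
Qed.

Lemma tagc_val (A B : M -> Prop) (A' B' : N -> Prop) (z : N) :
  (forall x, A x -> HC x) -> (forall x, B x -> HC x) ->
  (forall x : N, A' x <-> A (val x)) -> (forall x : N, B' x <-> B (val x)) ->
  (tagc A' B' z <-> tagc A B (val z)).
Proof.
  intros HA HB' H1 H2. unfold tagc. split.
  - intros [(x & -> & H)|(x & -> & H)]; [left|right]; exists (val x);
      rewrite val_kp, ?val_sg, val_emp; split; auto; [apply H1|apply H2]; auto.
  - intros [(x & E & H)|(x & E & H)]; [left|right].
    + destruct (val_ex x (HA x H)) as [x' <-]. exists x'. split; [|apply H1; auto].
      apply val_inj. rewrite val_kp, val_emp; auto.
    + destruct (val_ex x (HB' x H)) as [x' <-]. exists x'. split; [|apply H2; auto].
      apply val_inj. rewrite val_kp, val_sg, val_emp; auto.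
Qed.

Lemma val_npair (p a b : N) : ipair (val p) (val a) (val b) <-> p = npair a b.
Proof.
  assert (E : forall z : N, tagc (fun x => x ∊ a) (fun x => x ∊ b) z <->
    tagc (fun x => x ∊ val a) (fun x => x ∊ val b) (val z)).
  { intros z; apply tagc_val; try (intros; apply val_in); [apply (HC_mem a)|apply (HC_mem b)]. }
  split.
  - intros H. rewrite ipair_iff in H. apply zf_ext. intros z.
    rewrite in_npair, E, <- (proj1 (H _)). apply val_in.
  - intros ->. destruct (ipair_ex (val a) (val b)) as [q Hq].
    assert (HC q) by (eapply HC_ipair; eauto; apply val_HC).
    destruct (val_ex q) as [q' <-]; auto.
    replace (npair a b) with q'; auto. apply zf_ext. intros z.
    rewrite in_npair, E. rewrite ipair_iff in Hq. rewrite <- (proj1 (Hq _)). apply val_in.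
Qed.

Definition Pset (w : N) : N := mkc (fun x => forall y, y ∊ x -> y ∊ w).

Lemma in_Pset (x w : N) : x ∊ Pset w <-> forall y, y ∊ x -> y ∊ w.
Proof.
  apply (mkc_in (fun x => forall y, y ∊ x -> y ∊ w)).
  eapply small_iff; [apply (ws_power w)|]. intros y; cbn beta. unfold isub.
  split; intros H z; [|apply H].
  rewrite !inQ_classical by apply zf_classical. split; apply H.
Qed.

Lemma Pset_def : DefT N (fun s => Pset (s 0)).
Proof.
  unfold Pset. apply (defT_mkc (fun x s => forall y, y ∊ x -> y ∊ s 0)); [|def].
  intros s. exists (Pset (s 0)). split; [apply zf_cl|]. intros x; apply in_Pset.
Qed.

(** The theorem V = ⋃ V_α inside [N]: with all sets good and members as children, [hcl_iff] is the
    step of an ∈-induction. *)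
Lemma N_hcl (x : N) : hcl npair Pset x.
Proof.
  revert x. zf_induction.
  - apply def_hcl; [apply npair_def|apply Pset_def|def].
  - intros x IH. apply (hcl_iff npair npair_inj npair_def Pset Pset_def (fun _ => True) (fun y x => y ∊ x)); auto.
    + intros y w. rewrite in_Pset. tauto.
    + def.
    + def.
    + intros; apply small_in.
Qed.

Lemma ipair_in_N (x y f : N) : ipair_in (val x) (val y) (val f) <-> npair x y ∊ f.
Proof.
  split.
  - intros (p & Hp & H). destruct (val_ex p) as [p' <-]; [apply (HC_mem f); auto|].
    apply val_npair in Hp as <-; auto.
  - intros H. exists (val (npair x y)). split; auto. apply val_npair; auto.
Qed.

Lemma ipair_in_ex x y (f : N) : ipair_in x y (val f) ->
  exists x' y' : N, x = val x' /\ y = val y' /\ npair x' y' ∊ f.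
Proof.
  intros (p & Hp & H). assert (K : HC p) by (apply (HC_mem f); auto).
  destruct (HC_ipair_inv _ _ _ Hp K) as [Hx Hy].
  destruct (val_ex x Hx) as [x' <-], (val_ex y Hy) as [y' <-].
  exists x', y'. repeat split; auto. apply ipair_in_N. exists p; auto.
Qed.

Lemma ipair_inQ_iff (x y f : M) : cl f -> (ipair_inQ x y f <-> ipair_in x y f).
Proof.
  intros H. unfold ipair_inQ, ipair_in. split; intros (p & ? & ?); exists p; split; auto; apply H; auto.
Qed.

Lemma val_isucc (x a : N) : isucc (val x) (val a) <-> x = sc a.
Proof.
  unfold isucc. rewrite <- zsc_eq. unfold zset, iset. split.
  - intros H z. rewrite val_in, (proj1 (H (val z))), val_in.
    split; (intros [K|K]; [left|right]); subst; auto; apply val_inj; auto.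
  - intros H z.
    pose proof (HC_cl _ (val_HC x) z) as C1. pose proof (HC_cl _ (val_HC a) z) as C2.
    rewrite <- C1, <- C2.
    assert (L : z ∊ val x <-> z ∊ val a \/ z = val a); [|tauto].
    split.
    + intros Hz. destruct (val_ex z (HC_mem x z Hz)) as [z' <-].
      apply (H z') in Hz as [K| ->]; auto.
    + intros Hz. assert (Hz' : HC z) by (destruct Hz as [Hz| ->]; [apply (HC_mem a); auto|apply val_HC]).
      apply val_ex in Hz' as [z' <-]. apply (H z'). destruct Hz as [K|K]; auto.
      right; apply val_inj; auto.
Qed.

Lemma val_iempty (x : N) : iempty (val x) <-> x = emp N.
Proof.
  rewrite iempty_eq. rewrite <- val_emp. split; [apply val_inj|intros ->; auto].
Qed.

Lemma iord_N (a : N) : zordinal a -> iord (val a).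
Proof.
  intros [H1 H2]. assert (C := HC_cl _ (val_HC a)).
  assert (L : forall b, b ∊ val a -> exists b' : N, b = val b' /\ b' ∊ a).
  { intros b Hb. destruct (val_ex b (HC_mem a b Hb)) as [b' <-]. exists b'; auto. }
  split; [exact C|]. split; [|split].
  - intros b Hb. apply L in Hb as (b' & -> & _). apply HC_cl, val_HC.
  - intros b Hb. apply L in Hb as (b' & -> & Hb). intros z.
    pose proof (HC_cl _ (val_HC b') z) as C'. specialize (C z).
    assert (K : z ∊ val b' -> z ∊ val a); [|tauto].
    intros Hz. destruct (val_ex z (HC_mem b' z Hz)) as [z' <-]. apply (H1 b' Hb z'); auto.
  - intros b c [Hb Hc]. apply L in Hb as (b' & -> & Hb). apply L in Hc as (c' & -> & Hc).
    destruct (H2 b' c') as [K|[K|K]]; subst; auto.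
Qed.

Lemma ilim_N (b : N) : olim b <-> ilim (val b).
Proof.
  split; intros [H1 H2]; split.
  - destruct H1 as [c Hc]. exists (val c); auto.
  - intros c Hc. destruct (val_ex c (HC_mem b c Hc)) as [c' <-].
    exists (val (sc c')). split; [apply val_isucc; auto|]. apply H2; auto.
  - destruct H1 as [c Hc]. destruct (val_ex c (HC_mem b c Hc)) as [c' <-]. exists c'; auto.
  - intros c Hc. destruct (H2 (val c) Hc) as (s & Hs & H).
    destruct (val_ex s (HC_mem b s H)) as [s' <-]. apply val_isucc in Hs as ->; auto.
Qed.

(** Every classical subset of an element of [N] lies in [N], so the power sets of [N] are the
    successor stages of HCL in [M]; all sets involved are classical, which settles the falsity
    conditions. *)
Lemma iHCL_rec_N (f : N) : hrec npair Pset f -> iHCL_rec (val f).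
Proof.
  intros Hr b v Hbv. apply ipair_in_ex in Hbv as (b' & v' & -> & -> & H).
  destruct (Hr b' v' H) as [[-> ->]|[(c & w & -> & Hc & ->)|[K E]]].
  - left. rewrite !val_iempty; auto.
  - right; left. exists (val c), (val w). rewrite val_isucc, ipair_in_N.
    split; [auto|]. split; [auto|].
    assert (L : forall y, y ∊ val (Pset w) <-> isub y (val w) /\ cl y).
    { intros y; split.
      - intros Hy. destruct (val_ex y (HC_mem _ _ Hy)) as [y' <-].
        rewrite <- val_in, in_Pset in Hy. split; [|apply HC_cl, val_HC].
        intros z. rewrite <- (HC_cl _ (val_HC y') z), <- (HC_cl _ (val_HC w) z).
        assert (L : z ∊ val y' -> z ∊ val w); [|split; auto].
        intros Hz. destruct (val_ex z (HC_mem _ _ Hz)) as [z' <-]. apply (Hy z'); auto.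
      - intros Hy. destruct (val_ex y (HC_isub _ (val_HC w) y Hy)) as [y' <-].
        rewrite <- val_in, in_Pset. intros z Hz. apply (proj1 Hy (val z)); auto. }
    intros y. split; [apply L|]. rewrite <- (HC_cl _ (val_HC _) y). apply L.
  - right; right. split; [apply ilim_N; auto|].
    assert (L : forall z, z ∊ val v' <-> exists c w, c ∊ val b' /\ ipair_in c w (val f) /\ z ∊ w).
    { intros z; split.
      - intros Hz. destruct (val_ex z (HC_mem _ _ Hz)) as [z' <-].
        apply (E z') in Hz as (c & w & H1 & H2 & H3). exists (val c), (val w).
        rewrite ipair_in_N; auto.
      - intros (c & w & H1 & H2 & H3). apply ipair_in_ex in H2 as (c' & w' & -> & -> & H2).
        destruct (val_ex z (HC_mem _ _ H3)) as [z' <-]. apply (E z'). exists c', w'; auto. }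
    intros z. split; [apply L|]. rewrite <- (HC_cl _ (val_HC v') z), L.
    split; intros (c & w & H1 & H2 & H3); exists c, w;
      rewrite (ipair_inQ_iff _ _ _ (HC_cl _ (val_HC f))) in *.
    + split; [apply (HC_cl _ (val_HC b')); auto|]. split; auto.
      apply ipair_in_ex in H2 as (c' & w' & -> & -> & H2). apply (HC_cl _ (val_HC w')); auto.
    + split; [apply (HC_cl _ (val_HC b')); auto|]. split; auto.
      apply ipair_in_ex in H2 as (c' & w' & -> & -> & H2). apply (HC_cl _ (val_HC w')); auto.
Qed.

Lemma icfun_N (f d : N) : hfun npair f d -> exists b, icfun (val f) (val d) b.
Proof.
  intros (H1 & H2 & H3).
  (* A codomain has to be supplied: the set of second components of the pairs in [f]. *)
  assert (K : small (fun y => exists p, p ∊ val f /\ exists x, ipair p x y)).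
  { apply (small_repl (fun p => p ∊ val f) (fun p y => exists x, ipair p x y)).
    - apply small_in.
    - def.
    - intros p y z _ [x Hx] [x' Hx']. apply (ipair_inj _ _ _ _ _ Hx Hx'). }
  assert (Cf := HC_cl _ (val_HC f)). assert (Cd := HC_cl _ (val_HC d)).
  assert (Cb := mkc_cl _ K).
  set (b := mkc (fun y => exists p, p ∊ val f /\ exists x, ipair p x y)) in *.
  assert (L : forall z, z ∊ val f -> exists x y, ipair z x y /\ x ∊ val d /\ y ∊ b).
  { intros z Hz. destruct (val_ex z (HC_mem _ _ Hz)) as [z' <-].
    destruct (H1 z' Hz) as (x & y & -> & Hx). exists (val x), (val y).
    assert (E : ipair (val (npair x y)) (val x) (val y)) by (apply val_npair; auto).
    split; auto. split; auto. apply (mkc_in (fun y => exists p, p ∊ val f /\ exists x, ipair p x y)); eauto. }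
  assert (D : forall x, x ∊ val d <-> exists y, ipair_in x y (val f)).
  { intros x; split.
    - intros Hx. destruct (val_ex x (HC_mem _ _ Hx)) as [x' <-].
      destruct (H2 x' Hx) as [y Hy]. exists (val y). apply ipair_in_N; auto.
    - intros [y Hy]. apply ipair_in_ex in Hy as (x' & y' & -> & -> & Hp).
      destruct (H1 _ Hp) as (x & y & E & Hx). apply npair_inj in E as [-> ->]; auto. }
  exists b. split; [exact Cd|]. split; [exact Cf|]. split; [|split].
  - intros z. split; [apply L|]. intros Hz. apply Cf, L in Hz as (x & y & E & Hx & Hy).
    exists x, y. split; auto. split; [apply Cd|apply Cb]; auto.
  - intros x. split; [apply D|]. rewrite <- (Cd x), D.
    split; intros [y Hy]; exists y; apply ipair_inQ_iff; auto.
  - intros x y z [Hy Hz]. apply ipair_in_ex in Hy as (x' & y' & -> & -> & Hy).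
    apply ipair_in_ex in Hz as (x'' & z' & E & -> & Hz). apply val_inj in E as <-.
    f_equal. eapply H3; eauto.
Qed.

(** The ordinal and the approximating function found in [N] remain correct witnesses when read in
    [M]. *)
Lemma HC_iHCL (x : M) : HC x -> iHCL x.
Proof.
  intros H. apply val_ex in H as [x' <-]. destruct (N_hcl x') as (a & v & (Ha & f & Hf & Hr & Hav) & Hx).
  exists (val a), (val v). split; auto. split; [apply iord_N; auto|].
  exists (val (sc a)), (val f). split; [apply val_isucc; auto|].
  split; [apply icfun_N; auto|]. split; [apply iHCL_rec_N; auto|]. apply ipair_in_N; auto.
Qed.

(** Induction on the argument shows that all values of [f] are hereditarily classical. The arguments
    themselves are classical, which is needed to treat the falsity conditions of the limit
    clause. *)
Lemma iHCL_at_HC (a v : M) : iHCL_at a v -> HC v.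
Proof.
  intros ((Oa1 & Oa2 & Oa3 & Oa4) & d & f & Hd & (b & C1 & C2 & C3 & C4 & C5) & Hr & Hav).
  assert (Dom : forall x y, ipair_in x y f -> cl x).
  { intros x y (p & Hp & Hpf). apply C3 in Hpf as (x' & y' & Hp' & Hx & Hy).
    destruct (ipair_inj _ _ _ _ _ Hp Hp') as [-> ->]. apply Hd in Hx as [Hx| ->]; auto. }
  cut (forall x y, ipair_in x y f -> HC y); [eauto|]. clear v Hav.
  ws_induction; [unfold ipair_in; def|].
  intros x IH y Hxy. assert (Cx := Dom _ _ Hxy).
  destruct (Hr x y Hxy) as [[_ Hy]|[(c & w & Hs & Hcw & Hy)|[_ Hy]]].
  - apply iempty_eq in Hy as ->. apply HC_emp.
  - assert (Hw : HC w).
    { apply (IH c); auto. left. apply Hs; auto. }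
    apply HC_iff; split.
    + intros z. destruct (Hy z) as [-> ->]; tauto.
    + intros z Hz. apply (proj1 (proj1 (Hy z))) in Hz. apply (HC_isub w Hw z Hz).
  - assert (K : forall c w, c ∊ x /\ ipair_in c w f -> HC w).
    { intros c w [Hc Hw]. apply (IH c); auto. left; auto. }
    apply HC_iff; split.
    + intros z. destruct (Hy z) as [-> ->].
      split; intros (c & w & H1 & H2 & H3); exists c, w;
        rewrite (ipair_inQ_iff _ _ _ C2) in *; specialize (Cx c);
        (assert (Hw : HC w) by (apply (K c); tauto));
        pose proof (HC_cl _ Hw z); tauto.
    + intros z Hz. apply Hy in Hz as (c & w & H1 & H2 & H3).
      assert (Hw : HC w) by (apply (K c); auto). apply (HC_in w); auto. left; auto.
Qed.

Lemma iHCL_iff (x : M) : iHCL x <-> HC x.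
Proof.
  split; [|apply HC_iHCL]. intros (a & v & H & Hx). apply (HC_in v); [|left; auto].
  eapply iHCL_at_HC; eauto.
Qed.

(** On hereditarily classical parameters the relativized formula is two-valued. For = this is the
    falsity half of Extensionality applied to classical sets; for quantifiers it is the [bang] in
    [HCL]. *)
Lemma HCL_rel_ev p : forall s : nat -> M, (forall i, HC (s i)) ->
  ev M s (HCL_rel p) (rsat HC s p) (rsat HC s p).
Proof.
  induction p; intros s Hs; cbn [HCL_rel rsat].
  - split; cbn; [tauto|]. specialize (HC_cl _ (Hs n0) (s n)). destruct (classic (inF M (s n) (s n0))); tauto.
  - split; cbn; [tauto|]. pose proof (models_ext M) as [E _]. specialize (E bz_ext (s n) (s n0)).
    destruct E as [_ E].
    destruct (classic (neq M (s n) (s n0))) as [K|K]; split; try tauto.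
    + intros _ Heq. apply E; auto. rewrite Heq. intros z.
      pose proof (HC_cl _ (Hs n0) z); tauto.
    + intros Hne. exfalso. apply Hne. apply cl_ext; [apply HC_cl, Hs..|].
      intros z. destruct (proj1 E K z) as [K1 K2].
      pose proof (HC_cl _ (Hs n) z); pose proof (HC_cl _ (Hs n0) z); tauto.
  - split; cbn; tauto.
  - apply (ev_neg 0 s (fun _ => HCL_rel p)); auto.
  - apply (ev_and 0 s (fun _ => HCL_rel p1) (fun _ => HCL_rel p2)); auto.
  - apply (ev_or 0 s (fun _ => HCL_rel p1) (fun _ => HCL_rel p2)); auto.
  - apply (ev_imp 0 s (fun _ => HCL_rel p1) (fun _ => HCL_rel p2) _ (rsat HC s p1)); auto.
  - apply (ev_all 0 s (fun _ _ => fImp HCL (HCL_rel p))). intros d.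
    apply ev_conv with (HC d -> rsat HC (scons d s) p) (HC d -> rsat HC (scons d s) p); try tauto.
    destruct (classic (HC d)) as [Hd|Hd].
    + apply (ev_imp 0 _ (fun _ => HCL) (fun _ => HCL_rel p) _ (HC d)).
      * eapply ev_conv; [apply ev_HCL| |]; apply iHCL_iff.
      * apply IHp. intros [|i]; cbn; auto.
    + eapply ev_conv; [eapply (ev_imp 0 _ (fun _ => HCL) (fun _ => HCL_rel p));
        [eapply ev_conv; [apply ev_HCL| |]; apply iHCL_iff | apply ev_form]| |]; cbn; tauto.
  - apply (ev_ex 0 s (fun _ _ => fAnd HCL (HCL_rel p))). intros d.
    destruct (classic (HC d)) as [Hd|Hd].
    + apply (ev_and 0 _ (fun _ => HCL) (fun _ => HCL_rel p)).
      * eapply ev_conv; [apply ev_HCL| |]; apply iHCL_iff.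
      * apply IHp. intros [|i]; cbn; auto.
    + eapply ev_conv; [eapply (ev_and 0 _ (fun _ => HCL) (fun _ => HCL_rel p));
        [eapply ev_conv; [apply ev_HCL| |]; apply iHCL_iff | apply ev_form]| |]; cbn; tauto.
Qed.
End HCL.

(** * The class W *)

Section W.
Context {M : TFmodel} {HZ : ZF M}.

Definition ispair (x : M) : Prop := exists a b, x = kp a b.
(** The elements of W on which x = (a,b) is built; these must precede x in the hierarchy. *)
Definition child (y x : M) : Prop := exists a b, x = kp a b /\ (y ∊ a \/ y ∊ b).
Definition Sw (w : M) : M :=
  mkc (fun z => exists x y, zsubset x w /\ zsubset y w /\ z = kp x y).
Definition Wc : M -> Prop := hcl kp Sw.

Lemma small_zsub (w : M) : small (fun x => zsubset x w).
Proof.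
  eapply small_iff; [apply (ws_power w)|]. intros y; cbn beta. unfold isub, zsubset.
  split; intros H z; [|apply H].
  rewrite !inQ_classical by apply zf_classical. split; apply H.
Qed.

Lemma small_Sw (w : M) : small (fun z => exists x y, zsubset x w /\ zsubset y w /\ z = kp x y).
Proof. apply (small_prod (fun x => zsubset x w) (fun x => zsubset x w)); apply small_zsub. Qed.

Lemma in_Sw (x w : M) : x ∊ Sw w <-> ispair x /\ forall y, child y x -> y ∊ w.
Proof.
  unfold Sw. rewrite mkc_in by apply small_Sw. split.
  - intros (a & b & Ha & Hb & ->). split; [exists a, b; auto|].
    intros y (a' & b' & E & H). apply kp_inj in E as [-> ->]. destruct H; auto.
  - intros [(a & b & ->) H]. exists a, b. split; [|split; auto]; intros y Hy; apply H; exists a, b; auto.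
Qed.

Lemma Sw_def : DefT M (fun s => Sw (s 0)).
Proof.
  apply (defT_mkc (fun z s => exists x y, zsubset x (s 0) /\ zsubset y (s 0) /\ z = kp x y)).
  - intros; apply small_Sw.
  - unfold zsubset; def.
Qed.

Lemma kp_def : DefT M (fun s => kp (s 0) (s 1)).
Proof. def. Qed.

Lemma small_child (x : M) : small (fun y => child y x).
Proof.
  destruct (classic (ispair x)) as [(a & b & ->)|N].
  - apply small_iff with (fun y => y ∊ a \/ y ∊ b).
    + apply small_or; apply small_in.
    + intros y; split.
      * intros (a' & b' & E & H). apply kp_inj in E as [-> ->]; auto.
      * intros H; exists a, b; auto.
  - apply small_iff with (fun _ => False); [apply small_false|].
    intros y; split; [|tauto]. intros (a & b & E & _). apply N; exists a, b; auto.
Qed.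

Lemma Wc_iff (x : M) : Wc x <-> ispair x /\ forall y, child y x -> Wc y.
Proof.
  apply (hcl_iff kp kp_inj kp_def Sw Sw_def ispair child in_Sw).
  - unfold child; def.
  - unfold ispair; def.
  - apply small_child.
Qed.

Lemma def_Wc F : DefT M F -> Def M (fun s => Wc (F s)).
Proof. apply (def_hcl kp kp_def Sw Sw_def). Qed.

Lemma Wc_kp (a b : M) : Wc (kp a b) <-> forall y, y ∊ a \/ y ∊ b -> Wc y.
Proof.
  rewrite Wc_iff. split.
  - intros [_ H] y Hy. apply H. exists a, b; auto.
  - intros H; split; [exists a, b; auto|].
    intros y (a' & b' & E & Hy). apply kp_inj in E as [-> ->]; auto.
Qed.

Lemma Wc_ind (P : M -> Prop) : Def M (fun s => P (s 0)) ->
  (forall a b, (forall y, y ∊ a \/ y ∊ b -> Wc y /\ P y) -> P (kp a b)) -> forall x, Wc x -> P x.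
Proof.
  intros HP H. apply (hcl_ind kp kp_inj kp_def Sw Sw_def ispair child in_Sw); auto.
  intros x (a & b & ->) K. apply H. intros y Hy. apply K. exists a, b; auto.
Qed.

Lemma zfun_kp (f d : M) : zfun f d <-> hfun kp f d.
Proof.
  unfold zfun, hfun. split; intros (H1 & H2 & H3); split; [|split| |split].
  - intros p Hp. destruct (H1 p Hp) as (x & y & E & Hx). apply zpair_eq in E. eauto.
  - intros x Hx. destruct (H2 x Hx) as [y Hy]. apply zpairin_eq in Hy. eauto.
  - intros x y z Hy Hz. apply (H3 x); rewrite !zpairin_eq; auto.
  - intros p Hp. destruct (H1 p Hp) as (x & y & E & Hx). apply zpair_eq in E. eauto.
  - intros x Hx. destruct (H2 x Hx) as [y Hy]. apply zpairin_eq in Hy. eauto.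
  - intros x y z. rewrite !zpairin_eq. intros []; eauto.
Qed.

Lemma zW_rec_kp (f : M) : zW_rec f <-> hrec kp Sw f.
Proof.
  assert (E : forall v w : M, zset v (fun z => exists x y, zpair z x y /\ zsubset x w /\ zsubset y w) <-> v = Sw w).
  { intros v w. unfold Sw. rewrite <- zset_eq by apply small_Sw. unfold zset.
    split; intros H y; rewrite H; (split; intros (a & b & K); exists a, b;
      rewrite zpair_eq in *; tauto). }
  unfold zW_rec, hrec. split; intros H b v Hbv.
  - apply zpairin_eq in Hbv. destruct (H b v Hbv) as [[H1 H2]|[(c & w & H1 & H2 & H3)|[H1 H2]]].
    + left. rewrite !zemp_eq in *; auto.
    + right; left. exists c, w. rewrite zsc_eq, zpairin_eq, E in *; auto.
    + right; right. rewrite zlim_eq in H1; split; auto. intros z; rewrite (H2 z).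
      split; intros (c & w & K); exists c, w; rewrite zpairin_eq in *; auto.
  - apply zpairin_eq in Hbv. destruct (H b v Hbv) as [[H1 H2]|[(c & w & H1 & H2 & H3)|[H1 H2]]].
    + left. rewrite !zemp_eq in *; auto.
    + right; left. exists c, w. rewrite zsc_eq, zpairin_eq, E in *; auto.
    + right; right. rewrite zlim_eq; split; auto. intros z; rewrite (H2 z).
      split; intros (c & w & K); exists c, w; rewrite zpairin_eq in *; auto.
Qed.

Lemma zW_at_kp (a v : M) : zW_at a v <-> hat kp Sw a v.
Proof.
  unfold zW_at, hat. split.
  - intros (H1 & d & f & Hd & Hf & Hr & H). apply zsc_eq in Hd as ->.
    rewrite zfun_kp, zW_rec_kp, zpairin_eq in *. split; eauto.
  - intros (H1 & f & Hf & Hr & H). split; auto. exists (sc a), f.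
    rewrite zsc_eq, zfun_kp, zW_rec_kp, zpairin_eq; auto.
Qed.

Lemma sat_W (s : nat -> M) : satT M s W <-> Wc (s 0).
Proof.
  rewrite tv_W. unfold Wc, hcl.
  split; intros (a & v & H1 & H2); exists a, v; rewrite zW_at_kp in *; auto.
Qed.

(** Written as a set of elements to obtain a total definable operation; its value off the pairs is
    empty. *)
Definition pr1 (x : M) : M := mkc (fun y => exists a b, x = kp a b /\ y ∊ a).
Definition pr2 (x : M) : M := mkc (fun y => exists a b, x = kp a b /\ y ∊ b).

Lemma small_p1 (x : M) : small (fun y => exists a b, x = kp a b /\ y ∊ a).
Proof.
  apply small_sub with (fun y => child y x); [apply small_child|def|].
  intros y (a & b & E & H); exists a, b; auto.
Qed.

Lemma small_p2 (x : M) : small (fun y => exists a b, x = kp a b /\ y ∊ b).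
Proof.
  apply small_sub with (fun y => child y x); [apply small_child|def|].
  intros y (a & b & E & H); exists a, b; auto.
Qed.

Lemma p1_kp a b : pr1 (kp a b) = a.
Proof.
  apply zf_ext. intros z. unfold pr1. rewrite mkc_in by apply small_p1. split; eauto.
  intros (a' & b' & E & H). apply kp_inj in E as [-> ->]; auto.
Qed.

Lemma p2_kp a b : pr2 (kp a b) = b.
Proof.
  apply zf_ext. intros z. unfold pr2. rewrite mkc_in by apply small_p2. split; eauto.
  intros (a' & b' & E & H). apply kp_inj in E as [-> ->]; auto.
Qed.

Lemma def_p1 F : DefT M F -> DefT M (fun s => pr1 (F s)).
Proof.
  apply (defT_sub1 pr1). apply (defT_mkc (fun y s => exists a b, s 0 = kp a b /\ y ∊ a)); [|def].
  intros; apply small_p1.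
Qed.

Lemma def_p2 F : DefT M F -> DefT M (fun s => pr2 (F s)).
Proof.
  apply (defT_sub1 pr2). apply (defT_mkc (fun y s => exists a b, s 0 = kp a b /\ y ∊ b)); [|def].
  intros; apply small_p2.
Qed.

Lemma Wc_eta (x : M) : Wc x -> x = kp (pr1 x) (pr2 x).
Proof. intros H. apply Wc_iff in H as [(a & b & ->) _]. rewrite p1_kp, p2_kp; auto. Qed.

Lemma Wc_p (x y : M) : Wc x -> y ∊ pr1 x \/ y ∊ pr2 x -> Wc y.
Proof. intros H. rewrite (Wc_eta x H) in H. apply Wc_kp; auto. Qed.

Lemma Wc_emp : Wc (kp (emp M) (emp M)).
Proof. apply Wc_kp. intros y [H|H]; destruct (proj1 (in_emp y) H). Qed.

Definition wneq (x y : M) : Prop :=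
  (exists z, z ∊ pr1 x /\ ~ z ∊ pr2 y) \/ (exists z, z ∊ pr1 y /\ ~ z ∊ pr2 x).

Definition WD : TFmodel :=
  Build_TFmodel {x : M | Wc x} (exist _ _ Wc_emp)
    (fun x y => proj1_sig x ∊ pr1 (proj1_sig y))
    (fun x y => ~ proj1_sig x ∊ pr2 (proj1_sig y))
    (fun x y => wneq (proj1_sig x) (proj1_sig y))
    (fun x y H => proj1 (or_comm _ _) H).

Definition wv (x : WD) : M := proj1_sig x.
Lemma wv_W (x : WD) : Wc (wv x). Proof. exact (proj2_sig x). Qed.
Lemma wv_inj (x y : WD) : wv x = wv y -> x = y.
Proof. intros H. apply eq_sig_hprop; [intros; apply proof_irrelevance|auto]. Qed.
Lemma wv_ex x : Wc x -> exists x' : WD, wv x' = x.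
Proof. intros H; exists (exist _ x H); auto. Qed.

Lemma w_in (x y : WD) : x ∊ y <-> wv x ∊ pr1 (wv y).
Proof. reflexivity. Qed.
Lemma w_inQ (x y : WD) : x ∊? y <-> wv x ∊ pr2 (wv y).
Proof. split; [apply NNPP|]. intros H H'; apply H'; auto. Qed.

(** Truth and non-falsity extensions can be prescribed freely among subsets of W. Most axioms of
    BZFC reduce to finding these two sets. *)
Lemma w_mk (P Q : M -> Prop) : small P -> small Q -> (forall y, P y -> Wc y) ->
  (forall y, Q y -> Wc y) ->
  exists x : WD, wv x = kp (mkc P) (mkc Q) /\ iset x (fun y => P (wv y)) (fun y => Q (wv y)).
Proof.
  intros HP HQ H1 H2.
  destruct (wv_ex (kp (mkc P) (mkc Q))) as [x Hx].
  { apply Wc_kp. intros y [H|H]; rewrite mkc_in in H; auto. }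
  exists x; split; auto. intros y. rewrite w_in, w_inQ, Hx, p1_kp, p2_kp, !mkc_in; tauto.
Qed.

Lemma w_p (x : WD) y : y ∊ pr1 (wv x) \/ y ∊ pr2 (wv x) -> exists y' : WD, wv y' = y.
Proof. intros H. apply wv_ex, (Wc_p (wv x)); auto. apply wv_W. Qed.

Lemma w_eq (x y : WD) : x = y <-> pr1 (wv x) = pr1 (wv y) /\ pr2 (wv x) = pr2 (wv y).
Proof.
  split; [intros ->; auto|]. intros [H1 H2]. apply wv_inj.
  rewrite (Wc_eta _ (wv_W x)), (Wc_eta _ (wv_W y)), H1, H2; auto.
Qed.

Lemma pair_W (x c d : M) : Wc x -> (zpair x c d <-> c = pr1 x /\ d = pr2 x).
Proof.
  intros Hx. rewrite zpair_eq. split.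
  - intros ->. rewrite p1_kp, p2_kp; auto.
  - intros [-> ->]. apply Wc_eta; auto.
Qed.

Lemma sat_WT p : forall s : nat -> WD,
  (satT WD s p <-> satT M (fun i => wv (s i)) (W_T p)) /\
  (satF WD s p <-> satT M (fun i => wv (s i)) (W_F p)).
Proof.
  assert (HC : classicalM M) by apply zf_classical.
  assert (EW : forall s : nat -> M, satT M s W <-> Wc (s 0)) by (intros; apply sat_W).
  assert (E : forall (d : WD) s, (fun i => wv (scons d s i)) = scons (wv d) (fun i => wv (s i))).
  { intros; apply functional_extensionality; intros [|i]; reflexivity. }
  assert (Qex : forall (s : nat -> WD) (P : WD -> Prop) q,
    (forall d : WD, P d <-> satT M (fun i => wv (scons d s i)) q) ->
    ((exists d : WD, P d) <-> exists d, satT M (scons d (fun i => wv (s i))) W /\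
      satT M (scons d (fun i => wv (s i))) q)).
  { intros s P q H. split.
    - intros [d Hd]. exists (wv d). rewrite EW. split; [apply wv_W|]. rewrite <- E. apply H; auto.
    - intros (d & Hd & K). apply EW in Hd. cbn in Hd. apply wv_ex in Hd as [d' <-]. exists d'. apply H. rewrite E; auto. }
  assert (Qall : forall (s : nat -> WD) (P : WD -> Prop) q,
    (forall d : WD, P d <-> satT M (fun i => wv (scons d s i)) q) ->
    ((forall d : WD, P d) <-> forall d, satT M (scons d (fun i => wv (s i))) W ->
      satT M (scons d (fun i => wv (s i))) q)).
  { intros s P q H. split.
    - intros K d Hd. apply EW in Hd. cbn in Hd. apply wv_ex in Hd as [d' <-].
      rewrite <- E. apply H; auto.
    - intros K d. apply H. rewrite E. apply K. rewrite EW. apply wv_W. }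
  induction p; intros s; cbn [W_T W_F satT satF].
  - unfold apply2. rewrite !(proj1 (sat_ren M _ _ _)), tv_W_in, tv_W_notin by auto. split.
    + rewrite w_in. split.
      * intros H. exists (pr1 (wv (s n0))), (pr2 (wv (s n0))). rewrite pair_W by apply wv_W; auto.
      * intros (c & d & H & K). rewrite pair_W in H by apply wv_W. destruct H as [-> ->]; auto.
    + split.
      * intros H. exists (pr1 (wv (s n0))), (pr2 (wv (s n0))). rewrite pair_W by apply wv_W; auto.
      * intros (c & d & H & K). rewrite pair_W in H by apply wv_W. destruct H as [-> ->]; auto.
  - unfold apply2. rewrite !(proj1 (sat_ren M _ _ _)), tv_W_neq by auto. split.
    + cbn. split; [intros ->; auto|apply wv_inj].
    + split.
      * intros H. exists (pr1 (wv (s n))), (pr2 (wv (s n))), (pr1 (wv (s n0))), (pr2 (wv (s n0))).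
        rewrite !pair_W by apply wv_W; auto.
      * intros (a & b & c & d & H & H' & K). rewrite pair_W in H, H' by apply wv_W.
        destruct H as [-> ->], H' as [-> ->]; exact K.
  - split; tauto.
  - destruct (IHp s); tauto.
  - destruct (IHp1 s), (IHp2 s); tauto.
  - destruct (IHp1 s), (IHp2 s); tauto.
  - destruct (IHp1 s), (IHp2 s); tauto.
  - split; [apply Qall|apply Qex]; intros d; apply IHp.
  - split; [apply Qex|apply Qall]; intros d; apply IHp.
Qed.

Lemma wscons (d : WD) s : (fun i => wv (scons d s i)) = scons (wv d) (fun i => wv (s i)).
Proof. apply functional_extensionality; intros [|i]; reflexivity. Qed.

Definition ws (s : nat -> WD) : nat -> M := fun i => wv (s i).

Lemma sat_WT1 p (s : nat -> WD) (x : WD) :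
  (satT WD (scons x s) p <-> satT M (scons (wv x) (ws s)) (W_T p)) /\
  (satF WD (scons x s) p <-> satT M (scons (wv x) (ws s)) (W_F p)).
Proof. unfold ws. rewrite <- wscons. apply sat_WT. Qed.

Lemma sat_WT2 p (s : nat -> WD) (x y : WD) :
  satT WD (scons x (scons y s)) p <-> satT M (scons (wv x) (scons (wv y) (ws s))) (W_T p).
Proof. unfold ws. rewrite <- !wscons. apply sat_WT. Qed.

(** The translation [W_T] turns definability in [WD] into definability in [M], so that the schemas
    of [M] apply to predicates stated in [WD]. *)
Lemma def_w1 (R : WD -> Prop) : Def WD (fun s => R (s 0)) ->
  Def M (fun s => exists x, wv x = s 0 /\ R x).
Proof.
  intros H. apply def_formula1 in H as (p & t & H).
  eapply def_iff with (P := fun s => Wc (s 0) /\ satT M (scons (s 0) (ws t)) (W_T p)).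
  - apply def_and; [apply def_Wc; def|apply def_sat1].
  - intros s; split.
    + intros [H1 H2]. apply wv_ex in H1 as [x Hx]. exists x; split; auto.
      apply H, sat_WT1. rewrite Hx; auto.
    + intros (x & <- & Hx). split; [apply wv_W|]. apply sat_WT1, H; auto.
Qed.

Lemma def_w3 (R : WD -> WD -> WD -> Prop) : Def WD (fun s => R (s 0) (s 1) (s 2)) ->
  Def M (fun s => exists x y z, wv x = s 0 /\ wv y = s 1 /\ wv z = s 2 /\ R x y z).
Proof.
  intros H. apply def_formula3 in H as (p & t & H).
  assert (E : forall x y z : WD, R x y z <->
    satT M (scons (wv x) (scons (wv y) (scons (wv z) (ws t)))) (W_T p)).
  { intros. rewrite H. unfold ws. rewrite <- !wscons. apply sat_WT. }
  eapply def_iff with (P := fun s => Wc (s 0) /\ Wc (s 1) /\ Wc (s 2) /\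
    satT M (scons (s 0) (scons (s 1) (scons (s 2) (ws t)))) (W_T p)).
  - repeat (apply def_and; [apply def_Wc; def|]). apply def_sat3.
  - intros s; split.
    + intros (H1 & H2 & H3 & K). apply wv_ex in H1 as [x Hx], H2 as [y Hy], H3 as [z Hz].
      exists x, y, z. rewrite E, Hx, Hy, Hz; auto.
    + intros (x & y & z & <- & <- & <- & K). rewrite <- E. repeat split; auto; apply wv_W.
Qed.

(** * W is a model of BZFC *)

Lemma WD_ext : modelsT WD ax_ext.
Proof.
  apply models_ext. intros x y. split.
  - rewrite w_eq. split.
    + intros [H1 H2] z. rewrite !w_in, !w_inQ, H1, H2. tauto.
    + intros H. split; apply zf_ext; intros z.
      * split; intros Hz; destruct (w_p _ z (or_introl Hz)) as [z' <-]; apply (H z'); auto.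
      * split; intros Hz; destruct (w_p _ z (or_intror Hz)) as [z' <-]; apply w_inQ, (H z'), w_inQ; auto.
  - change (neq WD x y) with (wneq (wv x) (wv y)). unfold wneq. split.
    + intros H z. rewrite !w_in, !w_inQ. split; intros Hz; apply NNPP; intros Hz'; apply H; eauto.
    + intros H [(z & H1 & H2)|(z & H1 & H2)];
        destruct (w_p _ z (or_introl H1)) as [z' <-]; apply H2, w_inQ, H; auto.
Qed.

(** The first component of [u] is filtered by the truth of [p], the second one by its
    non-falsity. *)
Lemma WD_compr p : modelsT WD (ax_compr p).
Proof.
  apply models_compr. intros s u.
  destruct (w_mk (fun y => y ∊ pr1 (wv u) /\ satT M (scons y (ws s)) (W_T p))
    (fun y => y ∊ pr2 (wv u) /\ ~ satT M (scons y (ws s)) (W_F p))) as (x & _ & Hx).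
  - apply small_sub with (fun y => y ∊ pr1 (wv u)); [apply small_in| |tauto].
    apply def_and; [def|apply def_sat1].
  - apply small_sub with (fun y => y ∊ pr2 (wv u)); [apply small_in| |tauto].
    apply def_and; [def|apply def_not, def_sat1].
  - intros y [Hy _]. apply (Wc_p (wv u)); auto. apply wv_W.
  - intros y [Hy _]. apply (Wc_p (wv u)); auto. apply wv_W.
  - exists x; intros y. destruct (Hx y) as [-> ->].
    rewrite w_in, w_inQ, (proj1 (sat_WT1 p s y)), (proj2 (sat_WT1 p s y)). tauto.
Qed.

Lemma WD_superset : modelsT WD ax_superset.
Proof.
  apply models_superset. intros x.
  assert (K : small (fun y => y ∊ pr1 (wv x) \/ y ∊ pr2 (wv x))) by (apply small_or; apply small_in).
  destruct (w_mk _ _ K K) as (c & _ & Hc).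
  - intros y Hy. apply (Wc_p (wv x)); auto. apply wv_W.
  - intros y Hy. apply (Wc_p (wv x)); auto. apply wv_W.
  - exists c; split; intros z; destruct (Hc z) as [-> ->]; [rewrite w_in, w_inQ|]; tauto.
Qed.

Lemma WD_repl p : modelsT WD (ax_repl p).
Proof.
  apply models_repl. intros s [H1 H2] x.
  (* By [H1] the formula is classical, so a single relation yields the images of both components. *)
  pose (R := fun w z => Wc w /\ Wc z /\ satT M (scons w (scons z (ws s))) (W_T p)).
  assert (E : forall w z : WD, R (wv w) (wv z) <-> satT WD (scons w (scons z s)) p).
  { intros w z. rewrite sat_WT2. unfold R. pose proof (wv_W w). pose proof (wv_W z). tauto. }
  assert (D : Def M (fun s => R (s 0) (s 1))).
  { unfold R. apply def_and; [apply def_Wc; def|]. apply def_and; [apply def_Wc; def|]. apply def_sat2. }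
  assert (U : forall w z z', R w z -> R w z' -> z = z').
  { intros w z z' Hz Hz'. pose proof Hz as (K1 & K2 & _). pose proof Hz' as (_ & K3 & _).
    apply wv_ex in K1 as [w' <-], K2 as [y <-], K3 as [y' <-]. apply E in Hz, Hz'.
    destruct (H2 w') as (v & _ & Hv). f_equal. rewrite <- (Hv y), <- (Hv y'); auto. }
  assert (Ex : forall a (z : WD), (forall y, y ∊ a -> exists y' : WD, wv y' = y) ->
    ((exists w, w ∊ a /\ R w (wv z)) <-> exists w : WD, wv w ∊ a /\ satT WD (scons w (scons z s)) p)).
  { intros a z Ha. split.
    - intros (w & Hw & K). destruct (Ha w Hw) as [w' <-]. exists w'. rewrite <- E; auto.
    - intros (w & Hw & K). exists (wv w). rewrite E; auto. }
  destruct (w_mk (fun z => exists w, w ∊ pr1 (wv x) /\ R w z) (fun z => exists w, w ∊ pr2 (wv x) /\ R w z))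
    as (y & _ & Hy).
  - apply small_repl; [apply small_in|exact D|eauto].
  - apply small_repl; [apply small_in|exact D|eauto].
  - intros z (w & _ & _ & Hz & _); auto.
  - intros z (w & _ & _ & Hz & _); auto.
  - exists y; intros z. destruct (Hy z) as [-> ->]. split.
    + apply Ex. intros v Hv. apply (w_p x); auto.
    + rewrite Ex by (intros v Hv; apply (w_p x); auto).
      split; intros (w & Hw & K); exists w; rewrite <- H1, w_inQ in *; auto.
Qed.

Lemma WD_pairing : modelsT WD ax_pairing.
Proof.
  apply models_pairing. intros u v.
  destruct (w_mk _ _ (ws_pair (wv u) (wv v)) (ws_pair (wv u) (wv v))) as (x & _ & Hx);
    try (intros y [->| ->]; apply wv_W).
  exists x. intros y. destruct (Hx y) as [-> ->].
  assert (E : wv y = wv u \/ wv y = wv v <-> y = u \/ y = v); [|tauto].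
  split; (intros [H|H]; [left|right]); subst; auto; apply wv_inj; auto.
Qed.

Lemma WD_power : modelsT WD ax_power.
Proof.
  apply models_power. intros u.
  assert (K : small (fun x => exists a b, zsubset a (pr1 (wv u)) /\ zsubset b (pr2 (wv u)) /\ x = kp a b)).
  { apply (small_prod (fun x => zsubset x (pr1 (wv u))) (fun x => zsubset x (pr2 (wv u)))); apply small_zsub. }
  assert (KW : forall x, (exists a b, zsubset a (pr1 (wv u)) /\ zsubset b (pr2 (wv u)) /\ x = kp a b) -> Wc x).
  { intros x (a & b & Ha & Hb & ->). apply Wc_kp. intros y Hy.
    apply (Wc_p (wv u)); [apply wv_W|]. destruct Hy; auto. }
  destruct (w_mk _ _ K K) as (v & _ & Hv); auto.
  exists v; intros x. destruct (Hv x) as [-> ->].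
  assert (E : (exists a b, zsubset a (pr1 (wv u)) /\ zsubset b (pr2 (wv u)) /\ wv x = kp a b) <-> isub x u); [|tauto].
  split.
  - intros (a & b & Ha & Hb & E) z. rewrite !w_in, !w_inQ, E, p1_kp, p2_kp. auto.
  - intros H. exists (pr1 (wv x)), (pr2 (wv x)). split; [|split; [|apply Wc_eta, wv_W]].
    + intros z Hz. destruct (w_p x z (or_introl Hz)) as [z' <-]. apply (H z'); auto.
    + intros z Hz. destruct (w_p x z (or_intror Hz)) as [z' <-]. apply w_inQ, (H z'), w_inQ; auto.
Qed.

Lemma WD_union : modelsT WD ax_union.
Proof.
  apply models_union. intros u.
  destruct (w_mk (fun y => exists v, y ∊ v /\ exists z, z ∊ pr1 (wv u) /\ v = pr1 z)
    (fun y => exists v, y ∊ v /\ exists z, z ∊ pr2 (wv u) /\ v = pr2 z)) as (x & _ & Hx).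
  - apply small_union. apply (small_img (fun z => z ∊ pr1 (wv u)) pr1); [apply small_in|].
    apply def_p1; def.
  - apply small_union. apply (small_img (fun z => z ∊ pr2 (wv u)) pr2); [apply small_in|].
    apply def_p2; def.
  - intros y (v & Hy & z & Hz & ->). destruct (w_p u z) as [z' <-]; auto.
    destruct (w_p z' y) as [y' <-]; auto. apply wv_W.
  - intros y (v & Hy & z & Hz & ->). destruct (w_p u z) as [z' <-]; auto.
    destruct (w_p z' y) as [y' <-]; auto. apply wv_W.
  - exists x; intros y. destruct (Hx y) as [-> ->]. split.
    + split.
      * intros (v & Hy & z & Hz & ->). destruct (w_p u z) as [z' <-]; auto. exists z'; auto.
      * intros (z & Hy & Hz). exists (pr1 (wv z)); split; auto. exists (wv z); auto.
    + split.
      * intros (v & Hy & z & Hz & ->). destruct (w_p u z) as [z' <-]; auto.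
        exists z'. rewrite !w_inQ; auto.
      * intros (z & Hy & Hz). rewrite w_inQ in *. exists (pr2 (wv z)); split; auto. exists (wv z); auto.
Qed.

Lemma WD_foundation p : modelsT WD (ax_foundation p).
Proof.
  apply models_foundation. intros s H.
  assert (K : forall x, Wc x -> satT M (scons x (ws s)) (W_T p)).
  { apply Wc_ind; [apply def_sat1|]. intros a b IH.
    destruct (wv_ex (kp a b)) as [x Hx]; [apply Wc_kp; intros y Hy; apply IH; auto|].
    rewrite <- Hx. apply sat_WT1, H. intros y. rewrite w_in, w_inQ, Hx, p1_kp, p2_kp.
    intros Hy. apply sat_WT1, IH; auto. }
  intros u. apply sat_WT1, K, wv_W.
Qed.

Lemma WD_acla : modelsT WD ax_acla.
Proof.
  apply models_acla.
  assert (K : forall y, y = wv (point WD) -> Wc y) by (intros y ->; apply wv_W).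
  split.
  (* In ({w}, ∅) the membership of w is both true and false; in (∅, {w}), used for the other half,
     it is neither. *)
  - destruct (w_mk _ _ (small_eq (wv (point WD))) small_false) as (x & _ & Hx); auto; try tauto.
    exists x. intros H. destruct (Hx (point WD)) as [E1 E2]. specialize (H (point WD)). tauto.
  - destruct (w_mk _ _ small_false (small_eq (wv (point WD)))) as (x & _ & Hx); auto; try tauto.
    exists x. intros H. destruct (Hx (point WD)) as [E1 E2]. specialize (H (point WD)). tauto.
Qed.

Lemma J_step_zf (x y : M) : J x y <-> y = kp (jimg (fun w => w ∊ x)) (jimg (fun w => w ∊ x)).
Proof.
  rewrite J_iff. replace (jimg (fun w => w ∊? x)) with (jimg (fun w => w ∊ x)); [tauto|].
  apply zf_ext. intros z. rewrite !in_jimg by (apply small_in || apply small_inQ).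
  split; intros (w & Hw & H); exists w; split; auto; apply inQ_classical; auto; apply zf_classical.
Qed.

Lemma J_Wc (x : M) : forall y, J x y -> Wc y.
Proof.
  revert x. zf_induction.
  { apply def_all; dn. apply def_imp; [def|apply def_Wc; def]. }
  intros x IH y Hy. apply J_step_zf in Hy as ->. apply Wc_kp.
  intros z Hz. assert (Hz' : z ∊ jimg (fun w => w ∊ x)) by tauto.
  apply in_jimg in Hz' as (w & Hw & K); [eauto|apply small_in].
Qed.

(* The image of an inductive set under the embedding [J] of V is inductive in the sense of W. *)
Lemma WD_infinity : (exists I : M, emp M ∊ I /\ forall y, y ∊ I -> sc y ∊ I) -> modelsT WD ax_infinity.
Proof.
  intros (I & HI0 & HIS). apply models_infinity.
  assert (K := small_J (fun w => w ∊ I) (small_in I)).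
  assert (KW : forall z, (exists w, w ∊ I /\ J w z) -> Wc z) by (intros z (w & _ & H); eapply J_Wc; eauto).
  destruct (w_mk _ _ K K KW KW) as (X & _ & HX).
  exists X; split.
  - destruct (J_tot (emp M)) as [e He]. destruct (wv_ex e) as [e' <-]; [eapply J_Wc; eauto|].
    exists e'. split; [|apply HX; eauto].
    assert (L : forall z : M, ~ z ∊ jimg (fun w => w ∊ emp M)).
    { intros z Hz. apply in_jimg in Hz as (w & Hw & _); [|apply small_in]. apply (in_emp w); auto. }
    apply J_step_zf in He. intros y. rewrite w_in, w_inQ, He, p1_kp, p2_kp.
    split; split; try tauto; intros H; eapply L; eauto.
  - intros y Hy. apply HX in Hy as (w & Hw & HJ).
    destruct (J_tot (sc w)) as [t Ht]. destruct (wv_ex t) as [t' <-]; [eapply J_Wc; eauto|].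
    exists t'. split; [|apply HX; eauto].
    assert (L : forall z : WD, wv z ∊ jimg (fun w' => w' ∊ sc w) <-> wv z ∊ jimg (fun w' => w' ∊ w) \/ z = y).
    { intros z. rewrite !in_jimg by apply small_in. split.
      - intros (v & Hv & Hz). apply in_sc in Hv as [Hv| ->]; [left; eauto|].
        right. apply wv_inj. eapply J_fun; eauto.
      - intros [(v & Hv & Hz)| ->]; [exists v|exists w]; rewrite in_sc; auto. }
    apply J_step_zf in Ht. apply J_step_zf in HJ. intros z.
    rewrite !w_in, !w_inQ, Ht, HJ, !p1_kp, !p2_kp. rewrite L; tauto.
Qed.
End W.

(** * Choice in W *)

Definition BZFCmodel (M : TFmodel) : Prop := forall q, BZFC q -> modelsT M q.

Lemma BZFCmodel_BZ M : BZFCmodel M -> BZ M.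
Proof. intros H; split; intros; apply H; unfold BZFC; auto; left; constructor. Qed.

Lemma BZFCmodel_choice M : BZFCmodel M -> modelsT M ax_choice.
Proof. intros H; apply H; left; exact PZFC_choice. Qed.

Section WBZ.
Context {M : TFmodel} {HZ : ZF M}.
Hypothesis HM : ZFCmodel M.

Lemma WD_BZ : BZ (WD (M := M)).
Proof.
  split; [apply WD_ext|apply WD_compr|apply WD_superset|apply WD_repl|apply WD_pairing|
    apply WD_power|apply WD_union| |apply WD_foundation|apply WD_acla].
  apply WD_infinity. exact (ZFC_infinity_set M HM).
Qed.

Local Existing Instance WD_BZ.
Local Notation V := (WD (M := M)).

(** Choice in [M] is applied to the nonempty sets x^! for x in [u], that is, to the first
    components; its graph is then rebuilt from BS4 pairs of W as a classical set, with equal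
    components. *)
Lemma WD_choice : modelsT V ax_choice.
Proof.
  apply models_choice. intros u Cu Hu.
  assert (KU : small (fun v => exists x, x ∊ pr1 (wv u) /\ v = pr1 x)).
  { apply (small_img (fun x => x ∊ pr1 (wv u)) pr1); [apply small_in|apply def_p1; def]. }
  destruct (ZFC_choice_set M HM (mkc (fun v => exists x, x ∊ pr1 (wv u) /\ v = pr1 x))) as (f & Hf & Hch).
  { intros v Hv. rewrite mkc_in in Hv by auto. destruct Hv as (x & Hx & ->).
    destruct (w_p u x (or_introl Hx)) as [x' <-]. destruct (Hu x' Hx) as [y Hy]. exists (wv y); auto. }
  pose (h := fun x y : M => kp (pr1 x) y ∊ f).
  assert (Dh : Def M (fun s => h (s 0) (s 1))).
  { unfold h. apply def_inT; [|def]. apply defT_kp; [apply def_p1|]; def. }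
  assert (Hh : forall x y y', h x y -> h x y' -> y = y').
  { intros x y y' H H'. apply (proj2 (proj2 Hf) (pr1 x)). split; apply zpairin_eq; auto. }
  assert (Eh : forall x : V, x ∊ u -> exists y : V, h (wv x) (wv y) /\ y ∊ x).
  { intros x Hx. destruct (Hch (pr1 (wv x))) as (y & H1 & H2).
    - apply (mkc_in (fun v => exists x, x ∊ pr1 (wv u) /\ v = pr1 x)); auto. exists (wv x); auto.
    - destruct (w_p x y (or_introl H2)) as [y' <-]. exists y'. split; auto. apply zpairin_eq; auto. }
  (* The pairing relation of W seen as a relation on [M], definable there by [def_w3], so that
     Replacement in [M] can form the graph. *)
  pose (T := fun q x y : M => exists p x' y' : V, wv p = q /\ wv x' = x /\ wv y' = y /\ ipair p x' y').
  assert (DT : Def M (fun s => T (s 0) (s 1) (s 2))).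
  { apply (def_w3 (fun p x y => ipair p x y)). def. }
  assert (KF : small (fun q => exists x, x ∊ pr1 (wv u) /\ exists y, T q x y /\ h x y)).
  { apply (small_repl (fun x => x ∊ pr1 (wv u)) (fun x q => exists y, T q x y /\ h x y)).
    - apply small_in.
    - apply def_ex; dn. apply def_and.
      + apply (def_sub3 T); auto; def.
      + apply (def_sub2 h); auto; def.
    - intros x q q' _ (y & (p & x1 & y1 & <- & <- & <- & H1) & H2) (y' & (p' & x2 & y2 & <- & E & <- & H3) & H4).
      apply wv_inj in E as ->. f_equal. assert (E := Hh _ _ _ H2 H4). apply wv_inj in E as <-.
      eapply ipair_fun; eauto. }
  assert (KB : small (fun y => exists x, x ∊ pr1 (wv u) /\ (Wc y /\ h x y))).
  { apply (small_repl (fun x => x ∊ pr1 (wv u)) (fun x y => Wc y /\ h x y)).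
    - apply small_in.
    - apply def_and; [apply def_Wc; def|exact Dh].
    - intros x y y' _ [_ H] [_ H']. eapply Hh; eauto. }
  destruct (w_mk _ _ KF KF) as (F & _ & HF);
    [intros q (x & _ & y & (p & _ & _ & <- & _) & _); apply wv_W..|].
  destruct (w_mk _ _ KB KB) as (B & _ & HB); [intros y (x & _ & Hy & _); auto..|].
  assert (CF : cl F) by (intros z; destruct (HF z) as [-> ->]; tauto).
  assert (CB : cl B) by (intros z; destruct (HB z) as [-> ->]; tauto).
  assert (EF : forall p, p ∊ F <-> exists x y : V, x ∊ u /\ h (wv x) (wv y) /\ ipair p x y).
  { intros p. rewrite (proj1 (HF p)). split.
    - intros (x & Hx & y & (p' & x1 & y1 & E & <- & <- & H1) & H2). apply wv_inj in E as ->.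
      exists x1, y1; auto.
    - intros (x & y & Hx & H & Hp). exists (wv x); split; auto. exists (wv y); split; auto.
      exists p, x, y; auto. }
  assert (EB : forall y : V, y ∊ B <-> exists x : V, x ∊ u /\ h (wv x) (wv y)).
  { intros y. rewrite (proj1 (HB y)). split.
    - intros (x & Hx & _ & H). destruct (w_p u x (or_introl Hx)) as [x' <-]. exists x'; auto.
    - intros (x & Hx & H). exists (wv x). split; auto. split; auto. apply wv_W. }
  assert (EP : forall x y : V, ipair_in x y F <-> x ∊ u /\ h (wv x) (wv y)).
  { intros x y; split.
    - intros (p & Hp & H). apply EF in H as (x' & y' & Hx & H & Hp').
      destruct (ipair_inj _ _ _ _ _ Hp Hp') as [-> ->]; auto.
    - intros [Hx H]. destruct (ipair_ex x y) as [p Hp]. exists p; split; auto. apply EF; eauto. }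
  exists F; split.
  - exists B. split; [exact Cu|]. split; [exact CF|].
    assert (L : forall z, z ∊ F -> exists x y, ipair z x y /\ x ∊ u /\ y ∊ B).
    { intros z Hz. apply EF in Hz as (x & y & Hx & H & Hp). exists x, y. rewrite EB; eauto. }
    split; [|split].
    + intros z; split; [apply L|]. intros Hz. apply CF, L in Hz as (x & y & H1 & H2 & H3).
      exists x, y. split; auto. split; [apply Cu|apply CB]; auto.
    + assert (D : forall x, x ∊ u <-> exists y, ipair_in x y F).
      { intros x; split.
        - intros Hx. destruct (Eh x Hx) as (y & Hy & _). exists y. apply EP; auto.
        - intros [y Hy]. apply EP in Hy as []; auto. }
      intros x. split; [apply D|]. rewrite <- (Cu x), D.
      split; intros [y Hy]; exists y; apply (ipair_inQ_iff _ _ _ CF); auto.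
    + intros x y z [Hy Hz]. apply EP in Hy as [_ Hy], Hz as [_ Hz]. apply wv_inj. eapply Hh; eauto.
  - intros x Hx. destruct (Eh x Hx) as (y & Hy & Hyx). exists y. rewrite EP; auto.
Qed.

Lemma WD_BZFC : BZFCmodel V.
Proof.
  intros q [H| ->]; [destruct H|apply bz_acla];
    [apply bz_ext|apply bz_compr|apply bz_superset|apply bz_repl|apply bz_pairing|apply bz_power
    |apply bz_union|apply bz_infinity|apply bz_foundation|apply WD_choice].
Qed.
End WBZ.

(** * The isomorphism of V and HCL^W *)

Section Iso1.
Context {M : TFmodel} {HZ : ZF M}.
Hypothesis HM : ZFCmodel M.
#[local] Instance WD_BZ' : BZ (WD (M := M)) := WD_BZ HM.
Local Notation V := (WD (M := M)).

Lemma def_HCW : Def M (fun s => exists y : V, wv y = s 0 /\ HC y).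
Proof. apply def_w1. def. Qed.

(** Under two-valued membership both components of the value are the same set, hence the value is
    classical in W, and so are its members by induction. *)
Lemma J_HCW (x : M) : forall y, J x y -> exists y' : V, wv y' = y /\ HC y'.
Proof.
  revert x. zf_induction.
  { apply def_all; dn. apply def_imp; [def|].
    apply (def_sub1 (fun y => exists y' : V, wv y' = y /\ HC y')); [apply def_HCW|def]. }
  intros x IH y Hy. destruct (wv_ex y (J_Wc x y Hy)) as [y' <-].
  exists y'; split; auto. apply J_step_zf in Hy. apply HC_iff. split.
  - intros z. rewrite w_in, w_inQ, Hy, p1_kp, p2_kp. tauto.
  - intros z. rewrite w_in, Hy, p1_kp. intros Hz. apply in_jimg in Hz as (w & Hw & K); [|apply small_in].
    destruct (IH w Hw _ K) as (z' & E & H). apply wv_inj in E as <-; auto.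
Qed.

Lemma HCW_J (y : V) : HC y -> exists x, J x (wv y).
Proof.
  intros H. assert (K : exists y' : V, wv y' = wv y /\ HC y') by eauto.
  revert K. generalize (wv_W y). generalize (wv y). clear y H.
  match goal with |- forall x, Wc x -> @?P x => apply (Wc_ind P) end.
  { apply def_imp; [|def].
    apply (def_sub1 (fun y => exists y' : V, wv y' = y /\ HC y')); [apply def_HCW|def]. }
  intros a b IH (y & Hy & HCy). apply HC_iff in HCy as [Cy HCy].
  (* Being classical in the sense of W means that the two components coincide. *)
  assert (E : a = b).
  { apply zf_ext. intros z.
    split; intros Hz; (destruct (wv_ex z) as [z' <-]; [apply IH; auto|]);
      specialize (Cy z'); rewrite w_in, w_inQ, Hy, p1_kp, p2_kp in Cy; apply Cy; auto. }
  subst b.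
  (* The preimage of (a, a) is the set of preimages of the elements of a, which Replacement provides
     because [J] is injective. *)
  assert (K : small (fun x => exists z, z ∊ a /\ J x z)).
  { apply (small_repl (fun z => z ∊ a) (fun z x => J x z)); [apply small_in|def|].
    intros; eapply J_inj; eauto. }
  exists (mkc (fun x => exists z, z ∊ a /\ J x z)). apply J_step_zf.
  assert (Ea : a = jimg (fun w => w ∊ mkc (fun x => exists z, z ∊ a /\ J x z))).
  { apply zf_ext. intros z. rewrite in_jimg by apply small_in. split.
    - intros Hz. destruct (IH z) as [_ [x Hx]]; auto.
      + destruct (wv_ex z) as [z' <-]; [apply IH; auto|]. exists z'; split; auto.
        apply HCy. rewrite w_in, Hy, p1_kp; auto.
      + exists x. rewrite mkc_in by auto. eauto.
    - intros (w & Hw & Hz). rewrite mkc_in in Hw by auto. destruct Hw as (z' & Hz' & K').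
      rewrite (J_fun w z z'); auto. }
  rewrite <- Ea; auto.
Qed.

Lemma J_rel1 (x y : M) (u v : V) : J x (wv u) -> J y (wv v) ->
  (x ∊ y <-> wv u ∊ pr1 (wv v)) /\ (x ∊ y <-> wv u ∊ pr2 (wv v)) /\
  (x = y <-> u = v) /\ (x <> y <-> wneq (wv u) (wv v)).
Proof.
  intros Hx Hy. pose proof Hx as Hx'. pose proof Hy as Hy'.
  apply J_step_zf in Hx', Hy'.
  assert (E : forall a b, wv b = kp (jimg (fun w => w ∊ a)) (jimg (fun w => w ∊ a)) ->
    pr1 (wv b) = jimg (fun w => w ∊ a) /\ pr2 (wv b) = jimg (fun w => w ∊ a)).
  { intros a b ->. rewrite p1_kp, p2_kp; auto. }
  destruct (E _ _ Hx') as [U1 U2]. destruct (E _ _ Hy') as [V1 V2].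
  unfold wneq. rewrite U1, U2, V1, V2.
  assert (L : forall w a z : M, J w z -> (z ∊ jimg (fun w => w ∊ a) <-> w ∊ a)).
  { intros w a z H. apply (J_jimg (fun w => w ∊ a) w z); [apply small_in|auto]. }
  split; [|split; [|split]].
  - symmetry; apply L; auto.
  - symmetry; apply L; auto.
  - split.
    + intros ->. apply wv_inj. eapply J_fun; eauto.
    + intros ->. eapply J_inj; eauto.
  - split.
    + intros H. apply NNPP; intros N. apply H. apply zf_ext. intros w.
      destruct (J_tot w) as [z Hz].
      rewrite <- (L w x z Hz), <- (L w y z Hz).
      split; intros K; apply NNPP; intros K'; apply N; eauto.
    + intros [(z & H1 & H2)|(z & H1 & H2)] ->; auto.
Qed.
End Iso1.

(** * The isomorphism of V and W^HCL *)

Section Iso2.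
Context {M : TFmodel} {HB : BZ M}.
Hypothesis Hch : modelsT M ax_choice.
Local Notation N := (HCm M).
#[local] Instance N_ZF' : ZF N := N_ZF Hch.
Local Notation V := (WD (M := N)).

Definition WHC (y : M) : Prop := exists y' : N, val y' = y /\ Wc y'.

Lemma WHC_kp (a b : M) : HC a -> HC b -> (forall y, y ∊ a \/ y ∊ b -> WHC y) -> WHC (kp a b).
Proof.
  intros Ha Hb H. apply val_ex in Ha as [a' <-], Hb as [b' <-].
  exists (kp a' b'). split; [apply (val_kp Hch)|]. apply Wc_kp. intros y Hy.
  destruct (H (val y)) as (y' & E & K); auto. apply val_inj in E as <-; auto.
Qed.

Lemma WHC_kp_inv (y : M) : WHC y -> exists a b, y = kp a b /\ HC a /\ HC b /\
  forall z, z ∊ a \/ z ∊ b -> WHC z.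
Proof.
  intros (y' & <- & H). pose proof (proj1 (Wc_iff y') H) as [(a & b & ->) _].
  exists (val a), (val b). split; [apply (val_kp Hch)|]. split; [apply val_HC|]. split; [apply val_HC|].
  rewrite Wc_kp in H. intros z Hz.
  assert (Hz' : HC z) by (destruct Hz as [Hz|Hz]; [apply (HC_mem a)|apply (HC_mem b)]; auto).
  apply val_ex in Hz' as [z' <-]. exists z'; split; auto.
Qed.

(** [Wc] is a predicate on [N]. For inductions in [M] it is expressed by the formula [W] relativized
    to [HC], with ∅ as the value of all variables but the first. *)
Lemma def_WHC : Def M (fun s => WHC (s 0)).
Proof.
  assert (D : Def M (fun s => HC (s 0) /\ rsat HC (scons (s 0) (fun _ => emp M)) W)).
  { apply def_and; [def|].
    eapply def_iff; [apply (def_rsat HC W) with (r := fun i => match i with 0 => inl 0 | S j => inr (emp M) end); def|].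
    intros e; cbv beta. match goal with |- rsat HC ?a _ <-> rsat HC ?b _ => replace b with a; [reflexivity|] end.
    apply functional_extensionality; intros [|i]; reflexivity. }
  eapply def_iff; [exact D|]. intros s; cbv beta. unfold WHC.
  assert (E : forall y : N, rsat HC (scons (val y) (fun _ => emp M)) W <-> Wc y).
  { intros y. rewrite <- (sat_W (scons y (fun _ => point N))), rsat_N.
    match goal with |- rsat HC ?a _ <-> rsat HC ?b _ => replace b with a; [reflexivity|] end.
    apply functional_extensionality; intros [|i]; reflexivity. }
  split.
  - intros [H K]. apply val_ex in H as [y Hy]. exists y. rewrite <- Hy, E in K. auto.
  - intros (y & <- & Hy). rewrite E. split; auto. apply val_HC.
Qed.

Lemma WHC_HC (y : M) : WHC y -> HC y.
Proof. intros (y' & <- & _). apply val_HC. Qed.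

Lemma J_WHC (x : M) : forall y, J x y -> WHC y.
Proof.
  revert x. ws_induction.
  { apply def_all; dn. apply def_imp; [def|]. apply (def_sub1 WHC); [apply def_WHC|def]. }
  intros x IH y Hy. apply J_iff in Hy as ->.
  assert (K1 : forall z, z ∊ jimg (fun w => w ∊ x) -> WHC z).
  { intros z Hz. apply in_jimg in Hz as (w & Hw & K); [|apply small_in]. apply (IH w); auto. left; auto. }
  assert (K2 : forall z, z ∊ jimg (fun w => w ∊? x) -> WHC z).
  { intros z Hz. apply in_jimg in Hz as (w & Hw & K); [|apply small_inQ]. apply (IH w); auto. right; auto. }
  apply WHC_kp.
  - apply HC_iff; split; [apply mkc_cl, small_J, small_in|]. intros z Hz; apply WHC_HC; auto.
  - apply HC_iff; split; [apply mkc_cl, small_J, small_inQ|]. intros z Hz; apply WHC_HC; auto.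
  - intros z [Hz|Hz]; auto.
Qed.

(* Both components of a Kuratowski pair have their elements three membership steps below it. *)
Lemma mem3_ind (P : M -> Prop) : Def M (fun s => P (s 0)) ->
  (forall x, (forall v u t, v ∊ x -> u ∊ v -> t ∊ u -> P t) -> P x) -> forall x, P x.
Proof.
  intros HP IH.
  assert (K : forall x, P x /\ (forall v, v ∊ x -> P v) /\ (forall v u, v ∊ x -> u ∊ v -> P u)).
  { ws_induction.
    - apply def_and; [exact HP|]. apply def_and.
      + apply def_all; dn. apply def_imp; [def|]. apply (def_sub1 P); [exact HP|def].
      + repeat (apply def_all; dn). apply def_imp; [def|]. apply def_imp; [def|].
        apply (def_sub1 P); [exact HP|def].
    - intros x H. split; [|split].
      + apply IH. intros v u t Hv Hu Ht. apply (proj2 (proj2 (H v (or_introl Hv))) u); auto.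
      + intros v Hv. exact (proj1 (H v (or_introl Hv))).
      + intros v u Hv Hu. apply (proj1 (proj2 (H v (or_introl Hv)))); auto. }
  intros x; apply K.
Qed.

(** Surjectivity: given preimages for the elements of both components, ACLA, through [bz_full],
    produces a set whose two extensions are these two independent collections. *)
Lemma WHC_J (y : M) : WHC y -> exists x, J x y.
Proof.
  revert y. match goal with |- forall x, @?P x => apply (mem3_ind P) end.
  { apply def_imp; [apply (def_sub1 WHC); [apply def_WHC|def]|def]. }
  intros y IH Hy. apply WHC_kp_inv in Hy as (a & b & -> & Ha & Hb & H).
  assert (IH' : forall z, z ∊ a \/ z ∊ b -> exists x, J x z).
  (* The chain is z ∊ c ∊ {a,b} ∊ ⟨a,b⟩, where c is whichever of a and b contains z. *)
  { intros z Hz. apply (IH (upr a b) (if excluded_middle_informative (z ∊ a) then a else b)); auto.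
    - apply in_kp; auto.
    - apply in_upr. destruct (excluded_middle_informative _); auto.
    - destruct (excluded_middle_informative _); auto. tauto. }
  assert (K : forall c : M, small (fun x : M => exists z, z ∊ c /\ J x z)).
  { intros c. apply (small_repl (fun z => z ∊ c) (fun z x => J x z)); [apply small_in|def|].
    intros; eapply J_inj; eauto. }
  destruct (bz_full _ _ (K a) (K b)) as [x Hx].
  exists x. apply J_iff.
  assert (E : forall (c : M) (P : M -> Prop), cl c -> small P -> (forall z, z ∊ c -> exists x, J x z) ->
    (forall w, P w <-> exists z, z ∊ c /\ J w z) -> c = jimg P).
  { intros c P Cc HP Hc H'. apply cl_ext; [auto|apply mkc_cl, small_J; auto|].
    intros z. rewrite in_jimg by auto. split.
    - intros Hz. destruct (Hc z Hz) as [w Hw]. exists w. rewrite H'. eauto.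
    - intros (w & Hw & Hz). apply H' in Hw as (z' & Hz' & K'). rewrite (J_fun w z z'); auto. }
  rewrite <- (E a (fun w => w ∊ x)), <- (E b (fun w => w ∊? x)); auto.
  - apply HC_cl; auto.
  - apply small_inQ.
  - intros w; apply Hx.
  - apply HC_cl; auto.
  - apply small_in.
  - intros w; apply Hx.
Qed.

Lemma J_rel2 (x y : M) (a b c d : M) : J x (kp a b) -> J y (kp c d) ->
  (x ∊ y <-> kp a b ∊ c) /\ (x ∊? y <-> kp a b ∊ d) /\
  (x = y <-> kp a b = kp c d) /\
  (neq M x y <-> (exists z, z ∊ a /\ ~ z ∊ d) \/ (exists z, z ∊ c /\ ~ z ∊ b)).
Proof.
  intros Hx Hy. pose proof Hx as Hx'. pose proof Hy as Hy'.
  apply J_iff, kp_inj in Hx' as [-> ->], Hy' as [-> ->].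
  assert (L : forall (P : M -> Prop) (w z : M), small P -> J w z -> (z ∊ jimg P <-> P w)).
  { intros P w z HP H. apply (J_jimg P w z); auto. }
  split; [|split; [|split]].
  - symmetry; apply (L (fun w => w ∊ y)); auto. apply small_in.
  - symmetry; apply (L (fun w => w ∊? y)); auto. apply small_inQ.
  - split; [intros ->; auto|]. intros E. rewrite <- E in Hy. eapply J_inj; eauto.
  - rewrite bz_neq.
    assert (A : forall w z, J w z ->
      (z ∊ jimg (fun w => w ∊ x) <-> w ∊ x) /\ (z ∊ jimg (fun w => w ∊? x) <-> w ∊? x) /\
      (z ∊ jimg (fun w => w ∊ y) <-> w ∊ y) /\ (z ∊ jimg (fun w => w ∊? y) <-> w ∊? y)).
    { intros w z Hz. refine (conj (L _ w z (small_in x) Hz) (conj (L _ w z (small_inQ x) Hz) (conj (L _ w z (small_in y) Hz) (L _ w z (small_inQ y) Hz)))). }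
    split.
    + intros (w & Hw). destruct (J_tot w) as [z Hz]. destruct (A w z Hz) as (A1 & A2 & A3 & A4).
      destruct Hw; [left|right]; exists z; tauto.
    + intros [(z & H1 & H2)|(z & H1 & H2)]; pose proof H1 as H1';
        apply in_jimg in H1' as (w & Hw & Hz); try apply small_in; exists w;
        destruct (A w z Hz) as (A1 & A2 & A3 & A4); [left|right]; (split; [auto|]);
        apply NNPP; tauto.
Qed.
End Iso2.

(** * Free variables *)

Lemma fvb_ren p : forall r n, (forall i, i < fvb p -> r i < n) -> fvb (ren r p) <= n.
Proof.
  induction p; cbn; intros r m H.
  1,2: specialize (H n) as H1; specialize (H n0) as H2; lia.
  - lia.
  - apply IHp; auto.
  - apply Nat.max_lub; [apply IHp1|apply IHp2]; intros; apply H; lia.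
  - apply Nat.max_lub; [apply IHp1|apply IHp2]; intros; apply H; lia.
  - apply Nat.max_lub; [apply IHp1|apply IHp2]; intros; apply H; lia.
  - enough (fvb (ren (up r) p) <= S m) by lia. apply IHp.
    intros [|i] Hi; cbn; [lia|]. enough (r i < m) by lia. apply H; lia.
  - enough (fvb (ren (up r) p) <= S m) by lia. apply IHp.
    intros [|i] Hi; cbn; [lia|]. enough (r i < m) by lia. apply H; lia.
Qed.

Lemma fvb_W : fvb W <= 1.
Proof. vm_compute. lia. Qed.

Lemma fvb_HCL : fvb HCL <= 1.
Proof. vm_compute. lia. Qed.

Lemma fvb_apply2 q i j : fvb q <= 2 -> fvb (apply2 q i j) <= Nat.max (S i) (S j).
Proof. intros H; apply fvb_ren. intros [|[|k]] Hk; lia. Qed.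

Lemma fvb_WT p : fvb (W_T p) <= fvb p /\ fvb (W_F p) <= fvb p.
Proof.
  pose proof fvb_W.
  induction p; cbn [W_T W_F fvb]; try (split; lia).
  - split; apply fvb_apply2; vm_compute; lia.
  - split; apply fvb_apply2; vm_compute; lia.
Qed.

Lemma fvb_HCL_rel p : fvb (HCL_rel p) <= fvb p.
Proof. pose proof fvb_HCL. induction p; cbn [HCL_rel fvb]; lia. Qed.

(** * Isomorphic structures satisfy the same formulas *)

(** The isomorphism is a relation that is total and onto; its clause for = makes it single-valued
    and injective. Both truth and falsity are carried, as ∼ exchanges them. *)
Lemma sat_iso (M N : TFmodel) (R : M -> N -> Prop) :
  (forall x, exists y, R x y) -> (forall y, exists x, R x y) ->
  (forall x y u v, R x u -> R y v -> (x ∊ y <-> u ∊ v) /\ (inF M x y <-> inF N u v) /\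
    (x = y <-> u = v) /\ (neq M x y <-> neq N u v)) ->
  forall p s s', (forall i, R (s i) (s' i)) ->
  (satT M s p <-> satT N s' p) /\ (satF M s p <-> satF N s' p).
Proof.
  intros H1 H2 H.
  assert (K : forall x y s s', R x y -> (forall i, R (s i) (s' i)) ->
    forall i, R (scons x s i) (scons y s' i)) by (intros x y s s' ? ? [|i]; cbn; auto).
  assert (Qall : forall (P : M -> Prop) (P' : N -> Prop), (forall x y, R x y -> (P x <-> P' y)) ->
    ((forall x, P x) <-> forall y, P' y)).
  { intros P P' HP; split; intros HA; [intros y; destruct (H2 y) as [x Hx]
                                     | intros x; destruct (H1 x) as [y Hx]]; apply (HP x y Hx); auto. }
  assert (Qex : forall (P : M -> Prop) (P' : N -> Prop), (forall x y, R x y -> (P x <-> P' y)) ->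
    ((exists x, P x) <-> exists y, P' y)).
  { intros P P' HP; split; [intros [x HA]; destruct (H1 x) as [y Hx]; exists y
                           |intros [y HA]; destruct (H2 y) as [x Hx]; exists x]; apply (HP x y Hx); auto. }
  induction p; intros s s' Hs; cbn [satT satF].
  - destruct (H _ _ _ _ (Hs n) (Hs n0)) as (A & B & C & D); tauto.
  - destruct (H _ _ _ _ (Hs n) (Hs n0)) as (A & B & C & D); tauto.
  - tauto.
  - destruct (IHp s s' Hs); tauto.
  - destruct (IHp1 s s' Hs), (IHp2 s s' Hs); tauto.
  - destruct (IHp1 s s' Hs), (IHp2 s s' Hs); tauto.
  - destruct (IHp1 s s' Hs), (IHp2 s s' Hs); tauto.
  - split; [apply Qall|apply Qex]; intros x y Hxy; apply IHp; auto.
  - split; [apply Qex|apply Qall]; intros x y Hxy; apply IHp; auto.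
Qed.

Lemma class_iso_intro (M : TFmodel) j c rin rnotin req rneq :
  (forall s : nat -> M,
    let Jp x y := satT M (scons x (scons y s)) j in
    let Cp y := satT M (scons y s) c in
    let Rp r u v := satT M (scons u (scons v s)) r in
    (forall x y, satF M (scons x (scons y s)) j <-> ~ Jp x y) /\
    (forall x, exists y, Jp x y) /\
    (forall x y z, Jp x y -> Jp x z -> y = z) /\
    (forall x y, Jp x y -> Cp y) /\
    (forall x x' y, Jp x y -> Jp x' y -> x = x') /\
    (forall y, Cp y -> exists x, Jp x y) /\
    (forall x y u v, Jp x u -> Jp y v -> (x ∊ y <-> Rp rin u v) /\ (inF M x y <-> Rp rnotin u v) /\
       (x = y <-> Rp req u v) /\ (neq M x y <-> Rp rneq u v))) ->
  modelsT M (class_iso j c rin rnotin req rneq).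
Proof.
  intros H. unfold class_iso. apply models_axiom. intros s.
  eapply (fun E => proj2 (evT _ _ _ _ _ E (iff_refl _))); [evs|].
  destruct (H s) as (H1 & H2 & H3 & H4 & H5 & H6 & H7). cbv zeta in *. cbn beta in *.
  split; [|split; [|split; [|split; [|split]]]].
  - intros x y. rewrite (H1 x y). split; [tauto|apply NNPP].
  - intros x. destruct (H2 x) as [y Hy]. exists y; split; auto. intros z Hz. eapply H3; eauto.
  - intros x y Hxy. eapply H4; eauto.
  - intros x x' y [K K']. eapply H5; eauto.
  - intros y Hy. apply H6; auto.
  - intros x y u v [K K']. destruct (H7 x y u v K K') as (A & B & C & D).
    split; [exact A|]. split; [|split; [exact C|]].
    + rewrite <- B. split; [apply NNPP|tauto].
    + rewrite <- D. split; [apply NNPP|tauto].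
Qed.

(** * Formulas defining the two isomorphisms *)

Local Open Scope sform_scope.

(* The graph of [x |-> (j[x], j[x])], in ZFC *)
Definition j_ZFC : form := class2 (fun x y => ∃ f, zpair_in x y f ∧
  ∀ u v, zpair_in u v f → ∃ a b, zis_pair v a b ∧
    (∀ z, z ∈ a → ∃ w, w ∈ u ∧ zpair_in w z f) ∧ (∀ w, w ∈ u → ∃ z, z ∈ a ∧ zpair_in w z f) ∧
    (∀ z, z ∈ b → ∃ w, w ∈ u ∧ zpair_in w z f) ∧ (∀ w, w ∈ u → ∃ z, z ∈ b ∧ zpair_in w z f)).

(** This uses ⟨x,y⟩ and not the BS4 pair (x,y): a Kuratowski pair is classical whatever its entries
    are, and the elements of W computed in HCL are such pairs. *)
Definition kpair_in (x y r : nat) : sform := ∃ p, bang (is_kpair p x y) ∧ p ∈ r.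

(* The graph of [x |-> (j[x^!], j[x^?])], in BZFC; [bang] makes it classical. *)
Definition j_BZFC : form := class2 (fun x y => bang (∃ f, kpair_in x y f ∧
  ∀ u v, kpair_in u v f → ∃ a b, classical a ∧ classical b ∧ bang (is_kpair v a b) ∧
    (∀ z, z ∈ a → ∃ w, w ∈ u ∧ kpair_in w z f) ∧ (∀ w, w ∈ u → ∃ z, z ∈ a ∧ kpair_in w z f) ∧
    (∀ z, z ∈ b → ∃ w, quest (w ∈ u) ∧ kpair_in w z f) ∧
    (∀ w, quest (w ∈ u) → ∃ z, z ∈ b ∧ kpair_in w z f))).

Local Close Scope sform_scope.

Lemma sat_j_ZFC (M : TFmodel) {HZ : ZF M} (s : nat -> M) : satT M s j_ZFC <-> J (s 0) (s 1).
Proof.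
  unfold j_ZFC, class2. eapply tvT; [tvs|]. unfold J, bis, img.
  assert (Q : forall x y : M, x ∊? y <-> x ∊ y) by (intros; apply inQ_classical, zf_classical).
  cbn. split; intros (f & H & Hf); exists f; (split; [apply zpairin_eq, H|]); intros u v Huv;
    apply zpairin_eq in Huv; destruct (Hf u v Huv) as (a & b & K); exists a, b.
  - destruct K as (E & K1 & K2 & K3 & K4). split; [apply zf_cl|]. split; [apply zf_cl|].
    split; [apply zpair_eq; auto|].
    split; split; intros z Hz; rewrite ?Q in Hz;
      [destruct (K1 z Hz) as (w & ? & ?)|destruct (K2 z Hz) as (w & ? & ?)
      |destruct (K3 z Hz) as (w & ? & ?)|destruct (K4 z Hz) as (w & ? & ?)];
      exists w; rewrite ?Q, <- zpairin_eq; auto.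
  - destruct K as (_ & _ & E & (K1 & K2) & (K3 & K4)).
    split; [apply zpair_eq; auto|].
    split; [|split; [|split]]; intros z Hz;
      [destruct (K1 z Hz) as (w & A & B)|destruct (K2 z Hz) as (w & A & B)
      |destruct (K3 z Hz) as (w & A & B)|destruct (K4 z (proj2 (Q _ _) Hz)) as (w & A & B)];
      exists w; rewrite ?Q in A; rewrite zpairin_eq; auto.
Qed.

Lemma ev_kpair_in {M : TFmodel} {HW : WS0 M} n (s : nat -> M) x y f a b c :
  s (n - S x) = a -> s (n - S y) = b -> s (n - S f) = c -> x < n -> y < n -> f < n ->
  ev M s (kpair_in x y f n) (kp a b ∊ c) (kp a b ∊? c).
Proof.
  intros. unfold kpair_in. eapply ev_conv; [evs| |]; cbn beta.
  - split; [intros (p & Hp & K); apply ikpair_eq in Hp as ->; auto|].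
    intros K; exists (kp a b); rewrite ikpair_eq; auto.
  - split; [intros (p & Hp & K); apply ikpair_eq in Hp as ->; auto|].
    intros K; exists (kp a b); rewrite ikpair_eq; auto.
Qed.

#[export] Hint Extern 0 (ev _ _ (kpair_in _ _ _ _) _ _) => eapply ev_kpair_in : ev.

Lemma ev_j_BZFC (M : TFmodel) {HW : WS0 M} (s : nat -> M) :
  ev M s j_BZFC (J (s 0) (s 1)) (J (s 0) (s 1)).
Proof.
  unfold j_BZFC, class2.
  eapply ev_conv with (P := exists f, kp (s 0) (s 1) ∊ f /\ forall u v, kp u v ∊ f ->
    exists a b, cl a /\ cl b /\ ikpair v a b /\
    (forall z, z ∊ a -> exists w, w ∊ u /\ kp w z ∊ f) /\ (forall w, w ∊ u -> exists z, z ∊ a /\ kp w z ∊ f) /\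
    (forall z, z ∊ b -> exists w, w ∊? u /\ kp w z ∊ f) /\ (forall w, w ∊? u -> exists z, z ∊ b /\ kp w z ∊ f)).
  - eapply ev_bang.
    evs.
  - unfold J, bis, img. split; intros (f & H & Hf); exists f; (split; [auto|]); intros u v Huv;
      destruct (Hf u v Huv) as (a & b & K1 & K2 & K3 & K); exists a, b;
      rewrite ikpair_eq in *; tauto.
  - unfold J, bis, img. split; intros (f & H & Hf); exists f; (split; [auto|]); intros u v Huv;
      destruct (Hf u v Huv) as (a & b & K1 & K2 & K3 & K); exists a, b;
      rewrite ikpair_eq in *; tauto.
Qed.

(** * The interpretations *)

Lemma ZFC_sentence q : ZFC q -> sentence q.
Proof. intros []; apply fvb_closure. Qed.

Lemma BZFC_sentence q : BZFC q -> sentence q.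
Proof. intros [[]| ->]; apply fvb_closure. Qed.

(** * Interpretation over a model of ZFC *)

Section InZFC.
Variable M : TFmodel.
Hypothesis HM : ZFCmodel M.
#[local] Instance InZFC_ZF : ZF M := ZFCmodel_ZF M HM.
#[local] Instance InZFC_BZ : BZ (WD (M := M)) := WD_BZ HM.
Local Notation V := (WD (M := M)).

Lemma models_W_T p : sentence p -> (modelsT M (W_T p) <-> modelsT V p).
Proof.
  intros Hp. pose proof (proj1 (fvb_WT p)) as Hf. unfold sentence in Hp.
  assert (E := proj1 (sat_WT p (fun _ => point V))). split.
  - intros H. apply models_sentence with (s := fun _ => point V); auto. apply E, H.
  - intros H. apply models_sentence with (s := fun i => wv (point V)); [unfold sentence; lia|].
    apply E, H.
Qed.

(** [WD] is itself a model of BZFC, so the identification of HCL with the hereditarily classical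
    sets applies inside it. *)
Lemma sat_HCL_in_W (s : nat -> M) : satT M s HCL_in_W <-> exists y : V, wv y = s 0 /\ HC y.
Proof.
  unfold HCL_in_W. cbn [satT]. rewrite sat_W.
  assert (E : forall y : V, wv y = s 0 -> (satT M s (W_T HCL) <-> HC y)).
  { intros y Hy. rewrite <- (iHCL_iff (WD_choice HM)).
    rewrite <- (proj1 (ev_HCL (scons y (fun _ => point V)))), (proj1 (sat_WT HCL _)).
    apply sat_agree. intros [|i] Hi; [symmetry; exact Hy|].
    pose proof (proj1 (fvb_WT HCL)). pose proof fvb_HCL. lia. }
  split.
  - intros [H K]. apply wv_ex in H as [y Hy]. exists y; split; auto. apply (E y Hy); auto.
  - intros (y & Hy & K). split; [rewrite <- Hy; apply wv_W|]. apply (E y Hy); auto.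
Qed.

Lemma ZFC_iso : modelsT M (class_iso j_ZFC HCL_in_W W_in W_notin W_eq W_neq).
Proof.
  pose proof (proj1 HM) as HC.
  apply class_iso_intro. intros s. cbv zeta.
  split; [intros; apply satF_classical; auto|].
  assert (E : forall x y, satT M (scons x (scons y s)) j_ZFC <-> J x y) by exact (fun x y => sat_j_ZFC M (scons x (scons y s))).
  split; [intros x; destruct (J_tot x) as [y Hy]; exists y; apply E; auto|].
  split; [intros x y z; rewrite !E; apply J_fun|].
  split; [intros x y; rewrite E, sat_HCL_in_W; apply (J_HCW HM)|].
  split; [intros x x' y; rewrite !E; apply J_inj|].
  split.
  { intros y. rewrite sat_HCL_in_W. cbn [scons]. intros (y' & <- & Hy).
    destruct (HCW_J HM y' Hy) as [x Hx]. exists x. apply E; auto. }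
  intros x y u v. rewrite !E, tv_W_in, tv_W_notin, tv_W_neq by auto. intros Hu Hv.
  destruct (J_HCW HM x u Hu) as (u' & <- & _), (J_HCW HM y v Hv) as (v' & <- & _).
  destruct (J_rel1 x y u' v' Hu Hv) as (R1 & R2 & R3 & R4).
  rewrite (proj1 HC), (proj2 HC). split; [|split; [|split]].
  - rewrite R1. split.
    + intros H. exists (pr1 (wv v')), (pr2 (wv v')). rewrite (pair_W (wv v')) by apply wv_W. auto.
    + intros (c & d & K & H). apply pair_W in K as [-> ->]; [auto|apply wv_W].
  - rewrite R2. split.
    + intros H. exists (pr1 (wv v')), (pr2 (wv v')). rewrite (pair_W (wv v')) by apply wv_W. auto.
    + intros (c & d & K & H). apply pair_W in K as [-> ->]; [auto|apply wv_W].
  - rewrite R3. split; [intros ->; reflexivity|apply wv_inj].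
  - rewrite R4. split.
    + intros H. exists (pr1 (wv u')), (pr2 (wv u')), (pr1 (wv v')), (pr2 (wv v')).
      rewrite (pair_W (wv u')), (pair_W (wv v')) by apply wv_W. auto.
    + intros (a & b & c & d & K & K' & H). apply pair_W in K as [-> ->]; [|apply wv_W].
      apply pair_W in K' as [-> ->]; [exact H|apply wv_W].
Qed.

(** Passing from [M] to its W and back to the HCL of that gives the theory of [M] again; this serves
    the ZFC half of the syntactic statement. *)
Lemma HCW_iso p : sentence p -> (modelsT (HCm V) p <-> modelsT M p).
Proof.
  intros Hp.
  assert (L : forall (y : HCm V), exists x, J x (wv (val y))).
  { intros y. apply (HCW_J HM), val_HC. }
  destruct (L (point (HCm V))) as [x0 Hx0].
  pose (R := fun x (y : HCm V) => J x (wv (val y))).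
  assert (I := sat_iso M (HCm V) R).
  assert (E : forall s s', (forall i, R (s i) (s' i)) -> (satT M s p <-> satT (HCm V) s' p)).
  { intros s s' Hs. apply I; auto.
    - intros x. destruct (J_tot x) as [y Hy]. destruct (J_HCW HM x y Hy) as (y' & <- & Hy').
      destruct (val_ex y' Hy') as [y <-]. exists y; exact Hy.
    - clear s s' Hs. intros x y u v Hu Hv.
      destruct (J_rel1 x y _ _ Hu Hv) as (R1 & R2 & R3 & R4).
      pose proof (proj1 HM) as [C1 C2]. pose proof (@N_classical V _) as [C3 C4].
      rewrite C1, C2, C3, C4.
      assert (E1 : x ∊ y <-> u ∊ v) by exact R1.
      assert (E2 : x = y <-> u = v) by (rewrite R3; split; [apply val_inj|intros ->; auto]).
      tauto. }
  assert (E0 := E (fun _ => x0) (fun _ => point (HCm V)) (fun _ => Hx0)).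
  split; intros H; [apply models_sentence with (fun _ => x0)
                   |apply models_sentence with (fun _ => point (HCm V))]; auto; apply E0, H.
Qed.
End InZFC.

(** * Interpretation over a model of BZFC *)

Section InBZFC.
Variable M : TFmodel.
Hypothesis HM : BZFCmodel M.
#[local] Instance InBZFC_BZ : BZ M := BZFCmodel_BZ M HM.
Let Hch : modelsT M ax_choice := BZFCmodel_choice M HM.
Local Notation N := (HCm M).
#[local] Instance InBZFC_ZF : ZF N := N_ZF Hch.
Local Notation V := (WD (M := N)).

Lemma sat_HCL_rel p (s : nat -> N) : satT M (fun i => val (s i)) (HCL_rel p) <-> satT N s p.
Proof. rewrite rsat_N. apply (HCL_rel_ev Hch). intros; apply val_HC. Qed.

Lemma models_HCL_rel p : sentence p -> (modelsT M (HCL_rel p) <-> modelsT N p).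
Proof.
  intros Hp. pose proof (fvb_HCL_rel p) as Hf. unfold sentence in Hp.
  assert (E := sat_HCL_rel p (fun _ => point N)). split.
  - intros H. apply models_sentence with (s := fun _ => point N); auto. apply E, H.
  - intros H. apply models_sentence with (s := fun i => val (point N)); [unfold sentence; lia|].
    apply E, H.
Qed.

Lemma sat_HCL_rel1 p (s : nat -> M) (x : N) : fvb p <= 1 -> val x = s 0 ->
  (satT M s (HCL_rel p) <-> satT N (scons x (fun _ => x)) p).
Proof.
  intros Hp Hx. rewrite <- sat_HCL_rel. apply sat_agree. intros [|i] Hi; [auto|].
  pose proof (fvb_HCL_rel p). lia.
Qed.

Lemma sat_HCL_rel2 p (s : nat -> M) (x y : N) : fvb p <= 2 ->
  (satT M (scons (val x) (scons (val y) s)) (HCL_rel p) <->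
   satT N (scons x (scons y (fun _ => x))) p).
Proof.
  intros Hp. rewrite <- sat_HCL_rel. apply sat_agree. intros [|[|i]] Hi; auto.
  pose proof (fvb_HCL_rel p). lia.
Qed.

Lemma sat_W_in_HCL (s : nat -> M) : satT M s W_in_HCL <-> WHC (s 0).
Proof.
  unfold W_in_HCL, WHC. cbn [satT]. rewrite (proj1 (ev_HCL s)), (iHCL_iff Hch). split.
  - intros [H K]. apply val_ex in H as [y Hy]. exists y; split; auto.
    apply (sat_HCL_rel1 W s y fvb_W Hy) in K. apply sat_W in K. exact K.
  - intros (y & Hy & K). split; [rewrite <- Hy; apply val_HC|].
    apply (sat_HCL_rel1 W s y fvb_W Hy). apply sat_W. exact K.
Qed.

Lemma J_val x y : J x y -> exists y' : V, val (wv y') = y.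
Proof. intros H. destruct (J_WHC Hch x y H) as (y' & <- & K). apply wv_ex in K as [v <-]. eauto. Qed.

Lemma J_rel_val (x y : M) (u v : V) : J x (val (wv u)) -> J y (val (wv v)) ->
  (x ∊ y <-> wv u ∊ pr1 (wv v)) /\ (x ∊? y <-> wv u ∊ pr2 (wv v)) /\
  (x = y <-> wv u = wv v) /\ (neq M x y <-> wneq (wv u) (wv v)).
Proof.
  assert (E : forall u : V, val (wv u) = kp (val (pr1 (wv u))) (val (pr2 (wv u)))).
  { intros w. rewrite <- (val_kp Hch). f_equal. apply Wc_eta, wv_W. }
  intros Hu Hv. rewrite E in Hu, Hv.
  destruct (J_rel2 x y _ _ _ _ Hu Hv) as (R1 & R2 & R3 & R4).
  rewrite <- E in R1, R2, R3. rewrite <- E in R3.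
  split; [exact R1|]. split; [exact R2|]. split.
  - rewrite R3. split; [apply val_inj|intros ->; auto].
  - rewrite R4. unfold wneq.
    assert (L : forall a b : N, (exists z, z ∊ val a /\ ~ z ∊ val b) <-> exists z, z ∊ a /\ ~ z ∊ b).
    { intros a b; split.
      - intros (z & Hz & K). destruct (val_ex z (HC_mem a z Hz)) as [z' <-]. exists z'; auto.
      - intros (z & Hz & K). exists (val z); auto. }
    rewrite !L. reflexivity.
Qed.

Lemma BZFC_iso : modelsT M (class_iso j_BZFC W_in_HCL (HCL_rel W_in) (HCL_rel W_notin)
  (HCL_rel W_eq) (HCL_rel W_neq)).
Proof.
  pose proof (@N_classical M _) as HC.
  apply class_iso_intro. intros s. cbv zeta.
  assert (E : forall x y, satT M (scons x (scons y s)) j_BZFC <-> J x y) by exact (fun x y => proj1 (ev_j_BZFC M (scons x (scons y s)))).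
  split; [intros x y; rewrite E; apply (proj2 (ev_j_BZFC M (scons x (scons y s))))|].
  split; [intros x; destruct (J_tot x) as [y Hy]; exists y; apply E; auto|].
  split; [intros x y z; rewrite !E; apply J_fun|].
  split; [intros x y; rewrite E, sat_W_in_HCL; apply (J_WHC Hch)|].
  split; [intros x x' y; rewrite !E; apply J_inj|].
  split.
  { intros y. rewrite sat_W_in_HCL. cbn [scons]. intros Hy.
    destruct (WHC_J Hch _ Hy) as [x Hx]. exists x. apply E; auto. }
  intros x y u v. rewrite !E. intros Hu Hv.
  destruct (J_val x u Hu) as [u' <-], (J_val y v Hv) as [v' <-].
  destruct (J_rel_val x y u' v' Hu Hv) as (R1 & R2 & R3 & R4).
  rewrite !sat_HCL_rel2 by (vm_compute; lia).
  rewrite tv_W_in, tv_W_notin, tv_W_neq by auto.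
  assert (R2' : inF M x y <-> ~ wv u' ∊ pr2 (wv v')) by (rewrite <- R2; split; [tauto|apply NNPP]).
  split; [|split; [|split]].
  - rewrite R1. split.
    + intros H. exists (pr1 (wv v')), (pr2 (wv v')). rewrite (pair_W (wv v')) by apply wv_W. auto.
    + intros (c & d & K & H). apply (pair_W (wv v')) in K as [-> ->]; [auto|apply wv_W].
  - rewrite R2'. split.
    + intros H. exists (pr1 (wv v')), (pr2 (wv v')). rewrite (pair_W (wv v')) by apply wv_W. auto.
    + intros (c & d & K & H). apply (pair_W (wv v')) in K as [-> ->]; [auto|apply wv_W].
  - rewrite R3. reflexivity.
  - rewrite R4. split.
    + intros H. exists (pr1 (wv u')), (pr2 (wv u')), (pr1 (wv v')), (pr2 (wv v')).
      cbn [scons]. rewrite (pair_W (wv u')), (pair_W (wv v')) by apply wv_W. auto.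
    + intros (a & b & c & d & K & K' & H). apply (pair_W (wv u')) in K as [-> ->]; [|apply wv_W].
      apply (pair_W (wv v')) in K' as [-> ->]; [exact H|apply wv_W].
Qed.

(** The counterpart of [HCW_iso] starting from a model of BZFC, with the isomorphism carrying
    falsity as well as truth. *)
Lemma WHC_iso p : sentence p -> (modelsT V p <-> modelsT M p).
Proof.
  intros Hp.
  assert (L : forall y : V, exists x, J x (val (wv y))).
  { intros y. apply (WHC_J Hch). exists (wv y); split; auto. apply wv_W. }
  destruct (L (point V)) as [x0 Hx0].
  pose (R := fun x (y : V) => J x (val (wv y))).
  assert (I := sat_iso M V R).
  assert (E : forall s s', (forall i, R (s i) (s' i)) -> (satT M s p <-> satT V s' p)).
  { intros s s' Hs. apply I; auto.
    - intros x. destruct (J_tot x) as [y Hy]. destruct (J_val x y Hy) as [y' <-]. exists y'; exact Hy.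
    - clear s s' Hs. intros x y u v Hu Hv.
      destruct (J_rel_val x y _ _ Hu Hv) as (R1 & R2 & R3 & R4).
      split; [exact R1|]. split; [|split; [|exact R4]].
      + rewrite <- w_inQ in R2. destruct (classic (inF M x y)), (classic (inF V u v)); tauto.
      + rewrite R3. split; [apply wv_inj|intros ->; auto]. }
  assert (E0 := E (fun _ => x0) (fun _ => point V) (fun _ => Hx0)).
  split; intros H; [apply models_sentence with (fun _ => x0)
                   |apply models_sentence with (fun _ => point V)]; auto; apply E0, H.
Qed.
End InBZFC.

Lemma HCm_model M (HB : BZFCmodel M) : ZFCmodel (@HCm M (@BZ_WS M (BZFCmodel_BZ M HB))).
Proof. apply HCm_ZFC, BZFCmodel_choice, HB. Qed.

Theorem theorem9p1 :
  (* (1) *)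
  ((forall p, BZFC p -> CL_proves ZFC (W_T p)) /\
   (exists j, fvb j <= 2 /\
      CL_proves ZFC (class_iso j HCL_in_W W_in W_notin W_eq W_neq))) /\
  (* (2) *)
  ((forall p, ZFC p -> BS4_proves BZFC (HCL_rel p)) /\
   (exists j, fvb j <= 2 /\
      BS4_proves BZFC
        (class_iso j W_in_HCL (HCL_rel W_in) (HCL_rel W_notin)
                     (HCL_rel W_eq) (HCL_rel W_neq)))) /\
  (* (3) *)
  (forall p, sentence p ->
     (CL_proves ZFC p <-> BS4_proves BZFC (HCL_rel p)) /\
     (BS4_proves BZFC p <-> CL_proves ZFC (W_T p))).
Proof.
  split; [split|split; [split|]].
  - intros p Hp. apply CL_complete; [exact ZFC_sentence|]. intros M HC HM.
    apply (models_W_T M (conj HC HM)); [apply BZFC_sentence; auto|].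
    apply WD_BZFC; auto. split; auto.
  - exists j_ZFC. split; [vm_compute; lia|].
    apply CL_complete; [exact ZFC_sentence|]. intros M HC HM. apply ZFC_iso. split; auto.
  - intros p Hp M HM. apply (models_HCL_rel M HM); [apply ZFC_sentence; auto|].
    apply (HCm_model M HM); auto.
  - exists j_BZFC. split; [vm_compute; lia|]. intros M HM. apply BZFC_iso; auto.
  - intros p Hp. split; split.
    + intros H M HM. apply (models_HCL_rel M HM); auto.
      apply (CL_sound ZFC p H); apply (HCm_model M HM).
    + intros H. apply CL_complete; [exact ZFC_sentence|]. intros M HC HM.
      assert (HZ : ZFCmodel M) by (split; auto).
      (* [M] is replaced by the HCL of its own W; the hypothesis is available there, because W is a
         model of BZFC. *)
      apply (HCW_iso M HZ p Hp).
      pose proof (WD_BZFC (HZ := ZFCmodel_ZF M HZ) HZ) as HW.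
      pose proof (proj1 (models_HCL_rel _ HW p Hp) (H _ HW)) as K.
      (* The type of the inner model mentions the proof that W satisfies the axioms; the two proofs
         in play are identified. *)
      rewrite (proof_irrelevance _ (InZFC_BZ M HZ) (InBZFC_BZ _ HW)). exact K.
    + intros H. apply CL_complete; [exact ZFC_sentence|]. intros M HC HM.
      assert (HZ : ZFCmodel M) by (split; auto).
      apply (models_W_T M HZ); auto. apply H.
      apply (WD_BZFC (HZ := ZFCmodel_ZF M HZ) HZ).
    (* [M] is replaced by the W of its own HCL. Soundness gives the translated sentence in HCL, a
       model of ZFC, and this means truth in that W. *)
    + intros H M HM. apply (WHC_iso M HM p Hp).
      pose proof (CL_sound ZFC _ H _ (proj1 (HCm_model M HM)) (proj2 (HCm_model M HM))) as K.
      apply (models_W_T _ (HCm_model M HM)) in K; auto.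
      rewrite (proof_irrelevance _ (InBZFC_ZF M HM) (InZFC_ZF _ (HCm_model M HM))). exact K.
Qed.
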